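(* Let either ($s>2$ and $r\ge 2$) or ($s\ge 1$ and $r>3$), where $r$ is the decay rate in the kernel condition $0\le\widehat\beta(\xi)\le C(1+|\xi|^2)^{-r/2}$ ($\xi\in\mathbb{R}^2$). Let $\tilde F\in C^{[s]+1}(\mathbb{R}^2)$ with $\tilde F(0,0)=0$, let $\varphi,\psi\in X^s$, and let $w$ be the solution of the Cauchy problem $$w_{tt}=\left(\beta*\frac{\partial \tilde F}{\partial w_x}(\nabla w)\right)_x+\left(\beta*\frac{\partial \tilde F}{\partial w_y}(\nabla w)\right)_y,\quad (x,y)\in\mathbb{R}^2,\ t>0,$$ $$w(x,y,0)=\varphi(x,y),\qquad w_t(x,y,0)=\psi(x,y).$$ Suppose $R\varphi,R\psi\in L^2(\mathbb{R}^2)$ and $\tilde F(\nabla\varphi)\in L^1(\mathbb{R}^2)$. If there exists a positive number $\nu$ such that $$U\cdot\nabla\tilde F(U)\le 2(1+2\nu)\tilde F(U)\quad\text{for all }U\in\mathbb{R}^2,$$ and $$E(0)=\tfrac12\|R\psi\|^2+\int_{\mathbb{R}^2}\tilde F(\nabla\varphi)\,dx\,dy<0,$$ then the solution $w$ of the Cauchy problem blows up in finite time.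
   Context: The kernel $\beta:\mathbb{R}^2\to\mathbb{R}$ is integrable and its Fourier transform $\widehat\beta(\xi)=\int_{\mathbb{R}^2}e^{-iz\cdot\xi}\beta(z)\,dz$ satisfies $0\le\widehat\beta(\xi)\le C(1+|\xi|^2)^{-r/2}$ for all $\xi\in\mathbb{R}^2$, for some constants $C>0$ and $r$; $r$ is called the decay rate. $\beta*u$ denotes convolution over $\mathbb{R}^2$. Here $\tilde F=\tilde F(w_x,w_y)=\tilde F(\nabla w)$ is a general (anisotropic) nonlinearity, and $\frac{\partial\tilde F}{\partial w_x},\frac{\partial\tilde F}{\partial w_y}$ are its partial derivatives with respect to its first and second arguments, evaluated at $\nabla w$. $[s]$ is the integer part of $s$; $\|\cdot\|$ is the $L^2(\mathbb{R}^2)$ norm. $H^s(\mathbb{R}^2)$ is the $L^2$ Sobolev space with norm $\|u\|_s^2=\int_{\mathbb{R}^2}(1+|\xi|^2)^s|\widehat u(\xi)|^2d\xi$. The Banach space $X^s=\{w\in H^s(\mathbb{R}^2): w_x,w_y\in L^\infty(\mathbb{R}^2)\}$ has norm $\|w\|_{X^s}=\|w\|_s+\|w_x\|_{L^\infty}+\|w_y\|_{L^\infty}$ (for $s>2$, $X^s=H^s(\mathbb{R}^2)$ with equivalent norms). A solution is a function $t\mapsto w(t)$ of class $C^2$ with values in $X^s$ satisfying the equation for each $t$ (derivatives in the distribution sense) together with the initial conditions. Under the stated conditions on $s,r$ the problem is locally well posed in $X^s$ and the solution extends to a maximal interval $[0,T_{\max})$; finite $T_{\max}$ is characterized by $\limsup_{t\to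 T_{\max}^-}(\|w(t)\|_{X^s}+\|w_t(t)\|_{X^s})=\infty$. The solution blows up in finite time if $T_{\max}<\infty$, i.e. there is no global solution. $R$ is the unbounded linear operator $Ru=\mathcal{F}^{-1}\big((\widehat\beta(\xi))^{-1/2}\widehat u(\xi)\big)$, where $\mathcal{F}^{-1}$ is the inverse Fourier transform; $Ru\in L^2$ means that $\widehat\beta^{-1/2}\widehat u\in L^2$ (where $\widehat\beta=0$, $\widehat u$ is required to vanish a.e. and the product is read as $0$). *)

(* Defs.v *)
From HB Require Import structures.
From mathcomp Require Import all_boot all_order all_algebra.
From mathcomp Require Import complex.
From mathcomp Require Import all_classical all_reals all_analysis.

Set Implicit Arguments.
Unset Strict Implicit.
Unset Printing Implicit Defensive.

Import Order.TTheory GRing.Theory Num.Theory.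
Import numFieldNormedType.Exports.

Local Open Scope classical_set_scope.
Local Open Scope complex_scope.
Local Open Scope ring_scope.

(** Functions on the plane are everywhere-defined functions [R * R -> R];
    spaces, norms and operators below depend on them only up to a.e. equality.
    Operators that are only determined a.e. or only exist on a subspace
    (weak derivatives, the L^2 Fourier transform and its inverse) pick a
    representative with [xget] and are 0 when none exists. *)

Section Plane.
Context {R : realType}.
Implicit Types (u v g b F : R * R -> R) (f h : R * R -> R[i]) (z xi e : R * R).

Definition leb2 :
    {measure set (measurableTypeR R * measurableTypeR R) -> \bar R} :=
  (@lebesgue_measure R \x @lebesgue_measure R)%E.

Definition e1 : R * R := (1, 0).
Definition e2 : R * R := (0, 1).

Definition dot2 z xi : R := z.1 * xi.1 + z.2 * xi.2.

Definition box (n : nat) : set (R * R) :=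
  `[- n%:R, n%:R]%classic `*` `[- n%:R, n%:R]%classic.

Fixpoint Ck (k : nat) u : Prop :=
  continuous u /\
  if k is k'.+1 then
    [/\ forall z, derivable u z e1, forall z, derivable u z e2,
        Ck k' (fun z => 'D_e1 u z) & Ck k' (fun z => 'D_e2 u z)]
  else True.

Definition test_function u : Prop :=
  (forall k, Ck k u) /\ compact (closure [set z | u z != 0]).

Definition locally_integrable2 u : Prop :=
  measurable_fun [set: measurableTypeR R * measurableTypeR R] u /\
  forall n, leb2.-integrable (box n) (EFin \o u).

Definition is_weak_deriv e u v : Prop :=
  [/\ locally_integrable2 u, locally_integrable2 v &
      forall theta, test_function theta ->
        \int[leb2]_z (u z * 'D_e theta z) = - \int[leb2]_z (v z * theta z)].

Definition weakly_derivable e u : Prop := exists v, is_weak_deriv e u v.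

Definition weakD e u : R * R -> R :=
  xget (fun=> 0) [set v | is_weak_deriv e u v].

Definition wgrad u z : R * R := (weakD e1 u z, weakD e2 u z).

(** Fourier transform, with the convention
    fhat(xi) = \int e^{-i z.xi} f(z) dz, so that the inverse carries the
    factor (2 pi)^-2 *)

Definition toC u z : R[i] := (u z)%:C.

Definition cintegral (D : set (R * R)) f : R[i] :=
  (\int[leb2]_(z in D) complex.Re (f z)) +i*
  (\int[leb2]_(z in D) complex.Im (f z)).

Definition expi (t : R) : R[i] := cos t +i* sin t.

Definition fourier f xi : R[i] :=
  cintegral setT (fun z => expi (- dot2 z xi) * f z).

Definition L2C f : Prop :=
  (fun z => complex.Re (f z)) \in Lfun leb2 2%:E /\
  (fun z => complex.Im (f z)) \in Lfun leb2 2%:E.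

Definition norm2 f : \bar R := ('N[leb2]_2%:E[EFin \o (@Normc.normc R \o f)])%E.

(** On L^2 the integral over the plane need not converge: the transforms are
    the L^2 limits (Plancherel) of the integrals over growing boxes. *)
Definition fourierL2 f : R * R -> R[i] :=
  xget (fun=> 0) [set h | L2C h /\
    norm2 (fun xi =>
      cintegral (box n) (fun z => expi (- dot2 z xi) * f z) - h xi)
    @[n --> \oo] --> 0%E].

Definition ifourierL2 h : R * R -> R[i] :=
  xget (fun=> 0) [set f | L2C f /\
    norm2 (fun z =>
      ((2 * pi) ^- 2)%:C *
        cintegral (box n) (fun xi => expi (dot2 z xi) * h xi) - f z)
    @[n --> \oo] --> 0%E].

(** Only meant for [0 <= s], where H^s is contained in L^2. *)
Definition Hnorm (s : R) u : \bar R :=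
  ((\int[leb2]_xi ((1 + dot2 xi xi) `^ s *
      Normc.normc (fourierL2 (toC u) xi) ^+ 2)%:E) `^ 2^-1)%E.

Definition in_Hs (s : R) u : Prop :=
  u \in Lfun leb2 2%:E /\ (Hnorm s u < +oo)%E.

Definition norm_oo u : \bar R := ('N[leb2]_+oo[EFin \o u])%E.

Definition Xnorm (s : R) u : \bar R :=
  (Hnorm s u + norm_oo (weakD e1 u) + norm_oo (weakD e2 u))%E.

Definition in_Xs (s : R) u : Prop :=
  [/\ in_Hs s u, weakly_derivable e1 u, weakly_derivable e2 u,
      weakD e1 u \in Lfun leb2 +oo%E & weakD e2 u \in Lfun leb2 +oo%E].

(** The order of [R[i]] makes [0 <= x <= y] imply that [x] is real. *)
Definition kernel_decay b (C r : R) : Prop :=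
  forall xi, 0 <= fourier (toC b) xi <= (C * (1 + dot2 xi xi) `^ (- (r / 2)))%:C.

Definition convol b g z : R := \int[leb2]_y (b (z - y) * g y).

(** Since [0 `^ p = 0] for [p != 0], the product is 0 where bhat vanishes. *)
Definition Rsymbol b u xi : R[i] :=
  (complex.Re (fourier (toC b) xi) `^ (- 2^-1))%:C * fourierL2 (toC u) xi.

Definition Rop b u : R * R -> R[i] := ifourierL2 (Rsymbol b u).

Definition Rop_in_L2 b u : Prop :=
  [/\ u \in Lfun leb2 2%:E,
      {ae leb2, forall xi, fourier (toC b) xi = 0 -> fourierL2 (toC u) xi = 0} &
      L2C (Rsymbol b u)].

(** Initial energy; real-valued, meaningful when [Rop_in_L2 b psi] and
    [F \o wgrad phi] is integrable *)
Definition energy0 b F phi psi : R :=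
  2^-1 * fine (norm2 (Rop b psi)) ^+ 2 + \int[leb2]_z F (wgrad phi z).

Definition time_interval (T : \bar R) : set R :=
  [set t | 0 <= t /\ (t%:E < T)%E].

(** Limits of curves are relative to [0, T[, hence one-sided at 0. *)
Definition Xcontinuous (s : R) (T : \bar R) (w : R -> R * R -> R) : Prop :=
  forall t, time_interval T t ->
    Xnorm s (fun z => w t' z - w t z)
      @[t' --> within (time_interval T) (nbhs t)] --> 0%E.

Definition Xderiv (s : R) (T : \bar R) (w w' : R -> R * R -> R) : Prop :=
  forall t, time_interval T t ->
    Xnorm s (fun z => (t' - t)^-1 * (w t' z - w t z) - w' t z)
      @[t' --> within (time_interval T) (t^')] --> 0%E.

(** The equation is tested against smooth compactly supported functions, i.e.
    its space derivatives are taken in the sense of distributions. *)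
Definition is_solution b F (s : R) phi psi (T : \bar R)
    (w : R -> R * R -> R) : Prop :=
  exists wt wtt : R -> R * R -> R,
  [/\ (forall t, time_interval T t ->
        [/\ in_Xs s (w t), in_Xs s (wt t) & in_Xs s (wtt t)]),
      [/\ Xderiv s T w wt, Xderiv s T wt wtt & Xcontinuous s T wtt],
      w 0 = phi %[ae leb2],
      wt 0 = psi %[ae leb2] &
      forall t, 0 < t -> (t%:E < T)%E ->
      forall theta, test_function theta ->
        \int[leb2]_z (wtt t z * theta z) =
        (- \int[leb2]_z
            (convol b (fun y => 'D_e1 F (wgrad (w t) y)) z * 'D_e1 theta z))
        + (- \int[leb2]_z
            (convol b (fun y => 'D_e2 F (wgrad (w t) y)) z * 'D_e2 theta z))].

(** [Tmax = +oo] is allowed; maximality means that [w] has no proper extension,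
    solutions being identified when they agree a.e. at each time. *)
Definition maximal_solution b F (s : R) phi psi (Tmax : \bar R)
    (w : R -> R * R -> R) : Prop :=
  [/\ (0 < Tmax)%E, is_solution b F s phi psi Tmax w &
      forall (T : \bar R) (v : R -> R * R -> R), is_solution b F s phi psi T v ->
        (forall t, time_interval Tmax t -> v t = w t %[ae leb2]) ->
        (T <= Tmax)%E].

Definition global_solution b F (s : R) phi psi (w : R -> R * R -> R) : Prop :=
  is_solution b F s phi psi +oo%E w.

End Plane.

(* Main.v *)
Require Import Defs.
From HB Require Import structures.
From mathcomp Require Import all_boot all_order all_algebra.
From mathcomp Require Import complex.
From mathcomp Require Import all_classical all_reals all_analysis.
From mathcomp Require Import ring lra measurable_realfun ess_sup_inf.
Import Order.TTheory GRing.Theory Num.Theory.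
Import numFieldNormedType.Exports.
Local Open Scope classical_set_scope.
Local Open Scope ring_scope.

(** By maximality it suffices to exclude a solution [w] defined for all times. Formally,
    [E(t) = 1/2 |R w_t|^2 + \int F(grad w)] is conserved and, with [b = - E(0) / 2],
    [h(t) = |R w|^2 + b (t + t0)^2] satisfies [h h'' >= (1 + nu) h'^2], so that [h / h'] decreases
    at rate [nu] at least while [h' > 0] and vanishes before some time [T]: this is Levine's
    concavity argument.

    To avoid proving that [R w(t)] stays in [L^2] and is differentiable there, both quantities are cut
    off at the frequencies where [bhat >= 1/n]. On [bhat = 0] the transforms of [w] and [w_t] vanish
    for all times, because that of [w_tt] does. On [0 < bhat < 1/n] the equation bounds the error in
    terms of the transforms of [w] and [w_t] multiplied by [(1 + |xi|^2)^(1/2)], which are continuous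
    curves in [L^2]; hence the error tends to [0] uniformly on [[0, T]]. As [T] and [t0] do not depend
    on [n], one cutoff yields the contradiction.

    On real functions the Fourier transform is replaced by the Hartley transform, with kernel
    [cos (z.xi) + sin (z.xi)]: its even and odd parts are, up to sign, the real and imaginary parts
    of the Fourier transform, and it is real, symmetric, and an involution up to [(2 pi)^2]. *)

Set Implicit Arguments.
Unset Strict Implicit.
Unset Printing Implicit Defensive.

(** * Integrals of real functions and square-integrable functions *)

Section AlmostEverywhere.
Context d (T : measurableType d) (R : realType) (mu : {measure set T -> \bar R}).
Implicit Types P Q S U : T -> Prop.

Lemma ae_imp P Q : (forall x, P x -> Q x) ->
  {ae mu, forall x, P x} -> {ae mu, forall x, Q x}.
Proof. exact: filterS. Qed.

Lemma ae_imp2 P Q S : (forall x, P x -> Q x -> S x) ->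
  {ae mu, forall x, P x} -> {ae mu, forall x, Q x} -> {ae mu, forall x, S x}.
Proof. exact: filterS2. Qed.

Lemma ae_imp3 P Q S U : (forall x, P x -> Q x -> S x -> U x) ->
  {ae mu, forall x, P x} -> {ae mu, forall x, Q x} -> {ae mu, forall x, S x} ->
  {ae mu, forall x, U x}.
Proof. exact: filterS3. Qed.

Lemma ae_all P : (forall x, P x) -> {ae mu, forall x, P x}.
Proof. by move=> h; apply: nearW. Qed.

End AlmostEverywhere.

Section RealIntegral.
Context d (T : measurableType d) (R : realType) (mu : {measure set T -> \bar R}).
Implicit Types (f g h : T -> R) (a b c : R).

Definition L1 f : Prop := mu.-integrable setT (EFin \o f).

Lemma L1_meas f : L1 f -> measurable_fun setT f.
Proof. by move=> /integrableP[/measurable_EFinP]. Qed.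

Lemma L1_dom f g : measurable_fun setT f -> (forall x, `|f x| <= g x) ->
  L1 g -> L1 f.
Proof.
move=> mf fg; apply: le_integrable => //; first exact/measurable_EFinP.
by move=> x _ /=; rewrite lee_fin (le_trans (fg x)) ?ler_norm.
Qed.

Lemma L1_lty f : measurable_fun setT f ->
  (\int[mu]_x `|f x|%:E < +oo)%E -> L1 f.
Proof. by move=> mf fo; apply/integrableP; split => //; exact/measurable_EFinP. Qed.

Lemma L1D f g : L1 f -> L1 g -> L1 (fun x => f x + g x).
Proof. by move=> If Ig; have := integrableD measurableT If Ig; apply: eq_integrable. Qed.

Lemma L1Z c f : L1 f -> L1 (fun x => c * f x).
Proof. by move=> If; have := integrableZl measurableT c If; apply: eq_integrable. Qed.

Lemma L1N f : L1 f -> L1 (fun x => - f x).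
Proof. by move=> /(L1Z (-1)); congr L1; apply/funext => x; rewrite mulN1r. Qed.

Lemma L1B f g : L1 f -> L1 g -> L1 (fun x => f x - g x).
Proof. by move=> If /L1N; exact: L1D. Qed.

Lemma L1_0 : L1 (fun=> 0).
Proof. exact: integrable0. Qed.

Lemma L1_abs f : L1 f -> L1 (fun x => `|f x|).
Proof.
move=> If; apply: (@L1_dom _ (fun x => `|f x|)) => //.
- by apply: measurableT_comp => //; exact: L1_meas.
- by move=> x; rewrite normr_id.
- by have := integrable_abse If; apply: eq_integrable.
Qed.

Lemma L1_bdM f g c : measurable_fun setT g -> (forall x, `|g x| <= c) ->
  L1 f -> L1 (fun x => f x * g x).
Proof.
move=> mg gc If; apply: (@L1_dom _ (fun x => c * `|f x|)).
- by apply: measurable_funM => //; exact: L1_meas.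
- by move=> x; rewrite normrM mulrC ler_wpM2r.
- exact/L1Z/L1_abs.
Qed.

Lemma L1_EFin f : L1 f -> (\int[mu]_x (f x)%:E)%E = (\int[mu]_x f x)%:E.
Proof. by move=> If; rewrite fineK// integrable_fin_num. Qed.

Lemma RintD f g : L1 f -> L1 g ->
  \int[mu]_x (f x + g x) = \int[mu]_x f x + \int[mu]_x g x.
Proof. exact: RintegralD. Qed.

Lemma RintB f g : L1 f -> L1 g ->
  \int[mu]_x (f x - g x) = \int[mu]_x f x - \int[mu]_x g x.
Proof. exact: RintegralB. Qed.

Lemma RintZ c f : L1 f -> \int[mu]_x (c * f x) = c * \int[mu]_x f x.
Proof. exact: RintegralZl. Qed.

Lemma RintN f : L1 f -> \int[mu]_x (- f x) = - \int[mu]_x f x.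
Proof.
move=> If; rewrite -mulN1r -RintZ//; congr Rintegral.
by apply/funext => x; rewrite mulN1r.
Qed.

Lemma Rint_le f g : L1 f -> L1 g -> (forall x, f x <= g x) ->
  \int[mu]_x f x <= \int[mu]_x g x.
Proof. by move=> If Ig fg; apply: le_Rintegral. Qed.

Lemma Rint_ge0 f : (forall x, 0 <= f x) -> 0 <= \int[mu]_x f x.
Proof. by move=> f0; apply: Rintegral_ge0. Qed.

Lemma Rint_abs f : L1 f -> `|\int[mu]_x f x| <= \int[mu]_x `|f x|.
Proof. exact: le_normr_Rintegral. Qed.

Lemma L1_ae f g : measurable_fun setT g -> {ae mu, forall x, f x = g x} ->
  L1 f -> L1 g.
Proof.
move=> mg fg If; apply: L1_lty => //.
have mf := L1_meas If.
rewrite -(@ge0_ae_eq_integral _ _ _ _ _ (EFin \o (fun x => `|f x|)))//=.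
- by move/integrableP : If => [].
- by apply/measurable_EFinP; exact: measurableT_comp.
- by apply/measurable_EFinP; exact: measurableT_comp.
- by apply: filterS fg => x /= -> _.
Qed.

Lemma Rint_ae f g : measurable_fun setT f -> measurable_fun setT g ->
  {ae mu, forall x, f x = g x} -> \int[mu]_x f x = \int[mu]_x g x.
Proof.
move=> mf mg fg; congr fine; apply: ae_eq_integral => //.
- exact/measurable_EFinP.
- exact/measurable_EFinP.
- by apply: filterS fg => x /= -> _.
Qed.

Lemma Rint_eq0_ae f : L1 f -> (forall x, 0 <= f x) -> \int[mu]_x f x = 0 ->
  {ae mu, forall x, f x = 0}.
Proof.
move=> If f0 fI; have mf := L1_meas If.
have : ae_eq mu setT (EFin \o f) (cst 0%E).
  apply/ae_eq_integral_abs => //; first exact/measurable_EFinP.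
  under eq_integral => x _ do rewrite /= ger0_norm//.
  by rewrite L1_EFin// fI.
by apply: filterS => x /= /(_ I) [].
Qed.

Lemma Rint_fatou (f_ : nat -> T -> R) f (M : R) :
  (forall n, L1 (f_ n)) -> (forall n x, 0 <= f_ n x) ->
  measurable_fun setT f ->
  {ae mu, forall x, f_ ^~ x @ \oo --> f x} ->
  (forall n, \int[mu]_x f_ n x <= M) ->
  L1 f /\ \int[mu]_x `|f x| <= M.
Proof.
move=> If f0 mf cvf fM.
have mfn n : measurable_fun setT (EFin \o f_ n) by have /integrableP[] := If n.
have key : (\int[mu]_x `|f x|%:E <= M%:E)%E.
  rewrite (@ge0_ae_eq_integral _ _ _ _ _ _ (fun x => limn_einf (fun n => (f_ n x)%:E)))//=.
  - apply: (le_trans (fatou mu measurableT mfn _)) => [n x _|].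
      by rewrite lee_fin.
    rewrite limn_einf_lim; apply: lime_le.
      by apply: is_cvg_einfs.
    near=> n; apply: (@le_trans _ _ (\int[mu]_x (f_ n x)%:E)%E).
      by apply: ereal_inf_lbound; exists n => //=.
    by rewrite L1_EFin// lee_fin.
  - by apply/measurable_EFinP; exact: measurableT_comp.
  - rewrite /limn_einf; apply: measurableT_comp => //.
    apply: (@measurable_fun_limn_esup _ _ _ _ (fun n x => - (f_ n x)%:E)%E) => n.
    by apply/measurable_EFinP; apply: measurableT_comp => //; exact: L1_meas.
  - move=> x _; rewrite limn_einf_lim; apply: lime_ge; first exact: is_cvg_einfs.
    by near=> n; apply: le_ereal_inf_tmp => _ [k _ <-]; rewrite lee_fin.
  apply: filterS cvf => x /= cvx _.
  have c2 : (f_ n x)%:E @[n --> \oo] --> (f x)%:E by apply: cvg_EFin => //; near=> n.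
  rewrite is_cvg_limn_einfE; last by apply/cvg_ex; eexists; exact: c2.
  rewrite (cvg_lim _ c2)//.
  rewrite ger0_norm//.
  by rewrite -(cvg_lim _ cvx)//; apply: limr_ge; [apply/cvg_ex; exists (f x)|near=> n].
have If' : L1 f by apply: L1_lty => //; rewrite (le_lt_trans key)// ltry.
split=> //; rewrite -lee_fin -L1_EFin//; exact: L1_abs.
Unshelve. all: by end_near. Qed.

Lemma Rint_dct (f_ : nat -> T -> R) f g :
  (forall n, measurable_fun setT (f_ n)) -> measurable_fun setT f ->
  {ae mu, forall x, f_ ^~ x @ \oo --> f x} -> L1 g ->
  (forall n x, `|f_ n x| <= g x) ->
  \int[mu]_x f_ n x @[n --> \oo] --> \int[mu]_x f x.
Proof.
move=> mfn mf cvf Ig fg.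
have mfn' n : measurable_fun setT (EFin \o f_ n) by exact/measurable_EFinP.
have mf' : measurable_fun setT (EFin \o f) by exact/measurable_EFinP.
have [] := @dominated_convergence _ _ _ mu setT measurableT
  (fun n => EFin \o f_ n) (EFin \o f) (EFin \o g) mfn' mf' _ Ig _.
- apply: filterS cvf => x cvx _ /=.
  by apply: cvg_EFin => //; near=> n.
- by apply: nearW => x n _ /=; rewrite lee_fin.
move=> If _ cv.
have -> : (fun n => \int[mu]_x f_ n x) = fine \o (fun n => (\int[mu]_x (f_ n x)%:E)%E) by [].
apply: fine_cvg; rewrite /Rintegral fineK//; exact: integrable_fin_num.
Unshelve. all: by end_near. Qed.

End RealIntegral.

Section SquareIntegrable.
Context d (T : measurableType d) (R : realType) (mu : {measure set T -> \bar R}).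
Implicit Types (f g h : T -> R) (a b c : R).

Definition L2 f : Prop := measurable_fun setT f /\ L1 mu (fun x => f x ^+ 2).
Definition ip f g : R := \int[mu]_x (f x * g x).

Lemma L2_L1M f g : L2 f -> L2 g -> L1 mu (fun x => f x * g x).
Proof.
move=> [mf If] [mg Ig].
apply: (@L1_dom _ _ _ _ _ (fun x => f x ^+ 2 + g x ^+ 2)).
- exact: measurable_funM.
- move=> x; rewrite ler_norml; apply/andP; split; nra.
- exact: L1D.
Qed.

Lemma L2_dom f g : measurable_fun setT f -> (forall x, `|f x| <= `|g x|) ->
  L2 g -> L2 f.
Proof.
move=> mf fg [_ Ig]; split => //; apply: L1_dom Ig.
- exact: measurable_funX.
- by move=> x; rewrite normrX -(real_normK (num_real (g x))) lerXn2r// nnegrE.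
Qed.

Lemma L2D f g : L2 f -> L2 g -> L2 (fun x => f x + g x).
Proof.
move=> Lf Lg; split; first by apply: measurable_funD; [case: Lf|case: Lg].
rewrite (_ : (fun x => _) = fun x => f x ^+ 2 + (2 * (f x * g x) + g x ^+ 2)).
  by apply: L1D; [case: Lf|apply: L1D; [apply/L1Z/L2_L1M|case: Lg]].
by apply/funext => x; ring.
Qed.

Lemma L2Z c f : L2 f -> L2 (fun x => c * f x).
Proof.
move=> [mf If]; split; first exact: measurable_funM.
rewrite (_ : (fun x => _) = fun x => c ^+ 2 * f x ^+ 2); first exact: L1Z.
by apply/funext => x; ring.
Qed.

Lemma L2N f : L2 f -> L2 (fun x => - f x).
Proof. by move=> /(L2Z (-1)); congr L2; apply/funext => x; rewrite mulN1r. Qed.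

Lemma L2B f g : L2 f -> L2 g -> L2 (fun x => f x - g x).
Proof. by move=> Lf /L2N; exact: L2D. Qed.

Lemma L2_bdM f g c : measurable_fun setT g -> (forall x, `|g x| <= c) ->
  L2 f -> L2 (fun x => f x * g x).
Proof.
move=> mg gc [mf If].
apply: (@L2_dom _ (fun x => c * f x)); last exact: L2Z.
- exact: measurable_funM.
- move=> x; have c0 : 0 <= c by rewrite (le_trans _ (gc x)).
  by rewrite !normrM (ger0_norm c0) mulrC ler_wpM2r.
Qed.

Lemma L2_ae f g : measurable_fun setT g -> {ae mu, forall x, f x = g x} ->
  L2 f -> L2 g.
Proof.
move=> mg fg [mf If]; split => //; apply: L1_ae If; first exact: measurable_funX.
by apply: filterS fg => x /= ->.
Qed.

Lemma ipC f g : ip f g = ip g f.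
Proof. by congr Rintegral; apply/funext => x; rewrite mulrC. Qed.

Lemma ipDl f g h : L2 f -> L2 g -> L2 h ->
  ip (fun x => f x + g x) h = ip f h + ip g h.
Proof.
move=> Lf Lg Lh; rewrite /ip -RintD; try exact: L2_L1M.
by congr Rintegral; apply/funext => x; rewrite mulrDl.
Qed.

Lemma ipZl c f h : L2 f -> L2 h -> ip (fun x => c * f x) h = c * ip f h.
Proof.
move=> Lf Lh; rewrite /ip -RintZ; try exact: L2_L1M.
by congr Rintegral; apply/funext => x; rewrite mulrA.
Qed.

Lemma ipNl f h : L2 f -> L2 h -> ip (fun x => - f x) h = - ip f h.
Proof.
move=> Lf Lh; rewrite -mulN1r -ipZl//; congr ip.
by apply/funext => x; rewrite mulN1r.
Qed.

Lemma ipBl f g h : L2 f -> L2 g -> L2 h ->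
  ip (fun x => f x - g x) h = ip f h - ip g h.
Proof. by move=> Lf Lg Lh; rewrite ipDl ?ipNl//; exact: L2N. Qed.

Lemma ipDr f g h : L2 f -> L2 g -> L2 h ->
  ip h (fun x => f x + g x) = ip h f + ip h g.
Proof. by move=> *; rewrite !(ipC h) ipDl. Qed.

Lemma ipZr c f h : L2 f -> L2 h -> ip h (fun x => c * f x) = c * ip h f.
Proof. by move=> *; rewrite !(ipC h) ipZl. Qed.

Lemma ipNr f h : L2 f -> L2 h -> ip h (fun x => - f x) = - ip h f.
Proof. by move=> *; rewrite !(ipC h) ipNl. Qed.

Lemma ip_ge0 f : 0 <= ip f f.
Proof. by apply: Rint_ge0 => x; rewrite -expr2 sqr_ge0. Qed.

Lemma ip_ae f f' g g' : L2 f -> L2 g ->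
  measurable_fun setT f' -> measurable_fun setT g' ->
  {ae mu, forall x, f x = f' x} -> {ae mu, forall x, g x = g' x} ->
  ip f g = ip f' g'.
Proof.
move=> [mf _] [mg _] mf' mg' ff' gg'; apply: Rint_ae.
- exact: measurable_funM.
- exact: measurable_funM.
- by apply: filterS2 ff' gg' => x -> ->.
Qed.

Lemma ip_eq0_ae f : L2 f -> ip f f = 0 -> {ae mu, forall x, f x = 0}.
Proof.
move=> Lf f0.
have h : forall x, 0 <= f x * f x by move=> x; rewrite -expr2 sqr_ge0.
have := Rint_eq0_ae (L2_L1M Lf Lf) h f0.
by apply: filterS => x /eqP; rewrite mulf_eq0 orbb => /eqP.
Qed.

End SquareIntegrable.

Lemma discriminant_le (R : realType) (a b c : R) :
  (forall t, 0 <= a + 2 * t * b + t ^+ 2 * c) -> b ^+ 2 <= a * c.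
Proof.
move=> h; have c0 : 0 <= c.
  rewrite leNgt; apply/negP => c0.
  have a0 : 0 <= a by have := h 0; rewrite mulr0 mul0r expr0n mul0r !addr0.
  pose t := (a + 1 + 2 * `|b|) / (- c) + 1.
  have := h t.
  have tc : (t - 1) * c = - (a + 1 + 2 * `|b|).
    by rewrite /t addrK invrN mulrN mulNr divfK// lt_eqF.
  have b0 := normr_ge0 b; have bl := ler_norm b.
  have t1 : 1 <= t.
    by rewrite /t lerDr divr_ge0//; lra.
  nra.
have [c_0|c_n0] := eqVneq c 0.
  rewrite c_0 mulr0.
  have [->|b0] := eqVneq b 0; first by rewrite expr0n.
  have := h (- (a + 1) / (2 * b)).
  rewrite c_0 mulr0 addr0 (_ : 2 * _ * b = - (a + 1)); last by field.
  lra.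
have cp : 0 < c by rewrite lt_neqAle eq_sym c_n0.
have := h (- b / c).
rewrite (_ : _ + _ = a - b ^+ 2 / c); last by field.
by rewrite subr_ge0 ler_pdivrMr.
Qed.

Section CauchySchwarz.
Context d (T : measurableType d) (R : realType) (mu : {measure set T -> \bar R}).
Implicit Types (f g h : T -> R).

Lemma ip_sqrD f g : L2 mu f -> L2 mu g ->
  ip mu (fun x => f x + g x) (fun x => f x + g x) =
  ip mu f f + 2 * ip mu f g + ip mu g g.
Proof.
move=> Lf Lg; rewrite ipDl// ?ipDr//; try exact: L2D.
rewrite (ipC _ g f); ring.
Qed.

Lemma ip_CS f g : L2 mu f -> L2 mu g ->
  ip mu f g ^+ 2 <= ip mu f f * ip mu g g.
Proof.
move=> Lf Lg; apply: discriminant_le => t.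
have := ip_ge0 mu (fun x => f x + t * g x).
have Lt := L2Z t Lg.
rewrite ip_sqrD// !ipZr// !ipZl//.
by move=> h; apply: (le_trans h); rewrite le_eqVlt; apply/orP; left; apply/eqP; ring.
Qed.

Lemma ip_sqrD_le f g : L2 mu f -> L2 mu g ->
  ip mu (fun x => f x + g x) (fun x => f x + g x) <=
  2 * ip mu f f + 2 * ip mu g g.
Proof.
move=> Lf Lg; rewrite ip_sqrD//.
have := ip_ge0 mu (fun x => f x - g x).
have Ln := L2N Lg; rewrite ip_sqrD// !ipNr// !ipNl//; lra.
Qed.

Lemma ip_abs_le f g : L2 mu f -> L2 mu g ->
  2 * `|ip mu f g| <= ip mu f f + ip mu g g.
Proof.
move=> Lf Lg.
have := ip_ge0 mu (fun x => f x - g x).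
have := ip_ge0 mu (fun x => f x + g x).
have Ln := L2N Lg; rewrite !ip_sqrD// !ipNr// !ipNl//.
by move=> h1 h2; case: (ler0P (ip mu f g)) => _; lra.
Qed.

Lemma ip_cvg (f_ : nat -> T -> R) f g : (forall n, L2 mu (f_ n)) -> L2 mu f ->
  L2 mu g -> ip mu (fun x => f_ n x - f x) (fun x => f_ n x - f x) @[n --> \oo] --> 0 ->
  ip mu (f_ n) g @[n --> \oo] --> ip mu f g.
Proof.
move=> Lf_ Lf Lg c0; apply/cvgrPdist_le => /= e e0.
have c1 : ip mu (fun x => f_ n x - f x) (fun x => f_ n x - f x) * ip mu g g
    @[n --> \oo] --> 0.
  by rewrite -(mul0r (ip mu g g)); apply: cvgM => //; exact: cvg_cst.
move/cvgrPdist_le : c1 => /(_ (e ^+ 2)) /=; rewrite exprn_gt0// => /(_ isT).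
apply: filterS => n; rewrite sub0r normrN => h.
have := ip_CS (L2B (Lf_ n) Lf) Lg.
rewrite ipBl// => h2.
rewrite distrC -(ler_pXn2r (n:=2))// ?nnegrE ?(ltW e0)//.
by rewrite (real_normK (num_real _)) (le_trans h2)// (le_trans _ h)// ler_norm.
Qed.

Lemma L2_lim_unique (f_ : nat -> T -> R) f g : (forall n, L2 mu (f_ n)) ->
  L2 mu f -> L2 mu g ->
  ip mu (fun x => f_ n x - f x) (fun x => f_ n x - f x) @[n --> \oo] --> 0 ->
  ip mu (fun x => f_ n x - g x) (fun x => f_ n x - g x) @[n --> \oo] --> 0 ->
  {ae mu, forall x, f x = g x}.
Proof.
move=> Lf_ Lf Lg cf cg.
have : ip mu (fun x => f x - g x) (fun x => f x - g x) = 0.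
  apply/eqP; rewrite eq_le ip_ge0 andbT.
  have c2 : 2 * ip mu (fun x => f_ n x - f x) (fun x => f_ n x - f x) +
      2 * ip mu (fun x => f_ n x - g x) (fun x => f_ n x - g x) @[n --> \oo] --> 0.
    rewrite -[X in _ --> X](_ : 2 * 0 + 2 * 0 = 0); last by rewrite mulr0 addr0.
    by apply: cvgD; apply: cvgM => //; exact: cvg_cst.
  rewrite -(cvg_lim _ c2)//; apply: limr_ge; first by apply/cvg_ex; exists 0.
  near=> n.
  have -> : (fun x => f x - g x) =
      (fun x => - (f_ n x - f x) + (f_ n x - g x)).
    by apply/funext => x; ring.
  have L1' := L2B (Lf_ n) Lf; have L2' := L2B (Lf_ n) Lg.
  apply: le_trans (ip_sqrD_le (L2N L1') L2') _.
  by rewrite ipNr ?ipNl ?opprK//; exact: L2N.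
move=> /(ip_eq0_ae (L2B Lf Lg)); apply: filterS => x /eqP.
by rewrite subr_eq0 => /eqP.
Unshelve. all: by end_near. Qed.

End CauchySchwarz.

Section Completeness.
Context d (T : measurableType d) (R : realType) (mu : {measure set T -> \bar R}).

Lemma sum_halves_le n : \sum_(k < n) (2^-1 : R) ^+ k <= 2.
Proof.
suff -> : \sum_(k < n) (2^-1 : R) ^+ k = 2 - 2 * (2^-1) ^+ n.
  by rewrite gerBl mulr_ge0// exprn_ge0// invr_ge0.
elim: n => [|n IH]; first by rewrite big_ord0 expr0 mulr1 subrr.
by rewrite big_ord_recr /= IH exprS; field.
Qed.

Lemma fast_cauchy_cvg (u : nat -> R) (G : R) :
  (forall n, \sum_(k < n) 2 ^+ k * (u k.+1 - u k) ^+ 2 <= G) -> cvgn u.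
Proof.
move=> hG.
have -> : u = fun n => u 0%N + series (fun k => u k.+1 - u k) n.
  by apply/funext => n; rewrite telescopeK addrC subrK.
apply: is_cvgD; first exact: is_cvg_cst.
apply: normed_cvg; apply: nondecreasing_is_cvgn.
  apply/nondecreasing_seqP => n; change (\sum_(0 <= k < n) `|u k.+1 - u k| <=
    \sum_(0 <= k < n.+1) `|u k.+1 - u k|).
  by rewrite big_nat_recr//= lerDl.
exists ((G + 2) / 2) => _ [n _ <-] /=; rewrite seriesEord /=.
apply: (@le_trans _ _ ((\sum_(k < n) 2 ^+ k * (u k.+1 - u k) ^+ 2 +
    \sum_(k < n) (2^-1) ^+ k) / 2)).
  rewrite -big_split /= mulr_suml; apply: ler_sum => k _.
  have p0 : 0 < (2 ^+ k : R) by exact: exprn_gt0.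
  rewrite exprVn ler_pdivlMr//.
  set x := 2 ^+ k in p0 *; set y := u k.+1 - u k.
  rewrite -(real_normK (num_real y)); set z := `|y|.
  rewrite -subr_ge0 (_ : _ - _ = (x * z - 1) ^+ 2 / x); last by field; lra.
  by rewrite divr_ge0 ?sqr_ge0 ?ltW.
by rewrite ler_wpM2r//; apply: lerD => //; exact: sum_halves_le.
Qed.

Lemma L2_complete (f_ : nat -> T -> R) : (forall n, L2 mu (f_ n)) ->
  (forall e, 0 < e -> exists N, forall m n, (N <= m)%N -> (N <= n)%N ->
    ip mu (fun x => f_ m x - f_ n x) (fun x => f_ m x - f_ n x) <= e) ->
  exists2 f, L2 mu f &
    ip mu (fun x => f_ n x - f x) (fun x => f_ n x - f x) @[n --> \oo] --> 0.
Proof.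
move=> Lf hc.
have e8 k : 0 < (8^-1 : R) ^+ k by rewrite exprn_gt0// invr_gt0.
have [N hN] := choice (fun k => hc _ (e8 k)).
pose phi := fix phi k := if k is k'.+1 then maxn (phi k') (maxn (N k) k) else N 0%N.
have phiN k : (N k <= phi k)%N.
  by case: k => //= k; rewrite leq_max leq_max leqnn orbT.
have phik k : (k <= phi k)%N.
  by case: k => //= k; rewrite !leq_max leqnn !orbT.
have phiS k : (phi k <= phi k.+1)%N by rewrite /= leq_max leqnn.
pose D k x := 2 ^+ k * (f_ (phi k.+1) x - f_ (phi k) x) ^+ 2.
have D0 k x : 0 <= D k x by rewrite mulr_ge0 ?sqr_ge0 ?exprn_ge0.
have ID k : L1 mu (D k) by apply/L1Z; exact: (L2B (Lf _) (Lf _)).2.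
have mD k : measurable_fun setT (EFin \o D k) by have /integrableP[] := ID k.
pose g x := (\sum_(k <oo) (D k x)%:E)%E.
have mg : measurable_fun setT g.
  have D0' (k : nat) (x : T) : setT x -> xpredT k -> (0 <= (D k x)%:E)%E.
    by rewrite lee_fin.
  exact: (ge0_emeasurable_sum D0' (fun k _ => mD k)).
have g0 x : (0 <= g x)%E by apply: nneseries_ge0 => k _ _; rewrite lee_fin.
have Ig : mu.-integrable setT g.
  apply/integrableP; split => //.
  under eq_integral => x _ do rewrite gee0_abs//.
  rewrite integral_nneseries//; last by move=> n x _; rewrite lee_fin.
  apply: (@le_lt_trans _ _ (\sum_(k <oo) ((2^-1) ^+ k)%:E)%E).
    apply: lee_nneseries => [k _ _|k _].
      by apply: integral_ge0 => x _; rewrite lee_fin.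
    rewrite L1_EFin// lee_fin /D RintZ; last exact: (L2B (Lf _) (Lf _)).2.
    have := hN k _ _ (leq_trans (phiN k) (phiS k)) (phiN k).
    rewrite /ip => h.
    apply: (@le_trans _ _ (2 ^+ k * 8^-1 ^+ k)); first by rewrite ler_wpM2l// exprn_ge0.
    by rewrite -exprMn lerXn2r// ?nnegrE; lra.
  apply: (@le_lt_trans _ _ 2%:E); last exact: ltry.
  apply: lime_le.
    by apply: is_cvg_nneseries => k _ _; rewrite lee_fin exprn_ge0// invr_ge0.
  by near=> n; rewrite sumEFin lee_fin big_mkord; exact: sum_halves_le.
have aecv : {ae mu, forall x, cvgn (fun k => f_ (phi k) x)}.
  have := integrable_ae measurableT Ig; apply: filterS => x /(_ I) gf.
  apply: (@fast_cauchy_cvg _ (fine (g x))) => n.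
  rewrite -lee_fin fineK// -sumEFin.
  rewrite -(big_mkord xpredT (fun k => (D k x)%:E)).
  by apply: nneseries_lim_ge => k _ _; rewrite lee_fin.
pose f x := fine (limn_esup (fun k => (f_ (phi k) x)%:E)).
have mf : measurable_fun setT f.
  apply: measurableT_comp => //.
  apply: (@measurable_fun_limn_esup _ _ _ _ (fun k x => (f_ (phi k) x)%:E)) => k.
  by apply/measurable_EFinP; case: (Lf (phi k)).
have aef : {ae mu, forall x, f_ (phi k) x @[k --> \oo] --> f x}.
  apply: filterS aecv => x cvx.
  have c2 : (f_ (phi k) x)%:E @[k --> \oo] --> (limn (fun k => f_ (phi k) x))%:E.
    by apply: cvg_EFin => //; near=> n.
  rewrite /f is_cvg_limn_esupE; last by apply/cvg_ex; eexists; exact: c2.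
  by rewrite (cvg_lim _ c2).
have key e : 0 < e -> exists M, forall m, (M <= m)%N ->
    L2 mu (fun x => f x - f_ m x) /\
    ip mu (fun x => f x - f_ m x) (fun x => f x - f_ m x) <= e.
  move=> e0; have [M hM] := hc _ e0; exists M => m Mm.
  have mfm : measurable_fun setT (fun x => f x - f_ m x).
    by apply: measurable_funB => //; case: (Lf m).
  have [|||||If le] := @Rint_fatou _ _ _ mu (fun k x => (f_ (phi (k + M)%N) x - f_ m x) ^+ 2)
    (fun x => (f x - f_ m x) ^+ 2) e.
  - by move=> n; exact: (L2B (Lf _) (Lf _)).2.
  - by move=> n x; exact: sqr_ge0.
  - exact: measurable_funX.
  - apply: filterS aef => x cvx.
    have cs : f_ (phi (k + M)%N) x - f_ m x @[k --> \oo] --> f x - f_ m x.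
      by apply: cvgB; [rewrite (cvg_shiftn M (fun k => f_ (phi k) x))|exact: cvg_cst].
    by under eq_fun do rewrite expr2; rewrite expr2; exact: cvgM.
  - by move=> n; apply: hM => //; rewrite (leq_trans _ (phik _))// leq_addl.
  split; first by split.
  apply: le_trans le; rewrite le_eqVlt; apply/orP; left; apply/eqP.
  by congr Rintegral; apply/funext => x; rewrite ger0_norm ?sqr_ge0.
have Lfl : L2 mu f.
  have [M hM] := key 1 ltr01; have [L _] := hM M (leqnn M).
  by have := L2D L (Lf M); congr L2; apply/funext => x; rewrite subrK.
exists f => //; apply/cvgrPdist_le => /= e e0.
have [M hM] := key e e0; near=> n.
have Mn : (M <= n)%N by near: n; exact: nbhs_infty_ge.
have [_] := hM n Mn.
rewrite sub0r normrN ger0_norm ?ip_ge0//; apply: le_trans.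
rewrite le_eqVlt; apply/orP; left; apply/eqP.
by congr Rintegral; apply/funext => x; ring.
Unshelve. all: by end_near. Qed.

End Completeness.

(* The sections below abbreviate [L1], [L2] and [ip] to their instances on the plane. *)
Notation L1_on := L1.
Notation L2_on := L2.
Notation ip_on := ip.

Section MeasurePreserving.
Context d (T : measurableType d) (R : realType) (mu : {measure set T -> \bar R}).
Variable phi : T -> T.
Hypothesis mphi : measurable_fun setT phi.
Hypothesis phiP : forall A, measurable A -> mu (phi @^-1` A) = mu A.

Lemma L1_preserving f : L1 mu f -> L1 mu (fun x => f (phi x)).
Proof.
move=> If; have mf := L1_meas If.
apply: L1_lty; first exact: measurableT_comp.
have := @ge0_integral_pushforward _ _ _ _ _ phi mphi mu setT
  (fun x => `|f x|%:E)%E measurableT.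
rewrite preimage_setT /= => <-.
- rewrite (eq_measure_integral mu) => [|A mA _]; last exact: phiP.
  by case/integrableP : If.
- by apply/measurable_EFinP; exact: measurableT_comp.
- by move=> x _; rewrite lee_fin.
Qed.

Lemma Rint_preserving f : L1 mu f -> \int[mu]_x f (phi x) = \int[mu]_x f x.
Proof.
move=> If; have mf := L1_meas If; rewrite /Rintegral; congr fine.
have -> : (\int[mu]_x (f (phi x))%:E = \int[pushforward mu phi]_x (f x)%:E)%E.
  rewrite (integral_pushforward mphi) ?preimage_setT//.
  - exact/measurable_EFinP.
  - exact: L1_preserving.
by apply: eq_measure_integral => A mA _; rewrite -[RHS]phiP.
Qed.

End MeasurePreserving.

Lemma indic_disjU (R : realType) (X : Type) (A B : set X) x :
  A `&` B = set0 -> \1_(A `|` B) x = \1_A x + \1_B x :> R.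
Proof.
move=> AB; rewrite !indicE in_setU.
have [|xA] := boolP (x \in A); have [|xB] := boolP (x \in B);
  rewrite /= ?addr0 ?add0r// => /set_mem xB /set_mem xA.
by have : (A `&` B) x by []; rewrite AB.
Qed.

Section DynkinVanishing.
Context d (T : measurableType d) d' (X : measurableType d') (R : realType).
Variables (mu : {measure set T -> \bar R}) (phi : T -> X).
Hypothesis mphi : measurable_fun setT phi.
Variables (G : set (set X)) (g : nat -> set X).
Hypotheses (mG : @measurable _ X = <<s G >>) (GI : setI_closed G).
Hypotheses (Gg : forall n, G (g n)) (gT : forall x, \forall n \near \oo, g n x).

Let mphiA A : measurable A -> measurable_fun setT (fun x => \1_A (phi x) : R).
Proof. by move=> mA; apply: measurableT_comp => //; exact: measurable_indic. Qed.

Let indic1 (A : set X) x : `|\1_A x : R| <= 1.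
Proof. by rewrite indicE; case: (_ \in _) => /=; rewrite ?normr1 ?normr0. Qed.

Lemma Rint_dynkin_eq0 v : L1 mu v ->
  (forall A, G A -> \int[mu]_x (v x * \1_A (phi x)) = 0) ->
  forall A, measurable A -> \int[mu]_x (v x * \1_A (phi x)) = 0.
Proof.
move=> Iv v0.
have mv := L1_meas Iv.
have mGm A : G A -> measurable A by move=> GA; rewrite mG; exact: sub_sigma_algebra.
have IvA A : measurable A -> L1 mu (fun x => v x * \1_A (phi x)).
  by move=> mA; apply: L1_bdM Iv => //; exact: mphiA.
have vT : \int[mu]_x v x = 0.
  have : \int[mu]_x (v x * \1_(g n) (phi x)) @[n --> \oo] --> \int[mu]_x v x.
    apply: (@Rint_dct _ _ _ _ _ _ (fun x => `|v x|)) => //.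
    - by move=> n; apply: measurable_funM => //; apply: mphiA; exact: mGm.
    - apply: nearW => x; apply: cvg_near_cst; near=> n.
      rewrite indicE mem_set ?mulr1//; near: n; exact: gT.
    - exact: L1_abs.
    - by move=> n x; rewrite normrM ler_piMr.
  by under eq_fun do rewrite v0//; move/cvg_lim => <-//; rewrite lim_cst.
pose P := fun A : set X => \int[mu]_x (v x * \1_A (phi x)) = 0.
move=> A; rewrite mG; apply: (dynkin_induction (P := P) mG GI); rewrite /P //.
- by under eq_fun do rewrite indicE in_setT mulr1.
- move=> S mS vS.
  transitivity (\int[mu]_x (v x - v x * \1_S (phi x))).
    congr Rintegral; apply/funext => x; rewrite !indicE in_setC.
    by case: (_ \in S); rewrite /= ?mulr1 ?mulr0 ?subrr ?subr0.
  by rewrite RintB ?vT ?vS ?subrr//; exact: IvA.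
- move=> F mF tF vF.
  have mU n : measurable (\bigcup_(i < n) F i) by exact: bigcup_measurable.
  have vU n : \int[mu]_x (v x * \1_(\bigcup_(i < n) F i) (phi x)) = 0.
    elim: n => [|n IH].
      rewrite bigcup0//; under eq_fun do rewrite indic0 mulr0.
      by rewrite /Rintegral integral0.
    transitivity (\int[mu]_x (v x * \1_(\bigcup_(i < n) F i) (phi x) +
        v x * \1_(F n) (phi x))).
      congr Rintegral; apply/funext => x; rewrite -mulrDr; congr (_ * _).
      rewrite bigcup_mkord big_ord_recr /= -bigcup_mkord indic_disjU//.
      apply/seteqP; split => // y [[i /= ilt Fi] Fn].
      have /trivIsetP/(_ i n I I) := tF.
      rewrite ltn_eqF// => /(_ isT) FF.
      by have : (F i `&` F n) y by []; rewrite FF.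
    by rewrite RintD ?IH ?vF ?addr0//; exact: IvA.
  have : \int[mu]_x (v x * \1_(\bigcup_(i < n) F i) (phi x)) @[n --> \oo] -->
      \int[mu]_x (v x * \1_(\bigcup_i F i) (phi x)).
    apply: (@Rint_dct _ _ _ _ _ _ (fun x => `|v x|)) => //.
    - by move=> n; apply: measurable_funM => //; exact: mphiA.
    - by apply: measurable_funM => //; apply: mphiA; exact: bigcup_measurable.
    - apply: nearW => x; apply: cvg_near_cst.
      have [[i _ Fi]|nF] := pselect ((\bigcup_i F i) (phi x)).
        near=> n; rewrite !indicE !mem_set//; first by exists i.
        by exists i => //=; near: n; exact: nbhs_infty_gt.
      apply: nearW => n; rewrite !indicE !memNset// => -[i _ Fi].
      by apply: nF; exists i.
    - exact: L1_abs.
    - by move=> n x; rewrite normrM ler_piMr.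
  by under eq_fun do rewrite vU//; move/cvg_lim => <-//; rewrite lim_cst.
Unshelve. all: by end_near. Qed.

End DynkinVanishing.

Section RealFubini.
Context d1 d2 (T1 : measurableType d1) (T2 : measurableType d2) (R : realType).
Variable m1 : {sigma_finite_measure set T1 -> \bar R}.
Variable m2 : {sigma_finite_measure set T2 -> \bar R}.
Implicit Types f : T1 * T2 -> R.

Lemma L1_prod12 f (G : T1 -> R) : measurable_fun setT f ->
  (forall x, L1 m2 (fun y => f (x, y))) ->
  (forall x, \int[m2]_y `|f (x, y)| <= G x) -> L1 m1 G -> L1 (m1 \x m2)%E f.
Proof.
move=> mf If fG IG; apply/integrable12ltyP; first exact/measurable_EFinP.
have mG := L1_meas IG.
apply: (@le_lt_trans _ _ (\int[m1]_x `|G x|%:E)%E); last by case/integrableP : IG.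
apply: ge0_le_integral => //=.
- by move=> x _; apply: integral_ge0.
- apply: (@measurable_fun_fubini_tonelli_F _ _ _ _ _ m2 (fun z => `|f z|%:E)%E) => //.
  by apply/measurable_EFinP; exact: measurableT_comp.
- by apply/measurable_EFinP; exact: measurableT_comp.
- move=> x _; rewrite (L1_EFin (L1_abs (If x))) lee_fin.
  by apply: (le_trans (fG x)); exact: ler_norm.
Qed.

Lemma L1_prod21 f (G : T2 -> R) : measurable_fun setT f ->
  (forall y, L1 m1 (fun x => f (x, y))) ->
  (forall y, \int[m1]_x `|f (x, y)| <= G y) -> L1 m2 G -> L1 (m1 \x m2)%E f.
Proof.
move=> mf If fG IG; apply/integrable21ltyP; first exact/measurable_EFinP.
have mG := L1_meas IG.
apply: (@le_lt_trans _ _ (\int[m2]_x `|G x|%:E)%E); last by case/integrableP : IG.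
apply: ge0_le_integral => //=.
- by move=> x _; apply: integral_ge0.
- apply: (@measurable_fun_fubini_tonelli_G _ _ _ _ _ m1 (fun z => `|f z|%:E)%E) => //.
  by apply/measurable_EFinP; exact: measurableT_comp.
- by apply/measurable_EFinP; exact: measurableT_comp.
- move=> x _; rewrite (L1_EFin (L1_abs (If x))) lee_fin.
  by apply: (le_trans (fG x)); exact: ler_norm.
Qed.

Lemma L1_fubini12 f : L1 (m1 \x m2)%E f ->
  L1 m1 (fun x => \int[m2]_y f (x, y)) /\
  \int[m1]_x \int[m2]_y f (x, y) = \int[(m1 \x m2)%E]_z f z.
Proof.
move=> If; have mf := L1_meas If.
pose F := fubini_F m2 (EFin \o f).
have IF : m1.-integrable setT F by exact: integrable_fubini_F.
have mF := measurable_int _ IF.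
have mF' : measurable_fun setT (EFin \o (fine \o F)).
  by apply/measurable_EFinP; exact: measurableT_comp.
have eF : ae_eq m1 setT F (EFin \o (fine \o F)).
  have := integrable_ae measurableT IF.
  by apply: filterS => x /= h hx; rewrite fineK// h.
split.
  apply: le_integrable (IF) => //= x _; change (`|fine (F x)|%:E <= `|F x|)%E.
  by case: (F x) => [r||] /=; rewrite ?normr0 ?lexx ?leey.
rewrite /Rintegral -(integral12_prod_meas1 If) -/F; congr fine.
exact/esym/ae_eq_integral.
Qed.

Lemma L1_fubini21 f : L1 (m1 \x m2)%E f ->
  L1 m2 (fun y => \int[m1]_x f (x, y)) /\
  \int[m2]_y \int[m1]_x f (x, y) = \int[(m1 \x m2)%E]_z f z.
Proof.
move=> If; have mf := L1_meas If.
pose F := fubini_G m1 (EFin \o f).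
have mF : measurable_fun setT F by exact: (measurable_fubini_G If).
have mfE : measurable_fun setT (EFin \o f) by exact/measurable_EFinP.
have IF : m2.-integrable setT F.
  apply/integrableP; split => //.
  have h := (integrable21ltyP m1 m2 mfE).1 If; apply: (le_lt_trans _ h).
  apply: ge0_le_integral => //=.
  - exact: measurableT_comp.
  - apply: (@measurable_fun_fubini_tonelli_G _ _ _ _ _ m1 (fun z => `|f z|%:E)%E) => //.
    by apply/measurable_EFinP; exact: measurableT_comp.
  - move=> y _; apply: le_abse_integral => //; apply/measurable_EFinP.
    by apply: measurableT_comp => //; exact: measurable_fun_pair1.
have mF' : measurable_fun setT (EFin \o (fine \o F)).
  by apply/measurable_EFinP; exact: measurableT_comp.
have eF : ae_eq m2 setT F (EFin \o (fine \o F)).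
  have := integrable_ae measurableT IF.
  by apply: filterS => x /= h hx; rewrite fineK// h.
split.
  apply: le_integrable (IF) => //= x _; change (`|fine (F x)|%:E <= `|F x|)%E.
  by case: (F x) => [r||] /=; rewrite ?normr0 ?lexx ?leey.
rewrite /Rintegral -(integral21_prod_meas1 If) -/F; congr fine.
exact/esym/ae_eq_integral.
Qed.

Lemma Rint_swap f : L1 (m1 \x m2)%E f ->
  \int[m1]_x \int[m2]_y f (x, y) = \int[m2]_y \int[m1]_x f (x, y).
Proof. by move=> If; rewrite (L1_fubini12 If).2 (L1_fubini21 If).2. Qed.

Lemma L1_tensor (a : T1 -> R) (b : T2 -> R) : L1 m1 a -> L1 m2 b ->
  L1 (m1 \x m2)%E (fun z => a z.1 * b z.2) /\
  \int[(m1 \x m2)%E]_z (a z.1 * b z.2) = \int[m1]_x a x * \int[m2]_y b y.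
Proof.
move=> Ia Ib; have ma := L1_meas Ia; have mb := L1_meas Ib.
have I2 : L1 (m1 \x m2)%E (fun z => a z.1 * b z.2).
  apply: (@L1_prod12 _ (fun x => (\int[m2]_y `|b y|) * `|a x|)) => //=.
  - by apply: measurable_funM; exact: measurableT_comp.
  - by move=> x; exact: L1Z.
  - move=> x; rewrite mulrC -RintZ; last exact: L1_abs.
    by under eq_fun do rewrite normrM.
  - exact/L1Z/L1_abs.
split => //; rewrite -(L1_fubini12 I2).2/=.
under eq_fun do rewrite RintZ//.
by under eq_fun do rewrite mulrC; rewrite RintZ// mulrC.
Qed.

End RealFubini.

Section PlaneMeasure.
Context (R : realType).
Notation mu1 := (@lebesgue_measure R).
Notation P2 := (measurableTypeR R * measurableTypeR R)%type.
Implicit Types (f g v : R * R -> R) (z xi : R * R).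

Lemma leb2_sigma_finite : sigma_finite [set: P2] (@leb2 R).
Proof.
have /sigma_finiteP[F [TF ndF Foo]] := sigma_finiteT mu1.
exists (fun n => F n `*` F n).
  rewrite -setXTT TF predeqE => -[x y]; split.
    move=> [/= [n _ Fnx] [k _ Gky]]; exists (maxn n k) => //; split.
    - by move: x Fnx; exact/subsetPset/ndF/leq_maxl.
    - by move: y Gky; exact/subsetPset/ndF/leq_maxr.
  by move=> [n _ []/= ? ?]; split; exists n.
move=> k; have [? ?] := Foo k; split; first exact: measurableX.
by rewrite /leb2 /= product_measure1E// lte_mul_pinfty// ge0_fin_numE.
Qed.

(* [leb2] as a sigma-finite measure, the form in which Fubini's theorem takes it. *)
Definition sleb2 : {sigma_finite_measure set P2 -> \bar R} :=
  HB.pack (leb2 : set P2 -> \bar R) (@leb2 R) (Measure_isSigmaFinite.Build _ _ _ (@leb2 R) leb2_sigma_finite).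

Lemma leb2_rect (A B : set (measurableTypeR R)) : measurable A -> measurable B ->
  leb2 (A `*` B) = (mu1 A * mu1 B)%E.
Proof. by move=> mA mB; rewrite -product_measure1E. Qed.

Lemma leb1_oppr (A : set (measurableTypeR R)) : measurable A ->
  mu1 (-%R @^-1` A) = mu1 A.
Proof.
have mN : measurable_fun [set: measurableTypeR R] (-%R : measurableTypeR R -> measurableTypeR R).
  exact: measurable_funN.
move=> mA; apply/esym.
apply: (@lebesgue_measure_unique R (pushforward mu1 (-%R : measurableTypeR R -> measurableTypeR R))) => //.
move=> X [[a b] /= _ <-]; rewrite /pushforward.
rewrite (_ : _ @^-1` _ = [set` `[- b, - a[]); last first.
  by apply/seteqP; split => x /=; rewrite !in_itv /= => /andP[h1 h2]; apply/andP; split; lra.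
rewrite !lebesgue_measure_itv /= !lte_fin ltrN2; case: ifP => // _.
by rewrite -!EFinD; congr (_ %:E); lra.
Qed.

Lemma leb1_shift (c : R) (A : set (measurableTypeR R)) : measurable A ->
  mu1 ((fun x => x + c) @^-1` A) = mu1 A.
Proof.
pose T := (fun x => x + c) : measurableTypeR R -> measurableTypeR R.
have mN : measurable_fun [set: measurableTypeR R] T.
  exact: measurable_funD.
move=> mA; apply/esym.
apply: (@lebesgue_measure_unique R (pushforward mu1 T)) => //.
move=> X [[a b] /= _ <-]; rewrite /pushforward.
rewrite (_ : _ @^-1` _ = [set` `]a - c, b - c]]); last first.
  by apply/seteqP; split => x /=; rewrite !in_itv /= /T => /andP[h1 h2]; apply/andP; split; lra.
rewrite !lebesgue_measure_itv /= !lte_fin ltrBlDr subrK; case: ifP => // _.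
by rewrite -!EFinD; congr (_ %:E); lra.
Qed.

Lemma leb2_preserving (s1 s2 : R -> R) :
  measurable_fun [set: measurableTypeR R] (s1 : measurableTypeR R -> measurableTypeR R) ->
  measurable_fun [set: measurableTypeR R] (s2 : measurableTypeR R -> measurableTypeR R) ->
  (forall A : set (measurableTypeR R), measurable A -> mu1 (s1 @^-1` A) = mu1 A) ->
  (forall A : set (measurableTypeR R), measurable A -> mu1 (s2 @^-1` A) = mu1 A) ->
  measurable_fun [set: P2] ((fun z => (s1 z.1, s2 z.2)) : P2 -> P2) /\
  forall A : set P2, measurable A -> leb2 ((fun z => (s1 z.1, s2 z.2)) @^-1` A) = leb2 A.
Proof.
move=> ms1 ms2 h1 h2.
have mT : measurable_fun [set: P2] ((fun z => (s1 z.1, s2 z.2)) : P2 -> P2).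
  by apply: measurable_fun_pair; exact: measurableT_comp.
split => // A mA.
rewrite -/(pushforward leb2 ((fun z => (s1 z.1, s2 z.2)) : P2 -> P2) A).
apply/esym; apply: product_measure_unique => // X Y mX mY.
change (leb2 ((s1 @^-1` X) `*` (s2 @^-1` Y)) = (mu1 X * mu1 Y)%E).
rewrite leb2_rect ?h1 ?h2//.
- by rewrite -[X in measurable X]setTI; exact: ms1.
- by rewrite -[X in measurable X]setTI; exact: ms2.
Qed.

Definition negp z : R * R := (- z.1, - z.2).

Lemma L1_negp f : L1 leb2 f -> L1 leb2 (fun z => f (negp z)).
Proof.
have [m h] := leb2_preserving (@measurable_funN _ _ _ _ _ (@measurable_id _ _ _))
  (@measurable_funN _ _ _ _ _ (@measurable_id _ _ _)) leb1_oppr leb1_oppr.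
exact: (L1_preserving m h).
Qed.

Lemma Rint_negp f : L1 leb2 f -> \int[leb2]_z f (negp z) = \int[leb2]_z f z.
Proof.
have [m h] := leb2_preserving (@measurable_funN _ _ _ _ _ (@measurable_id _ _ _))
  (@measurable_funN _ _ _ _ _ (@measurable_id _ _ _)) leb1_oppr leb1_oppr.
exact: (Rint_preserving m h).
Qed.

Definition addp z y : R * R := (z.1 + y.1, z.2 + y.2).

Lemma addp_preserving y : measurable_fun [set: P2] ((fun z => addp z y) : P2 -> P2) /\
  forall A : set P2, measurable A -> leb2 ((fun z => addp z y) @^-1` A) = leb2 A.
Proof.
by apply: (@leb2_preserving (fun x => x + y.1) (fun x => x + y.2));
  try exact: measurable_funD; exact: leb1_shift.
Qed.

Lemma L1_addp y f : L1 leb2 f -> L1 leb2 (fun z => f (addp z y)).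
Proof. by have [m h] := addp_preserving y; exact: (L1_preserving m h). Qed.

Lemma Rint_addp y f : L1 leb2 f -> \int[leb2]_z f (addp z y) = \int[leb2]_z f z.
Proof. by have [m h] := addp_preserving y; exact: (Rint_preserving m h). Qed.

Lemma measurable_negp : measurable_fun [set: P2] (negp : P2 -> P2).
Proof.
by have [] := leb2_preserving (@measurable_funN _ _ _ _ _ (@measurable_id _ _ _))
  (@measurable_funN _ _ _ _ _ (@measurable_id _ _ _)) leb1_oppr leb1_oppr.
Qed.

Definition rect (a b c d : R) : set (R * R) := `]a, b]%classic `*` `]c, d]%classic.

Lemma measurable_rect a b c d : measurable (rect a b c d : set P2).
Proof. by apply: measurableX; exact: measurable_itv. Qed.

Let Gitv : set (set (measurableTypeR R)) := [set A | exists a b : R, A = `]a, b]%classic].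

Let itv_near (x : measurableTypeR R) :
  \forall n \near \oo, (`]- (n%:R : R), n%:R]%classic : set R) x.
Proof.
near=> n => /=; rewrite in_itv /=.
have h : `|x| < n%:R by near: n; exact: nbhs_infty_gtr.
by move: h; rewrite ltr_norml => /andP[h1 h2]; rewrite h1 ltW.
Unshelve. all: by end_near. Qed.

Let GitvI : setI_closed Gitv.
Proof.
move=> _ _ [a [b ->]] [c [d ->]]; exists (Num.max a c), (Num.min b d).
apply/seteqP; split => x /=; rewrite !in_itv /= gt_max le_min.
  by move=> [/andP[-> ->] /andP[-> ->]].
by move=> /andP[/andP[-> ->] /andP[-> ->]].
Qed.

Let GitvE : @measurable _ (measurableTypeR R) = <<s Gitv >>.
Proof.
rewrite [LHS](_ : _ = <<s (@ocitv R) >>)//; congr (<<s _ >>).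
apply/seteqP; split => [_ [[a b] _ <-]|_ [a [b ->]]]; first by exists a, b.
by exists (a, b).
Qed.

Lemma indic_setX (A B : set R) z : \1_(A `*` B) z = \1_A z.1 * \1_B z.2 :> R.
Proof.
rewrite !indicE.
have [|] := boolP (z \in A `*` B).
  by move=> /set_mem[/mem_set -> /mem_set ->]; rewrite mulr1.
have [|] := boolP (z.1 \in A); last by rewrite mul0r.
have [|] := boolP (z.2 \in B); last by rewrite mulr0.
by move=> /set_mem zB /set_mem zA /negP[]; exact/mem_set.
Qed.

Lemma Rint_rect_eq0 v : L1 leb2 v ->
  (forall a b c d, \int[leb2]_z (v z * \1_(rect a b c d) z) = 0) ->
  {ae leb2, forall z, v z = 0}.
Proof.
move=> Iv v0.
have mv : measurable_fun [set: P2] v := L1_meas Iv.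
have mi (A : set (measurableTypeR R)) : measurable A ->
    measurable_fun [set: measurableTypeR R] (\1_A : R -> R).
  by move=> mA; exact: measurable_indic.
have i1 (A : set R) x : `|\1_A x : R| <= 1.
  by rewrite indicE; case: (_ \in _) => /=; rewrite ?normr1 ?normr0.
have s1 (A : set (measurableTypeR R)) c d : measurable A ->
    \int[leb2]_z ((v z * \1_(`]c, d]%classic : set R) z.2) * \1_A z.1) = 0.
  move: A; apply: (@Rint_dynkin_eq0 _ P2 _ _ _ leb2 fst measurable_fst Gitv
    (fun n => `]- (n%:R : R), n%:R]%classic) GitvE GitvI) => //.
  - by move=> n; exists (- n%:R), n%:R.
  - apply: L1_bdM Iv => //.
    by apply: measurableT_comp => //; apply: mi; exact: measurable_itv.
  - move=> _ [a [b ->]]; rewrite -(v0 a b c d); congr Rintegral.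
    by apply/funext => z; rewrite indic_setX; ring.
have s2 (A B : set (measurableTypeR R)) : measurable A -> measurable B ->
    \int[leb2]_z ((v z * \1_A z.1) * \1_B z.2) = 0.
  move=> mA; move: B; apply: (@Rint_dynkin_eq0 _ P2 _ _ _ leb2 snd measurable_snd Gitv
    (fun n => `]- (n%:R : R), n%:R]%classic) GitvE GitvI) => //.
  - by move=> n; exists (- n%:R), n%:R.
  - apply: L1_bdM Iv => //.
    by apply: measurableT_comp => //; apply: mi; exact: measurable_itv.
  - move=> _ [c [d ->]]; rewrite -(s1 A c d mA); congr Rintegral.
    by apply/funext => z; ring.
have s3 (A : set P2) : measurable A -> \int[leb2]_z (v z * \1_A z) = 0.
  move: A; apply: (@Rint_dynkin_eq0 _ P2 _ P2 _ leb2 id (@measurable_id _ _ _)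
    [set A `*` B | A in measurable & B in measurable] (fun=> setT)) => //.
  - exact: measurable_prod_measurableType.
  - move=> _ _ [A mA [B mB <-]] [A' mA' [B' mB' <-]].
    exists (A `&` A'); first exact: measurableI.
    by exists (B `&` B'); [exact: measurableI|rewrite setXI].
  - by move=> n; exists setT => //; exists setT => //; rewrite setXTT.
  - by move=> x; near=> n.
  - move=> _ [A mA [B mB <-]]; rewrite -(s2 A B mA mB); congr Rintegral.
    by apply/funext => z; rewrite indic_setX; ring.
have key (w : R * R -> R) : L1 leb2 w ->
    (forall A : set P2, measurable A -> \int[leb2]_z (w z * \1_A z) = 0) ->
    {ae leb2, forall z, w z <= 0}.
  move=> Iw w0; have mw : measurable_fun [set: P2] w := L1_meas Iw.
  have mA : measurable ([set z | 0 < w z] : set P2).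
    have := mw measurableT `]0, +oo[%classic (measurable_itv _).
    by rewrite setTI; congr (measurable _); apply/seteqP; split => z /=;
      rewrite in_itv /= andbT.
  have IA : L1 leb2 (fun z => w z * \1_[set z | 0 < w z] z).
    apply: L1_bdM Iw; first exact: measurable_indic.
    by move=> z; rewrite indicE; case: (_ \in _) => /=; rewrite ?normr1 ?normr0.
  have := Rint_eq0_ae IA _ (w0 _ mA).
  have h : forall z, 0 <= w z * \1_[set z | 0 < w z] z.
    move=> z; rewrite indicE; have [/set_mem /= wz|_] := boolP (z \in _).
      by rewrite mulr1 ltW.
    by rewrite mulr0.
  move=> /(_ h); apply: filterS => z.
  rewrite leNgt => wz0; apply/negP => wz.
  by move: wz0; rewrite indicE mem_set//= mulr1 => w00; rewrite w00 ltxx in wz.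
have h1 := key v Iv s3.
have h2 : {ae leb2, forall z, - v z <= 0}.
  apply: key; first exact: L1N.
  move=> A mA; under eq_fun do rewrite mulNr.
  rewrite RintN ?s3 ?oppr0//; apply: L1_bdM Iv; first exact: measurable_indic.
  by move=> z; rewrite indicE; case: (_ \in _) => /=; rewrite ?normr1 ?normr0.
by apply: ae_imp2 h1 h2 => z a b; apply/eqP; rewrite eq_le a /= -oppr_le0.
Unshelve. all: by end_near. Qed.

End PlaneMeasure.

Section DeriveLambda.
Context (R : realType).
Implicit Types (f g : R -> R) (t c : R).

Lemma isd_cst c t : is_derive t 1 (fun=> c : R) 0.
Proof. exact: is_derive_cst. Qed.

Lemma isd_id t : is_derive t 1 (fun u : R => u) 1.
Proof. exact: is_derive_id. Qed.

Lemma isdD f g t a b : is_derive t 1 f a -> is_derive t 1 g b ->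
  is_derive t 1 (fun u => f u + g u) (a + b).
Proof. exact: is_deriveD. Qed.

Lemma isdN f t a : is_derive t 1 f a -> is_derive t 1 (fun u => - f u) (- a).
Proof. exact: is_deriveN. Qed.

Lemma isdM f g t a b : is_derive t 1 f a -> is_derive t 1 g b ->
  is_derive t 1 (fun u => f u * g u) (f t * b + g t * a).
Proof. exact: is_deriveM. Qed.

Lemma isdZ f t c a : is_derive t 1 f a -> is_derive t 1 (fun u => c * f u) (c * a).
Proof. exact: is_deriveZ. Qed.

Lemma isd_comp f g t a b : is_derive (g t) 1 f a -> is_derive t 1 g b ->
  is_derive t 1 (fun u => f (g u)) (b * a).
Proof. by move=> h1 h2; have := is_derive1_comp h1 h2; rewrite mulrC. Qed.

Lemma isd_eq f t a b : is_derive t 1 f a -> a = b -> is_derive t 1 f b.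
Proof. by move=> h <-. Qed.

Lemma isd_continuous f f' : (forall t, is_derive t 1 f (f' t)) -> continuous f.
Proof.
move=> df t; apply: differentiable_continuous; apply/derivable1_diffP.
exact: (@ex_derive _ _ _ _ _ _ _ (df t)).
Qed.

End DeriveLambda.

Section OneDim.
Context (R : realType).
Notation mu1 := (@lebesgue_measure R).
Implicit Types (f F : R -> R) (a b c e x t : R).

Lemma L1_indic_itv f (i : interval R) : measurable_fun setT f ->
  mu1.-integrable [set` i] (EFin \o f) ->
  L1 mu1 (fun t => f t * \1_[set` i] t) /\
  \int[mu1]_t (f t * \1_[set` i] t) = \int[mu1]_(t in [set` i]) f t.
Proof.
move=> mf If.
have E : (fun t => f t * \1_[set` i] t) = f \_ [set` i].
  apply/funext => t; rewrite patchE indicE; case: ifPn; by rewrite ?mulr1 ?mulr0.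
rewrite E -Rintegral_mkcond; split => //.
have /integrable_mkcond := If => /(_ (measurable_itv _)).
by apply: eq_integrable => // t _; rewrite /= restrict_EFin.
Qed.

Lemma FTC_itvoc f F a b : a <= b -> continuous f ->
  (forall t : R, is_derive t 1 F (f t)) ->
  L1 mu1 (fun t => f t * \1_(`]a, b]%classic : set R) t) /\
  \int[mu1]_t (f t * \1_(`]a, b]%classic : set R) t) = F b - F a.
Proof.
move=> ab cf dF.
have mf : measurable_fun setT f := continuous_measurable_fun cf.
have cF : continuous F := isd_continuous dF.
move: ab; rewrite le_eqVlt => /predU1P[<-|ab].
  have -> : (fun t => f t * \1_(`]a, a]%classic : set R) t) = fun=> 0.
    by apply/funext => t; rewrite set_itvoc0 indic0 mulr0.
  by rewrite subrr /Rintegral integral0; split => //; exact: L1_0.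
have cab : {within `[a, b], continuous f} by exact: continuous_subspaceT.
have Iab : mu1.-integrable `[a, b] (EFin \o f).
  by apply: continuous_compact_integrable => //; exact: segment_compact.
have Ioc : mu1.-integrable `]a, b] (EFin \o f).
  by apply: integrableS Iab => //; apply: subset_itvr; rewrite bnd_simp.
have [I1 E1] := L1_indic_itv mf Ioc.
split => //; rewrite E1 /Rintegral.
have -> : (\int[mu1]_(x in `]a, b]) (f x)%:E = \int[mu1]_(x in `[a, b]) (f x)%:E)%E.
  by rewrite -integral_itv_obnd_cbnd//; exact: (measurable_int _ Ioc).
rewrite (@continuous_FTC2 _ f F)//.
  split; first by move=> t _; exact: (@ex_derive _ _ _ _ _ _ _ (dF t)).
  by apply: cvg_at_right_filter; exact: cF.
  by apply: cvg_at_left_filter; exact: cF.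
by move=> t _; rewrite derive1E; exact: derive_val.
Qed.

Lemma FTC_ray f F (l : R) : continuous f -> (forall t, 0 <= t -> 0 <= f t) ->
  (forall t : R, is_derive t 1 F (f t)) -> F t @[t --> +oo] --> l ->
  (\int[mu1]_(t in `[0%R, +oo[) (f t)%:E = (l - F 0)%:E)%E.
Proof.
move=> cf f0 dF Fl.
have cF : continuous F := isd_continuous dF.
rewrite (@ge0_continuous_FTC2y _ f F 0 l)//.
- exact: continuous_subspaceT.
- by apply: cvg_at_right_filter; exact: cF.
- by move=> t _; rewrite derive1E; exact: derive_val.
Qed.

Lemma laplace_cos e x : 0 < e ->
  let f t := expR (- (e * `|t|)) * (1 + cos (x * t)) in
  L1 mu1 f /\ \int[mu1]_t f t = 2 / e + 2 * e / (e ^+ 2 + x ^+ 2).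
Proof.
move=> e0 f.
have ex0 : 0 < e ^+ 2 + x ^+ 2 by rewrite ltr_pwDl ?exprn_gt0 ?sqr_ge0.
have f0 t : 0 <= f t.
  by rewrite mulr_ge0 ?expR_ge0//; have := cos_geN1 (x * t); lra.
have symf : f =1 f \o -%R.
  by move=> t; rewrite /f /= normrN mulrN cosN.
pose g t := expR (- (e * t)) * (1 + cos (x * t)).
pose F t := expR (- (e * t)) * ((x * sin (x * t) - e * cos (x * t)) / (e ^+ 2 + x ^+ 2) - e^-1).
have dF (t : R) : is_derive t 1 F (g t).
  apply: is_derive_eq; rewrite /g /GRing.scale /=; field.
  by rewrite !gt_eqF.
have cg : continuous g.
  apply: (@isd_continuous _ _ (fun t => g t * - e - expR (- (e * t)) * (x * sin (x * t)))) => t.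
  by apply: is_derive_eq; rewrite /g /GRing.scale /=; ring.
have cf : continuous f.
  have -> : f = g \o Num.norm.
    apply/funext => t; rewrite /f /g /=; congr (_ * (1 + _)).
    by case: (ger0P t) => // _; rewrite mulrN cosN.
  by move=> t; apply: continuous_comp; [exact: norm_continuous|exact: cg].
have g0 t : 0 <= g t.
  by rewrite mulr_ge0 ?expR_ge0//; have := cos_geN1 (x * t); lra.
have Fl : F t @[t --> +oo] --> 0.
  pose K := (`|x| + e) / (e ^+ 2 + x ^+ 2) + e^-1.
  have K0 : 0 <= K.
    apply: addr_ge0; last by rewrite invr_ge0 ltW.
    by apply: divr_ge0; [apply: addr_ge0 => //; exact: ltW|exact: ltW].
  have eK : K * expR (- (e * t)) @[t --> +oo] --> 0.
    rewrite -[X in _ --> X](mulr0 K); apply: cvgM; first exact: cvg_cst.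
    have -> : (fun t => expR (- (e * t))) = (fun t => expR (- t)) \o (fun t => e * t) by [].
    apply: (cvg_comp (fun t => e * t) (fun t => expR (- t))); last exact: cvgr_expR.
    by apply: gt0_cvgMry.
  apply/cvgrPdist_le => /= d d0; move/cvgrPdist_le : eK => /(_ d d0).
  apply: filterS => t; rewrite !sub0r !normrN => h; apply: le_trans h.
  rewrite /F normrM mulrC (normrM K) ler_wpM2r// (ger0_norm K0).
  rewrite (le_trans (ler_normB _ _))// lerD//; last by rewrite ger0_norm// invr_ge0 ltW.
  rewrite normrM normfV (gtr0_norm ex0) ler_wpM2r ?invr_ge0 ?(ltW ex0)//.
  rewrite (le_trans (ler_normB _ _))// lerD// normrM ?(gtr0_norm e0).
    by rewrite ler_piMr// ler_norml sin_geN1 sin_le1.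
  by rewrite ler_piMr// ?(ltW e0)// ler_norml cos_geN1 cos_le1.
have IE : (\int[mu1]_t (f t)%:E = (2 / e + 2 * e / (e ^+ 2 + x ^+ 2))%:E)%E.
  rewrite ge0_symfun_integralT// -set_itvcy.
  transitivity (2%:E * \int[mu1]_(t in `[0%R, +oo[) (g t)%:E)%E.
    congr (_ * _)%E; apply: eq_integral => t; rewrite inE /= in_itv /= andbT => t0.
    by rewrite /f ger0_norm.
  rewrite (FTC_ray cg _ dF Fl)// -EFinM; congr (_%:E).
  rewrite /F !mulr0 oppr0 expR0 sin0 cos0; field.
  by rewrite !gt_eqF.
have If : L1 mu1 f.
  apply: L1_lty; first exact: continuous_measurable_fun.
  by under eq_integral do rewrite ger0_norm//; rewrite IE ltry.
by split => //; rewrite /Rintegral IE.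
Qed.

Definition lapw e t := expR (- (e * `|t|)).

Lemma lapw_gt0 e t : 0 < lapw e t.
Proof. exact: expR_gt0. Qed.

Lemma L1_lapw e : 0 < e -> L1 mu1 (lapw e).
Proof.
move=> e0; have [I _] := laplace_cos 0 e0.
have -> : lapw e = fun t => 2^-1 * (expR (- (e * `|t|)) * (1 + cos (0 * t))).
  by apply/funext => t; rewrite mul0r cos0 /lapw; field.
exact: L1Z.
Qed.

Lemma Rint_lapw e : 0 < e -> \int[mu1]_t lapw e t = 2 / e.
Proof.
move=> e0; have [I E] := laplace_cos 0 e0.
have -> : lapw e = fun t => 2^-1 * (expR (- (e * `|t|)) * (1 + cos (0 * t))).
  by apply/funext => t; rewrite mul0r cos0 /lapw; field.
by rewrite RintZ// E; field; rewrite gt_eqF.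
Qed.

Lemma measurable_scale x : measurable_fun [set: measurableTypeR R]
  ((fun t => x * t) : R -> R).
Proof. exact: measurable_funM. Qed.

Lemma L1_lapw_cos e x : 0 < e -> L1 mu1 (fun t => lapw e t * cos (x * t)).
Proof.
move=> e0; apply: (@L1_bdM _ _ _ _ _ _ 1); last exact: L1_lapw.
  apply: measurableT_comp; last exact: measurable_scale.
  by apply: continuous_measurable_fun; exact: continuous_cos.
by move=> t; rewrite ler_norml cos_geN1 cos_le1.
Qed.

Lemma L1_lapw_sin e x : 0 < e -> L1 mu1 (fun t => lapw e t * sin (x * t)).
Proof.
move=> e0; apply: (@L1_bdM _ _ _ _ _ _ 1); last exact: L1_lapw.
  apply: measurableT_comp; last exact: measurable_scale.
  by apply: continuous_measurable_fun; exact: continuous_sin.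
by move=> t; rewrite ler_norml sin_geN1 sin_le1.
Qed.

Lemma Rint_lapw_cos e x : 0 < e ->
  \int[mu1]_t (lapw e t * cos (x * t)) = 2 * e / (e ^+ 2 + x ^+ 2).
Proof.
move=> e0; have [I E] := laplace_cos x e0.
have -> : (fun t => lapw e t * cos (x * t)) =
  fun t => expR (- (e * `|t|)) * (1 + cos (x * t)) - lapw e t.
  by apply/funext => t; rewrite /lapw; ring.
by rewrite RintB ?Rint_lapw ?E//; [ring|exact: L1_lapw].
Qed.

Lemma Rint_lapw_sin e x : 0 < e -> \int[mu1]_t (lapw e t * sin (x * t)) = 0.
Proof.
move=> e0; have I := L1_lapw_sin x e0.
have mN : measurable_fun [set: measurableTypeR R] (-%R : measurableTypeR R -> measurableTypeR R).
  exact: measurable_funN.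
have := Rint_preserving mN (@leb1_oppr R) I.
rewrite (_ : (fun _ => _) = fun t => - (lapw e t * sin (x * t))); last first.
  by apply/funext => t; rewrite /lapw normrN mulrN sinN mulrN.
rewrite RintN//; lra.
Qed.

Definition poisson e x y := 2 * e / (e ^+ 2 + (x - y) ^+ 2).

Lemma poisson_ge0 e x y : 0 < e -> 0 <= poisson e x y.
Proof. by move=> e0; rewrite divr_ge0 ?mulr_ge0 ?addr_ge0 ?sqr_ge0// ltW. Qed.

Lemma poissonC e x y : poisson e x y = poisson e y x.
Proof. by rewrite /poisson (_ : (x - y) ^+ 2 = (y - x) ^+ 2)//; ring. Qed.

Lemma continuous_cauchy e : 0 < e -> continuous (fun t => 2 * e / (e ^+ 2 + t ^+ 2) : R).
Proof.
move=> e0 t; apply: cvgM; first exact: cvg_cst.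
apply: cvgV; first by rewrite gt_eqF// ltr_pwDl ?exprn_gt0 ?sqr_ge0.
apply: cvgD; first exact: cvg_cst.
exact: exprn_continuous.
Qed.

Lemma poisson_itv e x a b : 0 < e -> a <= b ->
  L1 mu1 (fun y => poisson e x y * \1_(`]a, b]%classic : set R) y) /\
  \int[mu1]_y (poisson e x y * \1_(`]a, b]%classic : set R) y) =
  2 * (atan ((b - x) / e) - atan ((a - x) / e)).
Proof.
move=> e0 ab; rewrite mulrBr.
apply: (@FTC_itvoc _ (fun y => 2 * atan ((y - x) / e))) => //.
  move=> y; apply: (continuous_comp (f := fun y => x - y)
    (g := fun t => 2 * e / (e ^+ 2 + t ^+ 2) : R)).
    by apply: cvgB; [exact: cvg_cst|exact: cvg_id].
  exact: continuous_cauchy.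
move=> y; apply: is_derive_eq; rewrite /poisson /GRing.scale /=; field.
by rewrite !gt_eqF// ltr_pwDl ?exprn_gt0 ?sqr_ge0.
Qed.

Lemma measurable_poisson e x : 0 < e ->
  measurable_fun [set: measurableTypeR R] (poisson e x).
Proof.
move=> e0; apply: continuous_measurable_fun => y.
apply: (continuous_comp (f := fun y => x - y)
    (g := fun t => 2 * e / (e ^+ 2 + t ^+ 2) : R)); last exact: continuous_cauchy.
by apply: cvgB; [exact: cvg_cst|exact: cvg_id].
Qed.

Lemma L1_poisson e x : 0 < e ->
  L1 mu1 (poisson e x) /\ \int[mu1]_y poisson e x y <= 2 * pi.
Proof.
move=> e0; have mp := @measurable_poisson _ x e0.
have [|||||I E] := @Rint_fatou _ _ _ mu1
  (fun n y => poisson e x y * \1_(`]- (n%:R : R), n%:R]%classic : set R) y)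
  (poisson e x) (2 * pi).
- by move=> n; have [] := @poisson_itv e x (- n%:R) n%:R e0 (ge0_cp (ler0n R n)).2.
- by move=> n y; rewrite mulr_ge0 ?poisson_ge0.
- by [].
- apply: ae_all => y; apply: cvg_near_cst; near=> n.
  rewrite indicE mem_set ?mulr1//= in_itv /=.
  have h : `|y| < n%:R by near: n; exact: nbhs_infty_gtr.
  by move: h; rewrite ltr_norml => /andP[h1 h2]; rewrite h1 ltW.
- move=> n; have [_ ->] := @poisson_itv e x (- n%:R) n%:R e0 (ge0_cp (ler0n R n)).2.
  have := atan_ltpi2 ((n%:R - x) / e); have := atan_gtNpi2 ((- n%:R - x) / e); lra.
split => //; apply: le_trans E; rewrite le_eqVlt; apply/orP; left; apply/eqP.
by congr Rintegral; apply/funext => y; rewrite ger0_norm ?poisson_ge0.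
Unshelve. all: by end_near. Qed.

End OneDim.

(** * The Hartley transform *)

Section HartleyL1.
Context (R : realType).
Notation mu1 := (@lebesgue_measure R).
Notation P2 := (measurableTypeR R * measurableTypeR R)%type.
Implicit Types (f g v : R * R -> R) (x y z xi : R * R) (e t : R).

Definition cas t : R := cos t + sin t.

Lemma cas_le2 t : `|cas t| <= 2.
Proof.
rewrite /cas (le_trans (ler_normD _ _))// (_ : 2 = 1 + 1)//; apply: lerD.
  by rewrite ler_norml cos_geN1 cos_le1.
by rewrite ler_norml sin_geN1 sin_le1.
Qed.

Lemma continuous_cas : continuous cas.
Proof. by move=> t; apply: cvgD; [exact: continuous_cos|exact: continuous_sin]. Qed.

Lemma casM (a b : R) : cas a * cas b = cos (a - b) + sin (a + b).
Proof. by rewrite /cas cosB sinD; ring. Qed.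

Lemma dot2C z xi : dot2 z xi = dot2 xi z.
Proof. by rewrite /dot2 mulrC [X in _ + X]mulrC. Qed.

Lemma measurable_dot2 z : measurable_fun [set: P2] (dot2 z : P2 -> R).
Proof.
by apply: measurable_funD; apply: measurable_funM => //.
Qed.

Lemma measurable_dot2P : measurable_fun [set: P2 * P2] ((fun p => dot2 p.1 p.2) : P2 * P2 -> R).
Proof.
apply: measurable_funD; apply: measurable_funM;
  by (apply: measurableT_comp; [exact: measurable_fst|
       (exact: measurable_fst || exact: measurable_snd)]) ||
     (apply: measurableT_comp; [exact: measurable_snd|
       (exact: measurable_fst || exact: measurable_snd)]).
Qed.

Lemma measurable_cas_dot2 z : measurable_fun [set: P2] ((fun xi => cas (dot2 z xi)) : P2 -> R).
Proof.
apply: measurableT_comp; last exact: measurable_dot2.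
by apply: continuous_measurable_fun; exact: continuous_cas.
Qed.

Lemma measurable_cas_dot2' xi : measurable_fun [set: P2] ((fun z => cas (dot2 z xi)) : P2 -> R).
Proof. by under eq_fun do rewrite dot2C; exact: measurable_cas_dot2. Qed.

Lemma measurable_cas_dot2P :
  measurable_fun [set: P2 * P2] ((fun p => cas (dot2 p.1 p.2)) : P2 * P2 -> R).
Proof.
apply: measurableT_comp; last exact: measurable_dot2P.
by apply: continuous_measurable_fun; exact: continuous_cas.
Qed.

Definition hf f xi : R := \int[leb2]_z (f z * cas (dot2 z xi)).

Lemma L1_cas f xi : L1 leb2 f -> L1 leb2 (fun z => f z * cas (dot2 z xi)).
Proof.
move=> If; apply: (@L1_bdM _ _ _ _ _ _ 2) If; first exact: measurable_cas_dot2'.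
by move=> z; exact: cas_le2.
Qed.

Lemma hf_le f xi : L1 leb2 f -> `|hf f xi| <= 2 * \int[leb2]_z `|f z|.
Proof.
move=> If; apply: (le_trans (Rint_abs (L1_cas xi If))).
rewrite -RintZ; last exact: L1_abs.
apply: Rint_le.
- exact/L1_abs/L1_cas.
- exact/L1Z/L1_abs.
- by move=> z; rewrite normrM mulrC ler_wpM2r// cas_le2.
Qed.

Lemma L1_hf_swap f g : L1 leb2 f -> L1 leb2 g ->
  L1 (sleb2 R \x sleb2 R)%E (fun p => f p.1 * g p.2 * cas (dot2 p.1 p.2)).
Proof.
move=> If Ig; have [I _] := L1_tensor (m1 := sleb2 R) (m2 := sleb2 R) If Ig.
apply: (@L1_bdM _ _ _ _ _ _ 2) I; first exact: measurable_cas_dot2P.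
by move=> z; exact: cas_le2.
Qed.

Lemma hf_swap f g : L1 leb2 f -> L1 leb2 g ->
  \int[leb2]_xi (hf f xi * g xi) = \int[leb2]_z (f z * hf g z).
Proof.
move=> If Ig; have I := L1_hf_swap If Ig.
have := Rint_swap I; rewrite /=.
have -> : (fun z => \int[sleb2 R]_y (f z * g y * cas (dot2 z y))) =
    (fun z => f z * hf g z).
  apply/funext => z; rewrite /hf -RintZ; last exact: L1_cas.
  by congr Rintegral; apply/funext => y; rewrite dot2C; ring.
have -> : (fun y => \int[sleb2 R]_z (f z * g y * cas (dot2 z y))) =
    (fun y => hf f y * g y).
  apply/funext => y; rewrite mulrC /hf -RintZ; last exact: L1_cas.
  by congr Rintegral; apply/funext => z; ring.
by move=> ->.
Qed.

Definition wgt e xi : R := lapw e xi.1 * lapw e xi.2.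

Lemma wgt_gt0 e xi : 0 < wgt e xi.
Proof. by rewrite mulr_gt0 ?lapw_gt0. Qed.

Lemma wgt_le1 e xi : 0 < e -> wgt e xi <= 1.
Proof.
move=> e0; have h (t : R) : lapw e t <= 1.
  by rewrite /lapw expR_le1 oppr_le0 mulr_ge0// ltW.
by rewrite mulr_ile1 ?h// ltW ?lapw_gt0.
Qed.

Lemma L1_wgt e : 0 < e -> L1 leb2 (wgt e).
Proof. by move=> e0; have [] := L1_tensor (L1_lapw e0) (L1_lapw e0). Qed.

Lemma measurable_hf f : L1 leb2 f -> measurable_fun [set: P2] (hf f : P2 -> R).
Proof.
move=> If; have I1 := L1_wgt (@ltr01 R).
have [/L1_meas] := L1_fubini21 (L1_hf_swap If I1).
have -> : (fun y => \int[sleb2 R]_x ((fun p => f p.1 * wgt 1 p.2 * cas (dot2 p.1 p.2)) (x, y))) =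
    (fun y => hf f y * wgt 1 y).
  apply/funext => y; rewrite mulrC /hf -RintZ; last exact: L1_cas.
  by congr Rintegral; apply/funext => z /=; ring.
move=> m _.
have -> : hf f = (fun y => hf f y * wgt 1 y * (expR `|y.1| * expR `|y.2|)).
  apply/funext => y; rewrite /wgt /lapw !mul1r !expRN; field.
  by rewrite !gt_eqF// expR_gt0.
apply: measurable_funM => //; apply: measurable_funM.
  apply: (@measurableT_comp _ _ _ _ _ _ (fun t : measurableTypeR R => expR `|t| : R)).
    by apply: measurableT_comp => //; exact: measurable_expR.
  exact: measurable_fst.
apply: (@measurableT_comp _ _ _ _ _ _ (fun t : measurableTypeR R => expR `|t| : R)).
  by apply: measurableT_comp => //; exact: measurable_expR.
exact: measurable_snd.
Qed.

Lemma Rint_wgt_cos e x : 0 < e ->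
  L1 leb2 (fun xi => wgt e xi * cos (dot2 x xi)) /\
  \int[leb2]_xi (wgt e xi * cos (dot2 x xi)) =
  (2 * e / (e ^+ 2 + x.1 ^+ 2)) * (2 * e / (e ^+ 2 + x.2 ^+ 2)).
Proof.
move=> e0.
have [I1 E1] := L1_tensor (L1_lapw_cos x.1 e0) (L1_lapw_cos x.2 e0).
have [I2 E2] := L1_tensor (L1_lapw_sin x.1 e0) (L1_lapw_sin x.2 e0).
have -> : (fun xi => wgt e xi * cos (dot2 x xi)) = fun xi =>
   (lapw e xi.1 * cos (x.1 * xi.1)) * (lapw e xi.2 * cos (x.2 * xi.2)) -
   (lapw e xi.1 * sin (x.1 * xi.1)) * (lapw e xi.2 * sin (x.2 * xi.2)).
  by apply/funext => xi; rewrite /wgt /dot2 cosD; ring.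
split; first exact: L1B.
by rewrite RintB// E1 E2 !Rint_lapw_cos// !Rint_lapw_sin// mulr0 subr0.
Qed.

Lemma Rint_wgt_sin e x : 0 < e ->
  L1 leb2 (fun xi => wgt e xi * sin (dot2 x xi)) /\
  \int[leb2]_xi (wgt e xi * sin (dot2 x xi)) = 0.
Proof.
move=> e0.
have [I1 E1] := L1_tensor (L1_lapw_sin x.1 e0) (L1_lapw_cos x.2 e0).
have [I2 E2] := L1_tensor (L1_lapw_cos x.1 e0) (L1_lapw_sin x.2 e0).
have -> : (fun xi => wgt e xi * sin (dot2 x xi)) = fun xi =>
   (lapw e xi.1 * sin (x.1 * xi.1)) * (lapw e xi.2 * cos (x.2 * xi.2)) +
   (lapw e xi.1 * cos (x.1 * xi.1)) * (lapw e xi.2 * sin (x.2 * xi.2)).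
  by apply/funext => xi; rewrite /wgt /dot2 sinD; ring.
split; first exact: L1D.
by rewrite RintD// E1 E2 !Rint_lapw_sin// mulr0 mul0r addr0.
Qed.

Definition poisson2 e x y : R := poisson e x.1 y.1 * poisson e x.2 y.2.

(* The weight is a product of two-sided exponentials, whose transform is the Poisson kernel. *)
Lemma hf_wgt_cas e x y : 0 < e ->
  hf (fun xi => wgt e xi * cas (dot2 x xi)) y = poisson2 e x y.
Proof.
move=> e0; rewrite /hf.
have [I1 E1] := Rint_wgt_cos (x.1 - y.1, x.2 - y.2) e0.
have [I2 E2] := Rint_wgt_sin (x.1 + y.1, x.2 + y.2) e0.
transitivity (\int[leb2]_xi (wgt e xi * cos (dot2 (x.1 - y.1, x.2 - y.2) xi) +
    wgt e xi * sin (dot2 (x.1 + y.1, x.2 + y.2) xi))).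
  congr Rintegral; apply/funext => xi; rewrite -mulrA casM -mulrDr.
  by rewrite /dot2 /=; congr (_ * (cos _ + sin _)); ring.
by rewrite RintD// E1 E2 addr0.
Qed.

Lemma L1_wgt_cas e x : 0 < e -> L1 leb2 (fun xi => wgt e xi * cas (dot2 x xi)).
Proof.
move=> e0; apply: (@L1_bdM _ _ _ _ _ _ 2) (L1_wgt e0); first exact: measurable_cas_dot2.
by move=> z; exact: cas_le2.
Qed.

Lemma L1_hfM f g : L1 leb2 f -> L1 leb2 g -> L1 leb2 (fun x => g x * hf f x).
Proof.
move=> If; apply: L1_bdM; first exact: measurable_hf.
by move=> x; exact: hf_le.
Qed.

Lemma Rint_wgt_hf e f g : 0 < e -> L1 leb2 f -> L1 leb2 g ->
  \int[leb2]_xi (wgt e xi * (hf f xi * hf g xi)) =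
  \int[leb2]_x (f x * \int[leb2]_y (g y * poisson2 e x y)).
Proof.
move=> e0 If Ig.
transitivity (\int[leb2]_xi (hf f xi * (wgt e xi * hf g xi))).
  by congr Rintegral; apply/funext => xi; ring.
rewrite (hf_swap If (L1_hfM Ig (L1_wgt e0))).
congr Rintegral; apply/funext => x; congr (_ * _).
rewrite {1}/hf.
transitivity (\int[leb2]_xi (hf g xi * (wgt e xi * cas (dot2 x xi)))).
  by congr Rintegral; apply/funext => xi; rewrite dot2C; ring.
rewrite (hf_swap Ig (L1_wgt_cas x e0)).
by congr Rintegral; apply/funext => y; rewrite hf_wgt_cas.
Qed.

End HartleyL1.

Section Schur.
Context d1 d2 (T1 : measurableType d1) (T2 : measurableType d2) (R : realType).
Variable m1 : {sigma_finite_measure set T1 -> \bar R}.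
Variable m2 : {sigma_finite_measure set T2 -> \bar R}.
Variables (k : T1 * T2 -> R) (A : R).
Hypotheses (mk : measurable_fun setT k) (k0 : forall p, 0 <= k p).
Hypotheses (k1 : forall x, L1 m2 (fun y => k (x, y)) /\ \int[m2]_y k (x, y) <= A).
Hypotheses (k2 : forall y, L1 m1 (fun x => k (x, y)) /\ \int[m1]_x k (x, y) <= A).

Let schur1 (f : T1 -> R) : L2 m1 f ->
  L1 (m1 \x m2)%E (fun p => f p.1 ^+ 2 * k p) /\
  \int[(m1 \x m2)%E]_p (f p.1 ^+ 2 * k p) <= A * ip m1 f f.
Proof.
move=> [mf If].
have I : L1 (m1 \x m2)%E (fun p => f p.1 ^+ 2 * k p).
  apply: (@L1_prod12 _ _ _ _ _ _ _ _ (fun x => A * f x ^+ 2)).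
  - apply: measurable_funM => //; apply: measurable_funX.
    by apply: measurableT_comp => //; exact: measurable_fst.
  - by move=> x /=; apply: L1Z; case: (k1 x).
  - move=> x; have [I E] := k1 x.
    under eq_fun do rewrite /= normrM (ger0_norm (sqr_ge0 _)) (ger0_norm (k0 _)).
    by rewrite RintZ// mulrC ler_wpM2r// sqr_ge0.
  - exact: L1Z.
have [I1 E1] := L1_fubini12 I.
split => //; rewrite -E1 /ip.
have -> : (fun x => f x * f x) = (fun x => f x ^+ 2).
  by apply/funext => x; rewrite expr2.
rewrite -RintZ//; apply: Rint_le => //; first exact: L1Z.
by move=> x /=; have [J E] := k1 x; rewrite RintZ// mulrC ler_wpM2r// sqr_ge0.
Qed.

Let schur2 (g : T2 -> R) : L2 m2 g ->
  L1 (m1 \x m2)%E (fun p => g p.2 ^+ 2 * k p) /\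
  \int[(m1 \x m2)%E]_p (g p.2 ^+ 2 * k p) <= A * ip m2 g g.
Proof.
move=> [mf If].
have I : L1 (m1 \x m2)%E (fun p => g p.2 ^+ 2 * k p).
  apply: (@L1_prod21 _ _ _ _ _ _ _ _ (fun x => A * g x ^+ 2)).
  - apply: measurable_funM => //; apply: measurable_funX.
    by apply: measurableT_comp => //; exact: measurable_snd.
  - by move=> x /=; apply: L1Z; case: (k2 x).
  - move=> x; have [I E] := k2 x.
    under eq_fun do rewrite /= normrM (ger0_norm (sqr_ge0 _)) (ger0_norm (k0 _)).
    by rewrite RintZ// mulrC ler_wpM2r// sqr_ge0.
  - exact: L1Z.
have [I1 E1] := L1_fubini21 I.
split => //; rewrite -E1 /ip.
have -> : (fun x => g x * g x) = (fun x => g x ^+ 2).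
  by apply/funext => x; rewrite expr2.
rewrite -RintZ//; apply: Rint_le => //; first exact: L1Z.
by move=> x /=; have [J E] := k2 x; rewrite RintZ// mulrC ler_wpM2r// sqr_ge0.
Qed.

Lemma schur_test (f : T1 -> R) (g : T2 -> R) : L2 m1 f -> L2 m2 g ->
  L1 (m1 \x m2)%E (fun p => f p.1 * k p * g p.2) /\
  2 * `|\int[(m1 \x m2)%E]_p (f p.1 * k p * g p.2)| <= A * (ip m1 f f + ip m2 g g).
Proof.
move=> Lf Lg; have [I1 E1] := schur1 Lf; have [I2 E2] := schur2 Lg.
have h p : 2 * `|f p.1 * k p * g p.2| <= f p.1 ^+ 2 * k p + g p.2 ^+ 2 * k p.
  rewrite !normrM (ger0_norm (k0 p)) -(real_normK (num_real (f p.1))).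
  rewrite -(real_normK (num_real (g p.2))).
  move: (k0 p) (sqr_ge0 (`|f p.1| - `|g p.2|)).
  set a := `|f p.1|; set b := `|g p.2|; set c := k p => c0 q.
  rewrite -subr_ge0 (_ : _ - _ = c * (a - b) ^+ 2); last by ring.
  exact: mulr_ge0.
have I : L1 (m1 \x m2)%E (fun p => f p.1 * k p * g p.2).
  apply: (@L1_dom _ _ _ _ _ (fun p => f p.1 ^+ 2 * k p + g p.2 ^+ 2 * k p)); last exact: L1D.
    apply: measurable_funM; first apply: measurable_funM => //.
      by apply: measurableT_comp; [case: Lf|exact: measurable_fst].
    by apply: measurableT_comp; [case: Lg|exact: measurable_snd].
  by move=> p; apply: le_trans (h p); rewrite ler_peMl ?normr_ge0 ?ler1n.
split => //.
apply: (@le_trans _ _ (2 * \int[(m1 \x m2)%E]_p `|f p.1 * k p * g p.2|)).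
  by rewrite ler_wpM2l// Rint_abs.
rewrite -RintZ; last exact: L1_abs.
rewrite mulrDr; apply: le_trans (lerD E1 E2).
rewrite -RintD//; apply: Rint_le => //; [exact/L1Z/L1_abs|exact: L1D].
Qed.

End Schur.

Section HartleyL1L2.
Context (R : realType).
Notation mu1 := (@lebesgue_measure R).
Notation P2 := (measurableTypeR R * measurableTypeR R)%type.
Implicit Types (f g v : R * R -> R) (x y z xi : R * R) (e t : R).

Lemma measurable_poisson2 e : 0 < e ->
  measurable_fun [set: P2 * P2] ((fun p => poisson2 e p.1 p.2) : P2 * P2 -> R).
Proof.
move=> e0.
have mc : measurable_fun [set: R] (fun t => 2 * e / (e ^+ 2 + t ^+ 2) : R).
  by apply: continuous_measurable_fun; exact: continuous_cauchy.
apply: measurable_funM; apply: (measurableT_comp mc); apply: measurable_funB;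
  apply: measurableT_comp => //; (exact: measurable_fst || exact: measurable_snd || idtac);
  by apply: measurableT_comp.
Qed.

Lemma poisson2C e x y : poisson2 e x y = poisson2 e y x.
Proof. by rewrite /poisson2 poissonC (poissonC _ x.2). Qed.

Lemma L1_poisson2 e x : 0 < e ->
  L1 leb2 (poisson2 e x) /\ \int[leb2]_y poisson2 e x y <= (2 * pi) ^+ 2.
Proof.
move=> e0; have [I1 E1] := L1_poisson x.1 e0; have [I2 E2] := L1_poisson x.2 e0.
have [I E] := L1_tensor I1 I2; split => //.
rewrite [leLHS]E expr2; apply: ler_pM => //;
  by apply: Rint_ge0 => y; exact: poisson_ge0.
Qed.

Lemma poisson_bound e (a b : R) : 0 < e -> poisson e a b <= 2 / e.
Proof.
move=> e0; have q : 0 < e ^+ 2 + (a - b) ^+ 2 by rewrite ltr_pwDl ?exprn_gt0 ?sqr_ge0.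
rewrite /poisson ler_pdivrMr// mulrAC ler_pdivlMr//.
by have := sqr_ge0 (a - b); nra.
Qed.

Lemma L1_mul_poisson2 e x g : 0 < e -> L1 leb2 g ->
  L1 leb2 (fun y => g y * poisson2 e x y).
Proof.
move=> e0; apply: (@L1_bdM _ _ _ _ _ _ ((2 / e) * (2 / e))).
  by have [/L1_meas] := L1_poisson2 x e0.
move=> y; rewrite ger0_norm; last by apply: mulr_ge0; exact: poisson_ge0.
by apply: ler_pM; (exact: poisson_ge0 || exact: poisson_bound).
Qed.

Lemma poisson2_form e f g : 0 < e -> L2 leb2 f -> L2 leb2 g -> L1 leb2 g ->
  2 * `|\int[leb2]_x (f x * \int[leb2]_y (g y * poisson2 e x y))| <=
    (2 * pi) ^+ 2 * (ip leb2 f f + ip leb2 g g).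
Proof.
move=> e0 Lf Lg Ig.
have [||||I E] := @schur_test _ _ _ _ R (sleb2 R) (sleb2 R)
  (fun p => poisson2 e p.1 p.2) ((2 * pi) ^+ 2) _ _ _ _ f g Lf Lg.
- exact: measurable_poisson2.
- by move=> p; rewrite mulr_ge0 ?poisson_ge0.
- by move=> x; exact: L1_poisson2.
- move=> y /=; under eq_fun do rewrite poisson2C; exact: L1_poisson2.
apply: le_trans E; rewrite -(L1_fubini12 I).2 /=.
rewrite le_eqVlt; apply/orP; left; apply/eqP; congr (_ * `|_|).
congr Rintegral; apply/funext => x.
rewrite -RintZ; last exact: L1_mul_poisson2.
by congr Rintegral; apply/funext => y; ring.
Qed.

Definition eps n : R := n.+1%:R^-1.

Lemma eps_gt0 n : 0 < eps n.
Proof. by rewrite invr_gt0. Qed.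

Lemma wgt_cvg xi : wgt (eps n) xi @[n --> \oo] --> (1 : R).
Proof.
have h (t : R) : lapw (eps n) t @[n --> \oo] --> (1 : R).
  rewrite /lapw -expR0; apply: (cvg_comp _ expR); last exact: continuous_expR.
  rewrite -oppr0; apply: cvgN; rewrite -(mul0r `|t|).
  by apply: cvgM; [exact: cvg_harmonic|exact: cvg_cst].
by rewrite -(mulr1 1); apply: cvgM; exact: h.
Qed.

Lemma measurable_wgt e : 0 < e -> measurable_fun [set: P2] (wgt e : P2 -> R).
Proof. by move=> /L1_wgt/L1_meas. Qed.

Lemma L1_wgtM e g : 0 < e -> L1 leb2 g -> L1 leb2 (fun xi => wgt e xi * g xi).
Proof.
move=> e0 Ig; under eq_fun do rewrite mulrC.
apply: (@L1_bdM _ _ _ _ _ _ 1) Ig; first exact: measurable_wgt.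
by move=> xi; rewrite ger0_norm ?wgt_le1// ltW// wgt_gt0.
Qed.

Lemma hf_L2 f : L1 leb2 f -> L2 leb2 f ->
  L2 leb2 (hf f) /\ ip leb2 (hf f) (hf f) <= (2 * pi) ^+ 2 * ip leb2 f f.
Proof.
move=> If Lf; have mh := measurable_hf If.
have bd xi := @hf_le _ _ xi If.
have I1 n : L1 leb2 (fun xi => wgt (eps n) xi * (hf f xi * hf f xi)).
  have e0 := eps_gt0 n.
  have -> : (fun xi => wgt (eps n) xi * (hf f xi * hf f xi)) =
      fun xi => (wgt (eps n) xi * hf f xi) * hf f xi by apply/funext => xi; ring.
  by apply: (L1_bdM mh bd); apply: (L1_bdM mh bd); exact: L1_wgt.
have [|||||I E] := @Rint_fatou _ _ _ leb2
  (fun n xi => wgt (eps n) xi * (hf f xi * hf f xi)) (fun xi => hf f xi * hf f xi)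
  ((2 * pi) ^+ 2 * ip leb2 f f).
- exact: I1.
- by move=> n xi; apply: mulr_ge0; [exact/ltW/wgt_gt0|rewrite -expr2 sqr_ge0].
- exact: measurable_funM.
- apply: ae_all => xi; rewrite -[X in _ --> X]mul1r.
  by apply: cvgM; [exact: wgt_cvg|exact: cvg_cst].
- move=> n; rewrite (Rint_wgt_hf (eps_gt0 n) If If).
  have := poisson2_form (eps_gt0 n) Lf Lf If.
  set I := \int[_]_x _; have := ler_norm I; lra.
have EE : (fun xi => `|hf f xi * hf f xi|) = (fun xi => hf f xi * hf f xi).
  by apply/funext => xi; rewrite ger0_norm// -expr2 sqr_ge0.
rewrite EE in E.
by split => //; split => //; under eq_fun do rewrite expr2.
Qed.

Definition irect (a b c d : R) z : R := \1_(rect a b c d) z.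

Lemma irectE a b c d z : irect a b c d z =
  \1_(`]a, b]%classic : set R) z.1 * \1_(`]c, d]%classic : set R) z.2 :> R.
Proof. exact: indic_setX. Qed.

Lemma irect_bound a b c d z : `|irect a b c d z| <= 1.
Proof. by rewrite /irect indicE; case: (_ \in _) => /=; rewrite ?normr1 ?normr0. Qed.

Lemma measurable_irect a b c d : measurable_fun [set: P2] (irect a b c d : P2 -> R).
Proof. by apply: measurable_indic; exact: measurable_rect. Qed.

Lemma L1_irect a b c d : L1 leb2 (irect a b c d).
Proof.
have h (u v : R) : L1 mu1 (\1_(`]u, v]%classic : set R) : R -> R).
  by apply: integrable_indic_itv.
have [I _] := L1_tensor (h a b) (h c d).
by have -> : irect a b c d = (fun z => \1_(`]a, b]%classic : set R) z.1 *
  \1_(`]c, d]%classic : set R) z.2) by apply/funext => z; exact: irectE.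
Qed.

Lemma L2_irect a b c d : L2 leb2 (irect a b c d).
Proof.
split; first exact: measurable_irect.
under eq_fun do rewrite expr2.
by apply: (L1_bdM (measurable_irect a b c d) (irect_bound a b c d)); exact: L1_irect.
Qed.

Lemma ip0 d (T : measurableType d) (mu : {measure set T -> \bar R}) (h : T -> R) :
  ip mu h (fun=> 0) = 0.
Proof. by rewrite /ip; under eq_fun do rewrite mulr0; rewrite /Rintegral integral0. Qed.

Lemma hf0 : hf (fun=> 0 : R) = fun=> 0 :> R.
Proof.
apply/funext => x; rewrite /hf; under eq_fun do rewrite mul0r.
by rewrite /Rintegral integral0.
Qed.

Let itvpart e (a b x : R) : R := 2 * (atan ((b - x) / e) - atan ((a - x) / e)).

Let itvpart_bound e (a b x : R) : `|itvpart e a b x| <= 2 * pi.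
Proof.
have := atan_ltpi2 ((b - x) / e); have := atan_gtNpi2 ((b - x) / e).
have := atan_ltpi2 ((a - x) / e); have := atan_gtNpi2 ((a - x) / e).
by rewrite ler_norml /itvpart => *; apply/andP; split; lra.
Qed.

Let atan_eps (u : R) : u != 0 ->
  atan (u / eps n) @[n --> \oo] --> (Num.sg u * (pi / 2)).
Proof.
move=> u0; rewrite /eps; under eq_fun do rewrite invrK.
wlog up : u u0 / 0 < u => [hw|].
  have [|un] := ltP 0 u; first exact: hw.
  have un' : 0 < - u by rewrite oppr_gt0 lt_neqAle u0.
  have := hw (- u); rewrite oppr_eq0 => /(_ u0 un') h.
  rewrite -[u]opprK sgrN mulNr; under eq_fun do rewrite mulNr atanN.
  exact: cvgN.
rewrite gtr0_sg// mul1r; apply: (cvg_comp _ atan); last exact: cvgy_atan.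
have h : n.+1%:R @[n --> \oo] --> (+oo : set_system R).
  by apply: (cvg_comp S (fun n => n%:R : R)); [exact: cvg_addnl 1%N|exact: cvgr_idn].
exact: (cvg_comp _ (fun r : R => u * r) h (gt0_cvgMry up (@cvg_id _ _))).
Qed.

Let itvpart_cvg (a b x : R) : a <= b -> x != a -> x != b ->
  itvpart (eps n) a b x @[n --> \oo] --> 2 * pi * \1_(`]a, b]%classic : set R) x.
Proof.
move=> ab xa xb.
have a0 : a - x != 0 by rewrite subr_eq0 eq_sym.
have b0 : b - x != 0 by rewrite subr_eq0 eq_sym.
have -> : 2 * pi * \1_(`]a, b]%classic : set R) x =
    2 * (Num.sg (b - x) * (pi / 2) - Num.sg (a - x) * (pi / 2)).
  rewrite indicE.
  have [|] := boolP (x \in _) => [/set_mem /=|/negP xN].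
    rewrite in_itv /= => /andP[ax xleb].
    have xltb : x < b by rewrite lt_neqAle xb.
    by rewrite gtr0_sg ?subr_gt0// ltr0_sg ?subr_lt0//= ; field.
  have [xlea|altx] := leP x a.
    have xlta : x < a by rewrite lt_neqAle xa.
    by rewrite !gtr0_sg ?subr_gt0// ?(lt_le_trans xlta)//= ; field.
  have bltx : b < x.
    rewrite ltNge; apply/negP => xleb; apply: xN; apply/mem_set => /=.
    by rewrite in_itv /= altx.
  by rewrite !ltr0_sg ?subr_lt0//=; field.
by apply: cvgM; [exact: cvg_cst|apply: cvgB; exact: atan_eps].
Qed.

Let ae_neq1 (a : R) : {ae leb2, forall z : R * R, z.1 != a}.
Proof.
exists ([set a] `*` setT); split.
- by apply: measurableX => //; exact: measurable_set1.
- have m1 : @measurable _ (measurableTypeR R) [set a] by exact: measurable_set1.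
  by rewrite (leb2_rect m1)// lebesgue_measure_set1 mul0e.
- by move=> z /= /negP; rewrite negbK => /eqP; split.
Qed.

Let ae_neq2 (a : R) : {ae leb2, forall z : R * R, z.2 != a}.
Proof.
exists (setT `*` [set a]); split.
- by apply: measurableX => //; exact: measurable_set1.
- have m1 : @measurable _ (measurableTypeR R) [set a] by exact: measurable_set1.
  by rewrite (leb2_rect _ m1)// lebesgue_measure_set1 mule0.
- by move=> z /= /negP; rewrite negbK => /eqP; split.
Qed.

Let ae_neq2cd (c d : R) : {ae leb2, forall z : R * R, z.2 != c /\ z.2 != d}.
Proof. by apply: ae_imp2 (ae_neq2 c) (ae_neq2 d). Qed.

Lemma hf_irect f a b c d : L1 leb2 f -> L2 leb2 f ->
  ip leb2 (hf f) (hf (irect a b c d)) = (2 * pi) ^+ 2 * ip leb2 f (irect a b c d).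
Proof.
move=> If Lf.
have [ab|ba] := leP a b; last first.
  have -> : irect a b c d = fun=> 0.
    apply/funext => z; rewrite irectE indicE memNset ?mul0r//= in_itv /=.
    by move=> /andP[? ?]; lra.
  by rewrite hf0 !ip0 mulr0.
have [cd|dc] := leP c d; last first.
  have -> : irect a b c d = fun=> 0.
    apply/funext => z; rewrite irectE mulrC indicE memNset ?mul0r//= in_itv /=.
    by move=> /andP[? ?]; lra.
  by rewrite hf0 !ip0 mulr0.
have [Lh _] := hf_L2 If Lf.
have Ig := L1_irect a b c d; have Lg := L2_irect a b c d.
have [Lk _] := hf_L2 Ig Lg.
have Ihk := L2_L1M Lh Lk.
have c1 : \int[leb2]_xi (wgt (eps n) xi * (hf f xi * hf (irect a b c d) xi))
    @[n --> \oo] --> ip leb2 (hf f) (hf (irect a b c d)).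
  apply: (@Rint_dct _ _ _ leb2 _ _ (fun xi => `|hf f xi * hf (irect a b c d) xi|)).
  - by move=> n; exact: L1_meas (L1_wgtM (eps_gt0 n) Ihk).
  - exact: L1_meas Ihk.
  - apply: ae_all => xi; rewrite -[X in _ --> X]mul1r.
    by apply: cvgM; [exact: wgt_cvg|exact: cvg_cst].
  - exact: L1_abs.
  - move=> n xi; rewrite normrM ler_piMl//.
    by rewrite ger0_norm ?wgt_le1 ?eps_gt0// ltW// wgt_gt0.
have Ep n x : \int[leb2]_y (irect a b c d y * poisson2 (eps n) x y) =
    itvpart (eps n) a b x.1 * itvpart (eps n) c d x.2.
  have [I1 E1] := poisson_itv x.1 (eps_gt0 n) ab.
  have [I2 E2] := poisson_itv x.2 (eps_gt0 n) cd.
  have [_ E] := L1_tensor I1 I2.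
  rewrite E1 E2 in E; rewrite -E.
  by congr Rintegral; apply/funext => y; rewrite irectE /poisson2; ring.
have mp (e p q : R) : measurable_fun [set: R] (itvpart e p q).
  apply: measurable_funM => //; apply: measurable_funB;
  apply: (measurableT_comp (f := @atan R));
    (try by apply: continuous_measurable_fun; exact: continuous_atan);
    by apply: measurable_funM => //; exact: measurable_funB.
have c2 : \int[leb2]_x (f x * (itvpart (eps n) a b x.1 * itvpart (eps n) c d x.2))
    @[n --> \oo] --> \int[leb2]_x (f x * ((2 * pi) ^+ 2 * irect a b c d x)).
  have mf := L1_meas If.
  apply: (@Rint_dct _ _ _ leb2 _ _ (fun x => `|f x| * (2 * pi) ^+ 2)).
  - move=> n; apply: measurable_funM => //; apply: measurable_funM.
      exact: (measurableT_comp (mp _ _ _) (@measurable_fst _ _ _ _)).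
    exact: (measurableT_comp (mp _ _ _) (@measurable_snd _ _ _ _)).
  - apply: measurable_funM => //; apply: measurable_funM => //.
    exact: measurable_irect.
  - apply: ae_imp3 (ae_neq1 a) (ae_neq1 b) (ae_neq2cd c d).
    move=> x h3 h4 [h1 h2]; apply: cvgM; first exact: cvg_cst.
    rewrite irectE (_ : _ * _ = (2 * pi * \1_(`]a, b]%classic : set R) x.1) *
      (2 * pi * \1_(`]c, d]%classic : set R) x.2)); last by ring.
    by apply: cvgM; exact: itvpart_cvg.
  - under eq_fun do rewrite mulrC; exact/L1Z/L1_abs.
  - move=> n x; rewrite normrM ler_wpM2l// normrM expr2.
    by apply: ler_pM => //; exact: itvpart_bound.
have -> : (2 * pi) ^+ 2 * ip leb2 f (irect a b c d) =
    \int[leb2]_x (f x * ((2 * pi) ^+ 2 * irect a b c d x)).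
  rewrite /ip -RintZ; last exact: L2_L1M.
  by congr Rintegral; apply/funext => x; ring.
apply: (cvg_unique _ c1 _) => //=.
have -> : (fun n => \int[leb2]_xi (wgt (eps n) xi * (hf f xi * hf (irect a b c d) xi))) =
    fun n => \int[leb2]_x (f x * (itvpart (eps n) a b x.1 * itvpart (eps n) c d x.2)).
  apply/funext => n; rewrite (Rint_wgt_hf (eps_gt0 n) If Ig).
  by congr Rintegral; apply/funext => x; rewrite Ep.
exact: c2.
Qed.

End HartleyL1L2.

Section HartleyL2.
Context (R : realType).
Notation P2 := (measurableTypeR R * measurableTypeR R)%type.
Notation L2 := (@L2 _ P2 R leb2).
Notation L1 := (@L1 _ P2 R leb2).
Notation ip := (@ip _ P2 R leb2).
Implicit Types (f g h v : R * R -> R) (x y z xi : R * R) (e t : R).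

Lemma cvg_mull (u : nat -> R) (c l : R) :
  u n @[n --> \oo] --> l -> c * u n @[n --> \oo] --> c * l.
Proof. by move=> h; apply: cvgM => //; exact: cvg_cst. Qed.

Definition trunc n f z : R := f z * \1_(box n) z.

Lemma measurable_box n : measurable (box n : set P2).
Proof. by apply: measurableX; exact: measurable_itv. Qed.

Lemma measurable_indic_box n : measurable_fun [set: P2] (\1_(box n) : P2 -> R).
Proof. by apply: measurable_indic; exact: measurable_box. Qed.

Lemma indic_le1 (X : Type) (B : set X) (x : X) : `|\1_B x : R| <= 1.
Proof. by rewrite indicE; case: (_ \in _) => /=; rewrite ?normr1 ?normr0. Qed.

Lemma L1_indic_box n : L1 (\1_(box n) : R * R -> R).
Proof.
have h u w : @L1_on _ _ R lebesgue_measure (\1_(`[u, w]%classic : set R) : R -> R).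
  exact: integrable_indic_itv.
have [I _] := L1_tensor (h (- n%:R) n%:R) (h (- n%:R) n%:R).
by move: I; congr L1; apply/funext => z; rewrite -indic_setX.
Qed.

Lemma box_near z : \forall n \near \oo, box n z.
Proof.
near=> n; have [h1 h2] : `|z.1| < n%:R /\ `|z.2| < n%:R.
  by split; near: n; exact: nbhs_infty_gtr.
by split; rewrite /= in_itv /=; [move: h1|move: h2]; rewrite ltr_norml => /andP[a b]; rewrite !ltW.
Unshelve. all: by end_near. Qed.

Lemma trunc_abs_le n f z : `|trunc n f z| <= `|f z|.
Proof. by rewrite /trunc normrM ler_piMr// indic_le1. Qed.

Lemma trunc_measurable n f : measurable_fun [set: P2] (f : P2 -> R) ->
  measurable_fun [set: P2] (trunc n f : P2 -> R).
Proof. by move=> mf; apply: measurable_funM => //; exact: measurable_indic_box. Qed.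

Lemma L2_trunc n f : L2 f -> L2 (trunc n f).
Proof.
move=> Lf; apply: (L2_dom (trunc_measurable n Lf.1) _ Lf).
by move=> z; exact: trunc_abs_le.
Qed.

Lemma L1_trunc n f : L2 f -> L1 (trunc n f).
Proof.
move=> [mf If]; apply: (@L1_dom _ _ _ leb2 _ (fun z => f z ^+ 2 + \1_(box n) z : R)).
- exact: trunc_measurable.
- move=> z; rewrite /trunc indicE; case: (_ \in _); rewrite /= ?mulr1 ?mulr0 ?normr0.
    have h := sqr_ge0 (`|f z| - 1); rewrite -(real_normK (num_real (f z))).
    by have := normr_ge0 (f z); nra.
  by rewrite addr_ge0 ?sqr_ge0.
- by apply: L1D => //; exact: L1_indic_box.
Qed.

Lemma trunc_cvg_ae f z : trunc n f z @[n --> \oo] --> f z.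
Proof.
apply: cvg_near_cst; have := box_near z; apply: filterS => n bn.
by rewrite /trunc indicE mem_set// mulr1.
Qed.

Lemma trunc_cvg f : L2 f ->
  ip (fun z => trunc n f z - f z) (fun z => trunc n f z - f z) @[n --> \oo] --> 0.
Proof.
move=> Lf; have [mf If] := Lf.
rewrite -[X in _ --> X](_ : \int[leb2]_z (0 : R) = 0); last first.
  by rewrite /Rintegral integral0.
apply: (@Rint_dct _ P2 _ leb2 (fun n z => (trunc n f z - f z) * (trunc n f z - f z)) _
  (fun z => f z ^+ 2)) => //.
- move=> n; have m : measurable_fun [set: P2] (fun z => trunc n f z - f z).
    by apply: measurable_funB => //; exact: trunc_measurable.
  exact: measurable_funM.
- apply: ae_all => z; rewrite -[X in _ --> X](mulr0 0).
  have h : trunc n f z - f z @[n --> \oo] --> 0.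
    by rewrite -(subrr (f z)); apply: cvgB; [exact: trunc_cvg_ae|exact: cvg_cst].
  exact: cvgM.
- move=> n z; rewrite /trunc indicE; case: (_ \in _); rewrite /= ?mulr1 ?mulr0.
    by rewrite subrr mulr0 normr0 sqr_ge0.
  by rewrite sub0r mulrNN -expr2 ger0_norm ?sqr_ge0.
Qed.

Lemma Rint_rect_eq0_loc v : (forall n, L1 (trunc n v)) ->
  (forall a b c d, \int[leb2]_z (v z * irect a b c d z) = 0) ->
  measurable_fun [set: P2] (v : P2 -> R) ->
  {ae leb2, forall z, v z = 0}.
Proof.
move=> Iv v0 mv.
pose r n := irect (- (n%:R : R)) n%:R (- n%:R) n%:R.
have rr n a b c d z : r n z * irect a b c d z =
   irect (Num.max (- n%:R) a) (Num.min n%:R b) (Num.max (- n%:R) c) (Num.min n%:R d) z.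
  rewrite /r /irect /rect !indicE -natrM mulnb -in_setI; congr ((_ \in _)%:R).
  apply/seteqP; split => u /=; rewrite !in_itv /= !gt_max !le_min.
    by move=> [[/andP[-> ->] /andP[-> ->]] [/andP[-> ->] /andP[-> ->]]].
  by move=> [/andP[/andP[-> ->] /andP[-> ->]] /andP[/andP[-> ->] /andP[-> ->]]].
have h n : {ae leb2, forall z, v z * r n z = 0}.
  apply: Rint_rect_eq0.
    apply: L1_dom (L1_abs (Iv n)).
      by apply: measurable_funM => //; exact: measurable_irect.
    move=> z; rewrite /trunc !normrM ler_wpM2l// /r /irect !indicE.
    have [|] := boolP (z \in rect _ _ _ _); last by rewrite normr0.
    move=> /set_mem [/=]; rewrite !in_itv /= => /andP[/ltW a1 a2] /andP[/ltW a3 a4].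
    by rewrite mem_set//; split; rewrite /= in_itv /= ?a1 ?a3.
  move=> a b c d; rewrite -[RHS](v0 (Num.max (- n%:R) a) (Num.min n%:R b) (Num.max (- n%:R) c) (Num.min n%:R d)).
  by congr Rintegral; apply/funext => z; rewrite -mulrA -rr.
have : {ae leb2, forall z, forall n, v z * r n z = 0} by apply: ae_foralln.
apply: ae_imp => z hz.
have [n [h1 h2]] : exists n : nat, `|z.1| < n%:R /\ `|z.2| < n%:R.
  have : \forall n \near \oo, `|z.1| < (n%:R : R) /\ `|z.2| < (n%:R : R).
    by apply: filterI; exact: nbhs_infty_gtr.
  by case=> N _ /(_ N (leqnn N)); exists N.
have := hz n; rewrite /r /irect indicE mem_set ?mulr1//.
by split; rewrite /= in_itv /=; [move: h1|move: h2]; rewrite ltr_norml => /andP[a b];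
  rewrite a ltW.
Qed.

Lemma hfB f g xi : L1 f -> L1 g -> hf (fun z => f z - g z) xi = hf f xi - hf g xi.
Proof.
move=> If Ig; rewrite /hf -RintB; try exact: L1_cas.
by congr Rintegral; apply/funext => z; rewrite mulrBl.
Qed.

Lemma hfD f g xi : L1 f -> L1 g -> hf (fun z => f z + g z) xi = hf f xi + hf g xi.
Proof.
move=> If Ig; rewrite /hf -RintD; try exact: L1_cas.
by congr Rintegral; apply/funext => z; rewrite mulrDl.
Qed.

Lemma hfZ (c : R) f xi : L1 f -> hf (fun z => c * f z) xi = c * hf f xi.
Proof.
move=> If; rewrite /hf -RintZ; try exact: L1_cas.
by congr Rintegral; apply/funext => z; rewrite mulrA.
Qed.

Definition hn n f : R * R -> R := hf (trunc n f).

Lemma L2_hn n f : L2 f -> L2 (hn n f).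
Proof. by move=> Lf; have [] := hf_L2 (L1_trunc n Lf) (L2_trunc n Lf). Qed.

Definition L2_lim (u : nat -> R * R -> R) h : Prop := L2 h /\
  ip (fun xi => u n xi - h xi) (fun xi => u n xi - h xi) @[n --> \oo] --> 0.

Definition is_hartley f h : Prop := L2_lim (fun n => hn n f) h.

Definition hartley f : R * R -> R := xget (fun=> 0) [set h | is_hartley f h].

Lemma hartley_eq_ae f g : measurable_fun [set: P2] (f : P2 -> R) ->
  measurable_fun [set: P2] (g : P2 -> R) ->
  {ae leb2, forall z, f z = g z} -> hartley f = hartley g.
Proof.
move=> mf mg fg.
have E : (fun n => hn n f) = (fun n => hn n g); last by rewrite /hartley /is_hartley E.
apply/funext => n.
apply/funext => xi; rewrite /hn /hf; apply: Rint_ae.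
- by apply: measurable_funM; [exact: trunc_measurable|exact: measurable_cas_dot2'].
- by apply: measurable_funM; [exact: trunc_measurable|exact: measurable_cas_dot2'].
- by apply: ae_imp fg => z; rewrite /trunc => ->.
Qed.

#[local] Opaque hf hartley.

Lemma hartleyP f : L2 f -> is_hartley f (hartley f).
Proof.
move=> Lf; have [|h Lh ch] := @L2_complete _ _ _ leb2 (fun n => hn n f) (fun n => L2_hn n Lf).
  move=> e e0.
  have c0 : 0 < 4 * (2 * pi) ^+ 2 :> R.
    by rewrite mulr_gt0// exprn_gt0// mulr_gt0// pi_gt0.
  have /cvgrPdist_le /(_ (e / (4 * (2 * pi) ^+ 2))) := trunc_cvg Lf.
  rewrite divr_gt0// => /(_ isT) [N _ hN]; exists N => m n Nm Nn.
  have Lm := L2_trunc m Lf; have Ln := L2_trunc n Lf.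
  have Im := L1_trunc m Lf; have In := L1_trunc n Lf.
  have [_ E] := hf_L2 (L1B Im In) (L2B Lm Ln).
  have E2 : hf (fun z => trunc m f z - trunc n f z) = fun z => hn m f z - hn n f z.
    by apply/funext => z; rewrite hfB.
  rewrite E2 in E; apply: (le_trans E).
  have := ip_sqrD_le (L2B Lm Lf) (L2N (L2B Ln Lf)).
  rewrite ipNr ?ipNl ?opprK; try exact: L2B; last by apply: L2N; exact: L2B.
  have -> : (fun x => trunc m f x - f x + - (trunc n f x - f x)) =
    (fun x => trunc m f x - trunc n f x) by apply/funext => z; ring.
  have := hN m Nm; have := hN n Nn.
  rewrite /= !sub0r !normrN => h1 h2 h3.
  have := le_trans (ler_norm _) h1; have := le_trans (ler_norm _) h2 => h4 h5.
  have {}h3 := le_trans h3 (lerD (ler_wpM2l _ h4) (ler_wpM2l _ h5)).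
  have {}h3 := h3 (ler0n R 2) (ler0n R 2).
  have p0 : 0 < (2 * pi) ^+ 2 :> R by rewrite exprn_gt0// mulr_gt0// pi_gt0.
  rewrite -ler_pdivlMl//; apply: (le_trans h3).
  rewrite le_eqVlt; apply/orP; left; apply/eqP.
  by move: p0; set P := (2 * pi) ^+ 2 => p0; field; rewrite gt_eqF.
exact: (xgetPex (fun=> 0) (ex_intro (is_hartley f) h (conj Lh ch))).
Qed.

Lemma L2_hartley f : L2 f -> L2 (hartley f).
Proof. by case/hartleyP. Qed.

Lemma is_hartley_unique f h : L2 f -> is_hartley f h ->
  {ae leb2, forall z, hartley f z = h z}.
Proof.
move=> Lf [Lh ch]; have [Lh' ch'] := hartleyP Lf.
exact: (L2_lim_unique (fun n => L2_hn n Lf) Lh' Lh ch' ch).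
Qed.

Lemma is_hartley_compact f N : L2 f -> (forall z, ~ box N z -> f z = 0) ->
  L1 f /\ is_hartley f (hf f).
Proof.
move=> Lf f0.
have tf n : (N <= n)%N -> trunc n f = f.
  move=> Nn; apply/funext => z; rewrite /trunc indicE.
  have [|] := boolP (z \in box n); first by rewrite mulr1.
  move=> /negP zn; rewrite mulr0 f0// => -[h1 h2]; apply: zn; apply/mem_set.
  have Nn' : (N%:R : R) <= n%:R by rewrite ler_nat.
  by split; [move: h1|move: h2]; rewrite /= !in_itv /= => /andP[a b]; apply/andP; split; lra.
have If : L1 f by rewrite -(tf N)//; exact: L1_trunc.
have [Lh _] := hf_L2 If Lf.
split => //; split => //; apply: cvg_near_cst; exists N => // n /= Nn.
rewrite /hn tf// /ip; under eq_fun do rewrite subrr mulr0.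
by rewrite /Rintegral integral0.
Qed.

Lemma hartley_compact f N : L2 f -> (forall z, ~ box N z -> f z = 0) ->
  {ae leb2, forall z, hartley f z = hf f z}.
Proof. by move=> Lf /(is_hartley_compact Lf)[_]; exact: is_hartley_unique. Qed.

Let hartley_sym_trunc f g m : L2 f -> L2 g -> ip (hartley f) (trunc m g) = ip f (hn m g).
Proof.
move=> Lf Lg; have [Lh ch] := hartleyP Lf.
have c1 := ip_cvg (fun n => L2_hn n Lf) Lh (L2_trunc m Lg) ch.
have c2 := ip_cvg (fun n => L2_trunc n Lf) Lf (L2_hn m Lg) (trunc_cvg Lf).
apply: (cvg_unique _ c1) => //.
have -> : (fun n => ip (hn n f) (trunc m g)) = fun n => ip (trunc n f) (hn m g).
  by apply/funext => n; exact: (hf_swap (L1_trunc n Lf) (L1_trunc m Lg)).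
exact: c2.
Qed.

Lemma hartley_sym f g : L2 f -> L2 g -> ip (hartley f) g = ip f (hartley g).
Proof.
move=> Lf Lg; have [Lh ch] := hartleyP Lg.
have c1 := ip_cvg (fun n => L2_hn n Lg) Lh Lf ch.
have c2 := ip_cvg (fun n => L2_trunc n Lg) Lg (L2_hartley Lf) (trunc_cvg Lg).
rewrite [RHS]ipC; apply/esym; apply: (cvg_unique _ c1) => //.
have -> : (fun n => ip (hn n g) f) = fun n => ip (trunc n g) (hartley f).
  by apply/funext => n; rewrite ipC -(hartley_sym_trunc _ Lf Lg) ipC.
by rewrite [X in _ X]ipC; exact: c2.
Qed.

Lemma irect_compact a b c d : exists N, forall z, ~ box N z -> irect a b c d z = 0.
Proof.
have [N hN] : exists N : nat, [/\ `|a| < N%:R, `|b| < N%:R, `|c| < N%:R & `|d| < N%:R].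
  have : \forall n \near \oo, ((`|a| < (n%:R : R) /\ `|b| < (n%:R : R)) /\
     (`|c| < (n%:R : R) /\ `|d| < (n%:R : R))).
    by apply: filterI; apply: filterI; exact: nbhs_infty_gtr.
  by case=> N _ /(_ N (leqnn N)) /= [[? ?] [? ?]]; exists N.
exists N => z zN; rewrite /irect indicE memNset// => -[/=]; rewrite !in_itv /=.
move=> /andP[z1 z2] /andP[z3 z4]; apply: zN.
case: hN; rewrite !ltr_norml => /andP[? ?] /andP[? ?] /andP[? ?] /andP[? ?].
by split; rewrite /= in_itv /=; apply/andP; split; lra.
Qed.

Lemma hartley_inv f : L2 f -> {ae leb2, forall z, hartley (hartley f) z = (2 * pi) ^+ 2 * f z}.
Proof.
move=> Lf; have Lh := L2_hartley Lf; have Lhh := L2_hartley Lh.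
have Lv := L2B Lhh (L2Z ((2 * pi) ^+ 2) Lf).
suff : {ae leb2, forall z, hartley (hartley f) z - (2 * pi) ^+ 2 * f z = 0}.
  by apply: ae_imp => z /eqP; rewrite subr_eq0 => /eqP.
apply: Rint_rect_eq0_loc; last by case: Lv.
  by move=> n; exact: (L1_trunc n Lv).
move=> a b c d; have Lr := L2_irect a b c d.
have [N hN] := irect_compact a b c d.
have [_ hr] := is_hartley_compact Lr hN.
change (ip (fun z => hartley (hartley f) z - (2 * pi) ^+ 2 * f z) (irect a b c d) = 0).
rewrite (ipBl Lhh (L2Z _ Lf) Lr) (ipZl _ Lf Lr).
rewrite (hartley_sym Lh Lr).
have [_ ch] := hartleyP Lf.
have -> : ip (hartley f) (hartley (irect a b c d)) = ip (hartley f) (hf (irect a b c d)).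
  apply: (ip_ae Lh (L2_hartley Lr)).
  - by case: Lh.
  - by case: hr => -[].
  - exact: ae_all.
  - exact: is_hartley_unique.
have c1 := ip_cvg (fun n => L2_hn n Lf) Lh hr.1 ch.
have c2 := ip_cvg (fun n => L2_trunc n Lf) Lf Lr (trunc_cvg Lf).
have c3 : (2 * pi) ^+ 2 * ip (trunc n f) (irect a b c d) @[n --> \oo] -->
    (2 * pi) ^+ 2 * ip f (irect a b c d) by apply: cvgM => //; exact: cvg_cst.
apply/eqP; rewrite subr_eq0; apply/eqP; apply: (cvg_unique _ c1) => //.
have -> : (fun n => ip (hn n f) (hf (irect a b c d))) =
    fun n => (2 * pi) ^+ 2 * ip (trunc n f) (irect a b c d).
  by apply/funext => n; exact: (hf_irect _ _ _ _ (L1_trunc n Lf) (L2_trunc n Lf)).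
exact: c3.
Qed.

Lemma parseval f g : L2 f -> L2 g -> ip (hartley f) (hartley g) = (2 * pi) ^+ 2 * ip f g.
Proof.
move=> Lf Lg; have Lh := L2_hartley Lg; have Lhh := L2_hartley Lh.
have LZ := L2Z ((2 * pi) ^+ 2) Lg.
rewrite (hartley_sym Lf Lh) -(ipZr _ Lg Lf); apply: (ip_ae Lf Lhh).
- by case: Lf.
- by case: LZ.
- exact: ae_all.
- exact: hartley_inv.
Qed.

Lemma hartleyD f g : L2 f -> L2 g ->
  {ae leb2, forall z, hartley (fun z => f z + g z) z = hartley f z + hartley g z}.
Proof.
move=> Lf Lg; have [Lh ch] := hartleyP Lf; have [Lk ck] := hartleyP Lg.
apply: is_hartley_unique; first exact: L2D.
split; first exact: L2D.
have E n : (fun xi => hn n (fun z => f z + g z) xi - (hartley f xi + hartley g xi)) =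
    (fun xi => (hn n f xi - hartley f xi) + (hn n g xi - hartley g xi)).
  apply/funext => xi; rewrite /hn.
  have -> : trunc n (fun z => f z + g z) = fun z => trunc n f z + trunc n g z.
    by apply/funext => z; rewrite /trunc mulrDl.
  by rewrite (hfD _ (L1_trunc n Lf) (L1_trunc n Lg)) opprD addrACA.
under eq_fun do rewrite E.
have c2 : 2 * ip (fun x => hn n f x - hartley f x) (fun x => hn n f x - hartley f x) +
  2 * ip (fun x => hn n g x - hartley g x) (fun x => hn n g x - hartley g x) @[n --> \oo] --> 0.
  rewrite -[X in _ --> X](_ : 2 * 0 + 2 * 0 = 0); last by rewrite mulr0 addr0.
  by apply: cvgD; apply: cvg_mull; [exact: ch|exact: ck].
apply: (squeeze_cvgr _ (cvg_cst 0) c2); apply: nearW => n; rewrite ip_ge0 /=.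
exact: (ip_sqrD_le (L2B (L2_hn n Lf) Lh) (L2B (L2_hn n Lg) Lk)).
Qed.

Lemma hartleyZ (c : R) f : L2 f ->
  {ae leb2, forall z, hartley (fun z => c * f z) z = c * hartley f z}.
Proof.
move=> Lf; have [Lh ch] := hartleyP Lf.
apply: is_hartley_unique; first exact: L2Z.
split; first exact: L2Z.
have E n : (fun xi => hn n (fun z => c * f z) xi - (c * hartley f xi)) =
    (fun xi => c * (hn n f xi - hartley f xi)).
  apply/funext => xi; rewrite /hn.
  have -> : trunc n (fun z => c * f z) = fun z => c * trunc n f z.
    by apply/funext => z; rewrite /trunc mulrA.
  by rewrite (hfZ _ _ (L1_trunc n Lf)) mulrBr.
under eq_fun do rewrite E.
have -> : (fun n => ip (fun xi => c * (hn n f xi - hartley f xi)) (fun xi => c * (hn n f xi - hartley f xi)))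
  = fun n => c ^+ 2 * ip (fun x => hn n f x - hartley f x) (fun x => hn n f x - hartley f x).
  apply/funext => n; have L := L2B (L2_hn n Lf) Lh.
  by rewrite ipZl ?ipZr//; [ring|exact: L2Z].
by have := @cvg_mull _ (c ^+ 2) _ ch; rewrite mulr0.
Qed.

End HartleyL2.

#[local] Opaque hf hartley.

(** * Fourier transform, Sobolev norm and kernel in terms of the Hartley transform *)

Section FourierBridge.
Local Open Scope complex_scope.
Context (R : realType).
Notation P2 := (measurableTypeR R * measurableTypeR R)%type.
Notation L2 := (@L2 _ P2 R leb2).
Notation L1 := (@L1 _ P2 R leb2).
Notation ip := (@ip _ P2 R leb2).
Notation Re := complex.Re.
Notation Im := complex.Im.
Implicit Types (u v g : R * R -> R) (f h : R * R -> R[i]) (x y z xi : R * R) (e t : R).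

Lemma LfunP2 u : u \in Lfun (@leb2 R) 2%:E <-> L2 u.
Proof.
split=> [uL|[mu Iu]].
  split; last exact: Lfun2_integrable_sqr.
  by move: uL; rewrite inE => /andP[mf _]; move: mf; rewrite inE.
rewrite inE; apply/andP; split; first by rewrite inE /=.
rewrite inE /= /finite_norm unlock /=.
apply: poweR_lty.
under eq_integral => z _ do rewrite powR_mulrn// real_normK ?num_real//.
by have := L1_EFin Iu => ->; rewrite ltry.
Qed.

Lemma L2_negp u : L2 u -> L2 (fun z => u (negp z)).
Proof.
move=> [mu Iu]; split; last exact: (L1_negp Iu).
exact: (measurableT_comp mu (@measurable_negp R)).
Qed.

Lemma ip_negp u v : L2 u -> L2 v -> ip (fun z => u (negp z)) (fun z => v (negp z)) = ip u v.
Proof. by move=> Lu Lv; exact: (Rint_negp (L2_L1M Lu Lv)). Qed.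

Lemma negpK : involutive (@negp R).
Proof. by case=> a b; rewrite /negp /= !opprK. Qed.

Definition evenp u z : R := 2^-1 * (u z + u (negp z)).
Definition oddp u z : R := 2^-1 * (u z - u (negp z)).

Lemma L2_evenp u : L2 u -> L2 (evenp u).
Proof. by move=> Lu; apply: L2Z; apply: L2D => //; exact: L2_negp. Qed.

Lemma L2_oddp u : L2 u -> L2 (oddp u).
Proof. by move=> Lu; apply: L2Z; apply: L2B => //; exact: L2_negp. Qed.

Lemma ip_even_odd u v : L2 u -> L2 v -> ip (evenp u) (oddp v) = 0.
Proof.
move=> Lu Lv; have Le := L2_evenp Lu; have Lo := L2_oddp Lv.
have := ip_negp Le Lo.
have -> : (fun z => evenp u (negp z)) = evenp u.
  by apply/funext => z; rewrite /evenp negpK addrC.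
have -> : (fun z => oddp v (negp z)) = fun z => - oddp v z.
  by apply/funext => z; rewrite /oddp negpK -mulrN opprB.
rewrite (ipNr Lo Le); lra.
Qed.

Lemma ip_even_odd_sum u : L2 u -> ip (evenp u) (evenp u) + ip (oddp u) (oddp u) = ip u u.
Proof.
move=> Lu; have Ln := L2_negp Lu.
rewrite /evenp /oddp (ipZl _ (L2D Lu Ln)); last exact: L2Z (L2D Lu Ln).
rewrite (ipZr _ (L2D Lu Ln) (L2D Lu Ln)) (ip_sqrD Lu Ln).
rewrite (ipZl _ (L2B Lu Ln)); last exact: L2Z (L2B Lu Ln).
rewrite (ipZr _ (L2B Lu Ln) (L2B Lu Ln)) (ip_sqrD Lu (L2N Ln)).
rewrite (ipNr Ln Lu) (ipNr Ln (L2N Ln)) (ipNl Ln Ln) (ip_negp Lu Lu).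
by set a := ip _ _; set b := ip _ _; field.
Qed.

Lemma normc_sqr (c : R[i]) : Normc.normc c ^+ 2 = Re c ^+ 2 + Im c ^+ 2.
Proof. by case: c => a b; rewrite /Normc.normc sqr_sqrtr// addr_ge0 ?sqr_ge0. Qed.

Lemma norm2E f : L2 (fun z => Re (f z)) -> L2 (fun z => Im (f z)) ->
  norm2 f = (Num.sqrt (ip (fun z => Re (f z)) (fun z => Re (f z)) +
                       ip (fun z => Im (f z)) (fun z => Im (f z))))%:E.
Proof.
move=> LR LI; rewrite /norm2 unlock /=.
under eq_integral => z _ do
  rewrite powR_mulrn// real_normK ?num_real// normc_sqr.
have I := L1D LR.2 LI.2.
have := L1_EFin I => ->; rewrite poweR_EFin.
have -> : \int[leb2]_z (Re (f z) ^+ 2 + Im (f z) ^+ 2) =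
  ip (fun z => Re (f z)) (fun z => Re (f z)) + ip (fun z => Im (f z)) (fun z => Im (f z)).
  rewrite (RintD LR.2 LI.2) /ip.
  by congr (_ + _); congr Rintegral; apply/funext => z; rewrite expr2.
by rewrite powR12_sqrt// addr_ge0 ?ip_ge0.
Qed.

Lemma norm2_cvg (f_ : nat -> R * R -> R[i]) h :
  (forall n, L2 (fun z => Re (f_ n z))) -> (forall n, L2 (fun z => Im (f_ n z))) ->
  L2 (fun z => Re (h z)) -> L2 (fun z => Im (h z)) ->
  norm2 (fun z => f_ n z - h z) @[n --> \oo] --> 0%E <->
  (L2_lim (fun n z => Re (f_ n z)) (fun z => Re (h z)) /\
   L2_lim (fun n z => Im (f_ n z)) (fun z => Im (h z))).
Proof.
move=> LR LI hR hI.
have eR n z : Re (f_ n z - h z) = Re (f_ n z) - Re (h z).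
  by case: (f_ n z) => a b; case: (h z).
have eI n z : Im (f_ n z - h z) = Im (f_ n z) - Im (h z).
  by case: (f_ n z) => a b; case: (h z).
have LR' n := L2B (LR n) hR; have LI' n := L2B (LI n) hI.
pose A n := ip (fun z => Re (f_ n z) - Re (h z)) (fun z => Re (f_ n z) - Re (h z)).
pose B n := ip (fun z => Im (f_ n z) - Im (h z)) (fun z => Im (f_ n z) - Im (h z)).
have E n : norm2 (fun z => f_ n z - h z) = (Num.sqrt (A n + B n))%:E.
  have E1 : (fun z => Re (f_ n z - h z)) = (fun z => Re (f_ n z) - Re (h z)).
    by apply/funext => z; exact: eR.
  have E2 : (fun z => Im (f_ n z - h z)) = (fun z => Im (f_ n z) - Im (h z)).
    by apply/funext => z; exact: eI.
  by rewrite norm2E ?E1 ?E2.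
have A0 n : 0 <= A n := ip_ge0 _ _.
have B0 n : 0 <= B n := ip_ge0 _ _.
have -> : (fun n => norm2 (fun z => f_ n z - h z)) = fun n => (Num.sqrt (A n + B n))%:E.
  by apply/funext => n; exact: E.
split=> [c|[[_ cA] [_ cB]]].
  have c1 : Num.sqrt (A n + B n) @[n --> \oo] --> 0.
    by move/fine_cvg : c.
  have c2 : A n + B n @[n --> \oo] --> 0.
    rewrite -(mulr0 0).
    have -> : (fun n => A n + B n) = fun n => Num.sqrt (A n + B n) * Num.sqrt (A n + B n).
      by apply/funext => n; rewrite -expr2 sqr_sqrtr// addr_ge0.
    exact: cvgM.
  split; split => //.
    by apply: (squeeze_cvgr _ (cvg_cst 0) c2); apply: nearW => n; rewrite A0 /= lerDl.
  by apply: (squeeze_cvgr _ (cvg_cst 0) c2); apply: nearW => n; rewrite B0 /= lerDr.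
have c2 : A n + B n @[n --> \oo] --> 0 by rewrite -(addr0 0); exact: cvgD cA cB.
apply: cvg_EFin; first by apply: nearW.
rewrite -sqrtr0; apply: (cvg_comp (fun n => A n + B n) (@Num.sqrt R)); first exact: c2.
exact: sqrt_continuous.
Qed.

Lemma hn_cos n u xi : L2 u ->
  \int[leb2]_(z in box n) (cos (dot2 z xi) * u z) = evenp (hn n u) xi.
Proof.
move=> Lu; rewrite Rintegral_mkcond.
have It := L1_trunc n Lu.
transitivity (\int[leb2]_z (2^-1 * (trunc n u z * cas (dot2 z xi) + trunc n u z * cas (dot2 z (negp xi))))).
  congr Rintegral; apply/funext => z; rewrite patchE /trunc indicE.
  case: ifPn => _; rewrite /= ?mulr1 ?mulr0 ?mul0r ?addr0 ?mulr0//.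
  have -> : dot2 z (negp xi) = - dot2 z xi by rewrite /dot2 /=; ring.
  by rewrite /cas cosN sinN; field.
by rewrite (RintZ _ (L1D (L1_cas xi It) (L1_cas (negp xi) It))) (RintD (L1_cas xi It) (L1_cas _ It)).
Qed.

Lemma hn_sin n u xi : L2 u ->
  \int[leb2]_(z in box n) (sin (dot2 z xi) * u z) = oddp (hn n u) xi.
Proof.
move=> Lu; rewrite Rintegral_mkcond.
have It := L1_trunc n Lu.
transitivity (\int[leb2]_z (2^-1 * (trunc n u z * cas (dot2 z xi) - trunc n u z * cas (dot2 z (negp xi))))).
  congr Rintegral; apply/funext => z; rewrite patchE /trunc indicE.
  case: ifPn => _; rewrite /= ?mulr1 ?mulr0 ?mul0r ?subr0 ?mulr0//.
  have -> : dot2 z (negp xi) = - dot2 z xi by rewrite /dot2 /=; ring.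
  by rewrite /cas cosN sinN; field.
by rewrite (RintZ _ (L1B (L1_cas xi It) (L1_cas (negp xi) It))) (RintB (L1_cas xi It) (L1_cas _ It)).
Qed.

Lemma L2_lim_evenp (w : nat -> R * R -> R) v : (forall n, L2 (w n)) ->
  L2_lim w v -> L2_lim (fun n => evenp (w n)) (evenp v) /\ L2_lim (fun n => oddp (w n)) (oddp v).
Proof.
move=> Lw [Lv c].
have Le n := ip_even_odd_sum (L2B (Lw n) Lv).
have E1 n : (fun z => evenp (w n) z - evenp v z) = evenp (fun z => w n z - v z).
  by apply/funext => z; rewrite /evenp; ring.
have E2 n : (fun z => oddp (w n) z - oddp v z) = oddp (fun z => w n z - v z).
  by apply/funext => z; rewrite /oddp; ring.
split; split; [exact: L2_evenp| |exact: L2_oddp|].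
  apply: (squeeze_cvgr _ (cvg_cst 0) c); apply: nearW => n.
  by rewrite E1 ip_ge0 /= -(Le n) lerDl ip_ge0.
apply: (squeeze_cvgr _ (cvg_cst 0) c); apply: nearW => n.
by rewrite E2 ip_ge0 /= -(Le n) lerDr ip_ge0.
Qed.

Lemma L2_limD (w1 w2 : nat -> R * R -> R) v1 v2 :
  (forall n, L2 (w1 n)) -> (forall n, L2 (w2 n)) ->
  L2_lim w1 v1 -> L2_lim w2 v2 -> L2_lim (fun n z => w1 n z + w2 n z) (fun z => v1 z + v2 z).
Proof.
move=> Lw1 Lw2 [Lv1 c1] [Lv2 c2]; split; first exact: L2D.
have c3 : 2 * ip (fun x => w1 n x - v1 x) (fun x => w1 n x - v1 x) +
  2 * ip (fun x => w2 n x - v2 x) (fun x => w2 n x - v2 x) @[n --> \oo] --> 0.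
  rewrite -[X in _ --> X](_ : 2 * 0 + 2 * 0 = 0); last by rewrite mulr0 addr0.
  by apply: cvgD; apply: cvg_mull; [exact: c1|exact: c2].
apply: (squeeze_cvgr _ (cvg_cst 0) c3); apply: nearW => n; rewrite ip_ge0 /=.
have -> : (fun z => w1 n z + w2 n z - (v1 z + v2 z)) = (fun z => (w1 n z - v1 z) + (w2 n z - v2 z)).
  by apply/funext => z; rewrite opprD addrACA.
exact: (ip_sqrD_le (L2B (Lw1 n) Lv1) (L2B (Lw2 n) Lv2)).
Qed.

Lemma L2_limZ (c : R) (w : nat -> R * R -> R) v : (forall n, L2 (w n)) ->
  L2_lim w v -> L2_lim (fun n z => c * w n z) (fun z => c * v z).
Proof.
move=> Lw [Lv cv]; split; first exact: L2Z.
have E n : ip (fun z => c * w n z - c * v z) (fun z => c * w n z - c * v z) =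
   c ^+ 2 * ip (fun z => w n z - v z) (fun z => w n z - v z).
  have L := L2B (Lw n) Lv.
  have -> : (fun z => c * w n z - c * v z) = (fun z => c * (w n z - v z)).
    by apply/funext => z; rewrite mulrBr.
  by rewrite (ipZl _ L (L2Z c L)) (ipZr _ L L) mulrA expr2.
under eq_fun do rewrite E.
by have := @cvg_mull R _ (c ^+ 2) _ cv; rewrite mulr0.
Qed.

Lemma L2_limB (w1 w2 : nat -> R * R -> R) v1 v2 :
  (forall n, L2 (w1 n)) -> (forall n, L2 (w2 n)) ->
  L2_lim w1 v1 -> L2_lim w2 v2 -> L2_lim (fun n z => w1 n z - w2 n z) (fun z => v1 z - v2 z).
Proof.
move=> Lw1 Lw2 l1 l2.
have -> : (fun z => v1 z - v2 z) = (fun z => v1 z + -1 * v2 z) by apply/funext => z; rewrite mulN1r.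
have -> : (fun n z => w1 n z - w2 n z) = (fun n z => w1 n z + -1 * w2 n z).
  by apply/funext => n; apply/funext => z; rewrite mulN1r.
by apply: (L2_limD Lw1 _ l1) => [n|]; [exact: L2Z|exact: L2_limZ].
Qed.

Lemma fourierL2_hartley u : L2 u ->
  [/\ L2 (fun z => Re (fourierL2 (toC u) z)), L2 (fun z => Im (fourierL2 (toC u) z)),
    {ae leb2, forall z, Re (fourierL2 (toC u) z) = evenp (hartley u) z} &
    {ae leb2, forall z, Im (fourierL2 (toC u) z) = - oddp (hartley u) z}].
Proof.
move=> Lu; have [Lh ch] := hartleyP Lu.
pose F n xi := cintegral (box n) (fun z => expi (- dot2 z xi) * toC u z).
have FE n xi : F n xi = evenp (hn n u) xi +i* (- oddp (hn n u) xi).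
  rewrite /F /cintegral -(hn_cos n xi Lu) -(hn_sin n xi Lu); congr (_ +i* _).
    by congr Rintegral; apply/funext => z; rewrite /expi /toC /= mulr0 subr0 cosN.
  rewrite -mulN1r [LHS]Rintegral_mkcond [in RHS]Rintegral_mkcond -RintZ.
    congr Rintegral; apply/funext => z; rewrite !patchE /expi /toC /=.
    by case: ifP => _; rewrite ?mulr0// sinN; ring.
  rewrite (_ : (_ \_ _) = fun z => trunc n u z * sin (dot2 z xi)); last first.
    apply/funext => z; rewrite patchE /trunc indicE; case: ifP => _ /=.
      by rewrite mulr1 mulrC.
    by rewrite mulr0 mul0r.
  apply: (@L1_bdM _ P2 R leb2 _ _ 1) (L1_trunc n Lu).
    under eq_fun do rewrite dot2C.
    apply: measurableT_comp; last exact: measurable_dot2.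
    by apply: continuous_measurable_fun; exact: continuous_sin.
  by move=> z; rewrite ler_norml sin_geN1 sin_le1.
have L2hn n := L2_hn n Lu.
have [l1 l2] := L2_lim_evenp L2hn (conj Lh ch).
have FR : (fun n z => Re (F n z)) = fun n => evenp (hn n u).
  by apply/funext => n; apply/funext => z; rewrite FE.
have FI : (fun n z => Im (F n z)) = fun n z => - oddp (hn n u) z.
  by apply/funext => n; apply/funext => z; rewrite FE.
have l3 : L2_lim (fun n z => - oddp (hn n u) z) (fun z => - oddp (hartley u) z).
  have := L2_limZ (-1) (fun n => L2_oddp (L2hn n)) l2.
  have -> : (fun z => -1 * oddp (hartley u) z) = (fun z => - oddp (hartley u) z).
    by apply/funext => z; rewrite mulN1r.
  by congr L2_lim; apply/funext => n; apply/funext => z; rewrite mulN1r.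
have LRF n : L2 (fun z => Re (F n z)).
  by have -> := congr1 (fun W => L2 (W n)) FR; exact: L2_evenp.
have LIF n : L2 (fun z => Im (F n z)).
  by have -> := congr1 (fun W => L2 (W n)) FI; apply: L2N; exact: L2_oddp.
pose W xi := evenp (hartley u) xi +i* (- oddp (hartley u) xi).
have Wlim : norm2 (fun z => F n z - W z) @[n --> \oo] --> 0%E.
  have WR : L2 (fun z => Re (W z)) := l1.1.
  have WI : L2 (fun z => Im (W z)) := l3.1.
  by apply: (norm2_cvg LRF LIF WR WI).2; rewrite FR FI; split; [exact: l1|exact: l3].
have Wok : [set h | L2C h /\ norm2 (fun xi => F n xi - h xi) @[n --> \oo] --> 0%E] W.
  split => //; split; apply/LfunP2; [exact: l1.1|exact: l3.1].
have := xgetPex (fun=> 0) (ex_intro _ W Wok).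
rewrite -/(fourierL2 (toC u)) => -[[/LfunP2 hR /LfunP2 hI]].
move=> cW; have [] := (norm2_cvg LRF LIF hR hI).1 cW; rewrite FR FI => -[_ cR] [_ cI].
split => //.
- exact: (L2_lim_unique (fun n => L2_evenp (L2hn n)) hR l1.1 cR l1.2).
- exact: (L2_lim_unique (fun n => L2N (L2_oddp (L2hn n))) hI l3.1 cI l3.2).
Qed.

Lemma measurable_cos_dot2 xi : measurable_fun [set: P2] ((fun z => cos (dot2 z xi)) : P2 -> R).
Proof.
under eq_fun do rewrite dot2C.
apply: measurableT_comp; last exact: measurable_dot2.
by apply: continuous_measurable_fun; exact: continuous_cos.
Qed.

Lemma measurable_sin_dot2 xi : measurable_fun [set: P2] ((fun z => sin (dot2 z xi)) : P2 -> R).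
Proof.
under eq_fun do rewrite dot2C.
apply: measurableT_comp; last exact: measurable_dot2.
by apply: continuous_measurable_fun; exact: continuous_sin.
Qed.

Lemma cos_bound1 (t : R) : `|cos t| <= 1.
Proof. by rewrite ler_norml cos_geN1 cos_le1. Qed.

Lemma sin_bound1 (t : R) : `|sin t| <= 1.
Proof. by rewrite ler_norml sin_geN1 sin_le1. Qed.

Lemma L1_box_cos (n : nat) u xi : L2 u -> integrable (@leb2 R) (box n : set P2) (EFin \o (fun z => cos (dot2 z xi) * u z)).
Proof.
move=> Lu; apply/(integrable_mkcond _ (measurable_box n)).
have : L1 (fun z => trunc n u z * cos (dot2 z xi)).
  apply: (@L1_bdM _ P2 R leb2 _ _ 1) (L1_trunc n Lu); first exact: measurable_cos_dot2.
  by move=> z; exact: cos_bound1.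
apply: eq_integrable => // z _; rewrite /= /trunc /patch indicE.
by case: ifP => _ /=; rewrite ?mulr1 ?mulr0 ?mul0r// mulrC.
Qed.

Lemma L1_box_sin (n : nat) u xi : L2 u -> integrable (@leb2 R) (box n : set P2) (EFin \o (fun z => sin (dot2 z xi) * u z)).
Proof.
move=> Lu; apply/(integrable_mkcond _ (measurable_box n)).
have : L1 (fun z => trunc n u z * sin (dot2 z xi)).
  apply: (@L1_bdM _ P2 R leb2 _ _ 1) (L1_trunc n Lu); first exact: measurable_sin_dot2.
  by move=> z; exact: sin_bound1.
apply: eq_integrable => // z _; rewrite /= /trunc /patch indicE.
by case: ifP => _ /=; rewrite ?mulr1 ?mulr0 ?mul0r// mulrC.
Qed.

Lemma ifourierL2_norm h : L2 (fun z => Re (h z)) -> L2 (fun z => Im (h z)) ->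
  fine (norm2 (ifourierL2 h)) ^+ 2 = (2 * pi) ^- 2 *
    (ip (fun z => Re (h z)) (fun z => Re (h z)) + ip (fun z => Im (h z)) (fun z => Im (h z))).
Proof.
set h1 := fun z => Re (h z); set h2 := fun z => Im (h z) => L1h L2h.
set p : R := (2 * pi) ^- 2.
pose F n z := p%:C * cintegral (box n) (fun xi => expi (dot2 z xi) * h xi).
have FE n z : F n z = (p * (evenp (hn n h1) z - oddp (hn n h2) z)) +i*
    (p * (evenp (hn n h2) z + oddp (hn n h1) z)).
  rewrite /F /cintegral -(hn_cos n z L1h) -(hn_sin n z L2h) -(hn_cos n z L2h) -(hn_sin n z L1h).
  rewrite -(RintegralB (measurable_box n) (L1_box_cos n z L1h) (L1_box_sin n z L2h)).
  rewrite -(RintegralD (measurable_box n) (L1_box_cos n z L2h) (L1_box_sin n z L1h)).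
  have -> : (fun xi => Re (expi (dot2 z xi) * h xi)) =
      (fun xi => cos (dot2 xi z) * h1 xi - sin (dot2 xi z) * h2 xi).
    by apply/funext => xi; rewrite dot2C /h1 /h2 /expi; case: (h xi).
  have -> : (fun xi => Im (expi (dot2 z xi) * h xi)) =
      (fun xi => cos (dot2 xi z) * h2 xi + sin (dot2 xi z) * h1 xi).
    by apply/funext => xi; rewrite dot2C /h1 /h2 /expi; case: (h xi).
  by simpc.
have [H1 c1] := hartleyP L1h; have [H2 c2] := hartleyP L2h.
have Lh1 n := L2_hn n L1h; have Lh2 n := L2_hn n L2h.
have [e1 o1] := L2_lim_evenp Lh1 (conj H1 c1).
have [e2 o2] := L2_lim_evenp Lh2 (conj H2 c2).
have Le1 n := L2_evenp (Lh1 n); have Lo1 n := L2_oddp (Lh1 n).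
have Le2 n := L2_evenp (Lh2 n); have Lo2 n := L2_oddp (Lh2 n).
have lR := L2_limZ p (fun n => L2B (Le1 n) (Lo2 n)) (L2_limB Le1 Lo2 e1 o2).
have lI := L2_limZ p (fun n => L2D (Le2 n) (Lo1 n)) (L2_limD Le2 Lo1 e2 o1).
have FR : (fun n z => Re (F n z)) = fun n z => p * (evenp (hn n h1) z - oddp (hn n h2) z).
  by apply/funext => n; apply/funext => z; rewrite FE.
have FI : (fun n z => Im (F n z)) = fun n z => p * (evenp (hn n h2) z + oddp (hn n h1) z).
  by apply/funext => n; apply/funext => z; rewrite FE.
have LRF n : L2 (fun z => Re (F n z)).
  by have -> := congr1 (fun W => L2 (W n)) FR; apply: L2Z; exact: L2B.
have LIF n : L2 (fun z => Im (F n z)).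
  by have -> := congr1 (fun W => L2 (W n)) FI; apply: L2Z; exact: L2D.
pose W z := (p * (evenp (hartley h1) z - oddp (hartley h2) z)) +i*
    (p * (evenp (hartley h2) z + oddp (hartley h1) z)).
have WR : L2 (fun z => Re (W z)) := lR.1.
have WI : L2 (fun z => Im (W z)) := lI.1.
have Wlim : norm2 (fun z => F n z - W z) @[n --> \oo] --> 0%E.
  by apply: (norm2_cvg LRF LIF WR WI).2; rewrite FR FI; split; [exact: lR|exact: lI].
have Wok : [set f | L2C f /\ norm2 (fun z => F n z - f z) @[n --> \oo] --> 0%E] W.
  by split => //; split; apply/LfunP2; [exact: WR|exact: WI].
have := xgetPex (fun=> 0) (ex_intro _ W Wok).
rewrite -/(ifourierL2 h) => -[[/LfunP2 hR /LfunP2 hI]] cW.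
have [] := (norm2_cvg LRF LIF hR hI).1 cW; rewrite FR FI => -[_ cR] [_ cI].
have aR := L2_lim_unique (fun n => L2Z p (L2B (Le1 n) (Lo2 n))) hR WR cR lR.2.
have aI := L2_lim_unique (fun n => L2Z p (L2D (Le2 n) (Lo1 n))) hI WI cI lI.2.
rewrite (norm2E hR hI) /= sqr_sqrtr; last by rewrite addr_ge0// ip_ge0.
rewrite (ip_ae hR hR WR.1 WR.1 aR aR) (ip_ae hI hI WI.1 WI.1 aI aI).
have E1 := L2_evenp H1; have O1 := L2_oddp H1; have E2 := L2_evenp H2; have O2 := L2_oddp H2.
rewrite (_ : ip _ _ = p ^+ 2 * (ip (evenp (hartley h1)) (evenp (hartley h1)) +
    ip (oddp (hartley h2)) (oddp (hartley h2)))); last first.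
  have L := L2B E1 O2.
  rewrite [LHS](ipZl p L (L2Z p L)) (ipZr p L L) mulrA -expr2; congr (_ * _).
  rewrite (ip_sqrD E1 (L2N O2)) (ipNr O2 E1) (ip_even_odd H1 H2) (ipNr O2 (L2N O2)) (ipNl O2 O2).
  by rewrite opprK oppr0 mulr0 addr0.
rewrite (_ : ip (fun z => Im (W z)) _ = p ^+ 2 * (ip (evenp (hartley h2)) (evenp (hartley h2)) +
    ip (oddp (hartley h1)) (oddp (hartley h1)))); last first.
  have L := L2D E2 O1.
  rewrite [LHS](ipZl p L (L2Z p L)) (ipZr p L L) mulrA -expr2; congr (_ * _).
  by rewrite (ip_sqrD E2 O1) (ip_even_odd H2 H1) mulr0 addr0.
have S1 := ip_even_odd_sum H1; have S2 := ip_even_odd_sum H2.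
rewrite (parseval L1h L1h) in S1; rewrite (parseval L2h L2h) in S2.
rewrite -mulrDr (_ : _ + _ + _ = (2 * pi) ^+ 2 * (ip h1 h1 + ip h2 h2)); last first.
  rewrite mulrDr -S1 -S2.
  have ar (a b c d : R) : a + d + (c + b) = a + b + (c + d) by ring.
  exact: ar.
rewrite mulrA; congr (_ * _); rewrite expr2 -mulrA /p mulVf ?mulr1//.
by rewrite expf_neq0// mulf_neq0// gt_eqF// pi_gt0.
Qed.

Lemma hartley_sqr_le u : L2 u ->
  {ae leb2, forall z, hartley u z ^+ 2 <= 2 * Normc.normc (fourierL2 (toC u) z) ^+ 2}.
Proof.
move=> Lu; have [_ _ aR aI] := fourierL2_hartley Lu.
apply: ae_imp2 aR aI => z hR hI; rewrite normc_sqr hR hI.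
have -> : hartley u z = evenp (hartley u) z + oddp (hartley u) z.
  by rewrite /evenp /oddp; field.
by set a := evenp _ _; set b := oddp _ _; have := sqr_ge0 (a - b); nra.
Qed.

Definition bracket2 xi : R := 1 + dot2 xi xi.

Lemma bracket2_ge1 xi : 1 <= bracket2 xi.
Proof. by rewrite /bracket2 lerDl /dot2 addr_ge0// -expr2 sqr_ge0. Qed.

Lemma measurable_bracket2 : measurable_fun [set: P2] (bracket2 : P2 -> R).
Proof.
by apply: measurable_funD => //; apply: measurable_funD; apply: measurable_funM.
Qed.

Definition q1 u : R := \int[leb2]_xi (bracket2 xi * hartley u xi ^+ 2).

Lemma Hnorm_q1 s u : L2 u -> 1 <= s -> (Hnorm s u < +oo)%E ->
  L1 (fun xi => bracket2 xi * hartley u xi ^+ 2) /\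
  q1 u <= 2 * fine (Hnorm s u) ^+ 2.
Proof.
move=> Lu s1 Hfin; have [LR LI _ _] := fourierL2_hartley Lu.
pose N xi := bracket2 xi `^ s * Normc.normc (fourierL2 (toC u) xi) ^+ 2.
have N0 xi : 0 <= N xi by rewrite mulr_ge0 ?powR_ge0 ?sqr_ge0.
have mN : measurable_fun [set: P2] (N : P2 -> R).
  apply: measurable_funM.
    by apply: (measurableT_comp (measurable_powR s)); exact: measurable_bracket2.
  under eq_fun do rewrite normc_sqr.
  by apply: measurable_funD; apply: measurable_funX; [case: LR|case: LI].
have H0 : (0 <= Hnorm s u)%E by exact: poweR_ge0.
have IN : L1 N.
  apply: L1_lty => //; under eq_integral do rewrite ger0_norm//.
  rewrite ltey; apply/eqP => Ny; move: Hfin; rewrite /Hnorm.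
  by rewrite [X in (X `^ _)%E](_ : _ = +oo%E)//= gt_eqF ?invr_gt0// ltxx.
have HE : fine (Hnorm s u) ^+ 2 = \int[leb2]_xi N xi.
  have I0 : 0 <= \int[leb2]_xi N xi by exact: Rint_ge0.
  rewrite /Hnorm (_ : (\int[leb2]_xi _)%E = (\int[leb2]_xi N xi)%:E); last exact: L1_EFin.
  by rewrite poweR_EFin /= powR12_sqrt// sqr_sqrtr.
have mh : measurable_fun [set: P2] (hartley u : P2 -> R) by case: (L2_hartley Lu).
have mb : measurable_fun [set: P2] ((fun xi => bracket2 xi * hartley u xi ^+ 2) : P2 -> R).
  by apply: measurable_funM; [exact: measurable_bracket2|exact: measurable_funX].
have le : {ae leb2, forall xi, bracket2 xi * hartley u xi ^+ 2 <= 2 * N xi}.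
  apply: ae_imp (hartley_sqr_le Lu) => xi h.
  rewrite /N [leRHS]mulrCA; apply: ler_pM => //.
  - by rewrite (le_trans ler01)// bracket2_ge1.
  - exact: sqr_ge0.
  - rewrite -[leLHS]powRr1; last by rewrite (le_trans ler01)// bracket2_ge1.
    by apply: ler_powR => //; exact: bracket2_ge1.
have I : L1 (fun xi => bracket2 xi * hartley u xi ^+ 2).
  have m2 : measurable_fun [set: P2] ((fun xi => Num.min (bracket2 xi * hartley u xi ^+ 2) (2 * N xi)) : P2 -> R).
    by apply: measurable_minr => //; exact: measurable_funM.
  apply: (@L1_ae _ _ _ leb2 (fun xi => Num.min (bracket2 xi * hartley u xi ^+ 2) (2 * N xi))) => //.
    by apply: ae_imp le => xi h; rewrite min_l.
  apply: (@L1_dom _ _ _ leb2 _ (fun xi => 2 * N xi)) => //; last exact: L1Z.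
  move=> xi; rewrite ger0_norm; first by rewrite ge_min lexx orbT.
  rewrite le_min mulr_ge0 ?sqr_ge0 ?(le_trans ler01 (bracket2_ge1 _))//=.
  by rewrite mulr_ge0.
split => //; rewrite HE -RintZ// /q1.
rewrite (_ : \int[leb2]_xi (2 * N xi) = \int[leb2]_xi (Num.max (bracket2 xi * hartley u xi ^+ 2) (2 * N xi))).
  apply: Rint_le => //.
    apply: (@L1_dom _ _ _ leb2 _ (fun xi => bracket2 xi * hartley u xi ^+ 2 + 2 * N xi)).
    - by apply: measurable_maxr => //; exact: measurable_funM.
    - have b0 xi : 0 <= bracket2 xi * hartley u xi ^+ 2.
        by rewrite mulr_ge0 ?sqr_ge0 ?(le_trans ler01 (bracket2_ge1 _)).
      move=> xi; have := b0 xi; have := N0 xi; set A := _ * _ ^+ 2; set B := N xi => *.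
      by rewrite ger0_norm ?le_max ?ge_max; apply/orP || apply/andP; try split; lra.
    - by apply: L1D => //; exact: L1Z.
  by move=> xi; rewrite le_max lexx.
apply: Rint_ae.
- exact: measurable_funM.
- by apply: measurable_maxr => //; exact: measurable_funM.
- by apply: ae_imp le => xi h; rewrite max_r.
Qed.

End FourierBridge.

Section Kernel.
Local Open Scope complex_scope.
Context (R : realType).
Notation P2 := (measurableTypeR R * measurableTypeR R)%type.
Notation L2 := (@L2 _ P2 R leb2).
Notation L1 := (@L1 _ P2 R leb2).
Notation ip := (@ip _ P2 R leb2).
Notation Re := complex.Re.
Notation Im := complex.Im.
Implicit Types (u v g : R * R -> R) (x y z xi : R * R).
Variables (b : R * R -> R) (C r : R).
Hypotheses (Ib : L1 b) (hb : kernel_decay b C r).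

Definition bhat xi : R := Re (fourier (toC b) xi).

Lemma L1_cos_dot2 u xi : L1 u -> L1 (fun z => u z * cos (dot2 z xi)).
Proof.
by apply: (@L1_bdM _ P2 R leb2 _ _ 1) => [|z]; [exact: measurable_cos_dot2|exact: cos_bound1].
Qed.

Lemma L1_sin_dot2 u xi : L1 u -> L1 (fun z => u z * sin (dot2 z xi)).
Proof.
by apply: (@L1_bdM _ P2 R leb2 _ _ 1) => [|z]; [exact: measurable_sin_dot2|exact: sin_bound1].
Qed.

Lemma bhat_cos xi : bhat xi = \int[leb2]_z (b z * cos (dot2 z xi)).
Proof.
rewrite /bhat /fourier /cintegral /=; congr Rintegral; apply/funext => z.
by rewrite mulr0 subr0 cosN mulrC.
Qed.

Lemma bhat_sin0 xi : \int[leb2]_z (b z * sin (dot2 z xi)) = 0.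
Proof.
have /andP[+ _] := hb xi; rewrite lecE /= => /andP[/eqP + _].
rewrite /fourier /cintegral /= => h.
have {h} : \int[leb2]_z (- (b z * sin (dot2 z xi))) = 0.
  by rewrite -[RHS]h; congr Rintegral; apply/funext => z; rewrite mulr0 add0r sinN mulNr mulrC.
by rewrite (RintN (L1_sin_dot2 xi Ib)) => /eqP; rewrite oppr_eq0 => /eqP.
Qed.

Transparent hf.
Lemma bhat_hf xi : bhat xi = hf b xi.
Proof.
rewrite bhat_cos -[LHS]addr0 -(bhat_sin0 xi) -(RintD (L1_cos_dot2 xi Ib) (L1_sin_dot2 xi Ib)).
by rewrite /hf; congr Rintegral; apply/funext => z; rewrite /cas mulrDr.
Qed.
#[local] Opaque hf.

Lemma measurable_bhat : measurable_fun [set: P2] (bhat : P2 -> R).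
Proof.
have -> : bhat = hf b by apply/funext => xi; exact: bhat_hf.
exact: measurable_hf.
Qed.

Lemma bhat_ge0 xi : 0 <= bhat xi.
Proof. by have /andP[] := hb xi; rewrite lecE => /andP[_]. Qed.

Lemma bhat_fourier xi : fourier (toC b) xi = (bhat xi)%:C.
Proof.
have /andP[+ _] := hb xi; rewrite lecE /bhat; case: (fourier _ _) => x y /=.
by move=> /andP[/eqP -> _].
Qed.

Lemma bhat_even xi : bhat (negp xi) = bhat xi.
Proof.
rewrite !bhat_cos; congr Rintegral; apply/funext => z.
by rewrite -cosN; congr (_ * cos _); rewrite /dot2 /=; ring.
Qed.

Lemma bhat_bracket2 xi : 0 < C -> 2 <= r -> bracket2 xi * bhat xi <= C.
Proof.
move=> C0 r2; have /andP[_] := hb xi; rewrite bhat_fourier lecR => h.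
have b1 := bracket2_ge1 xi.
apply: (@le_trans _ _ (bracket2 xi * (C * (bracket2 xi)^-1))).
  rewrite ler_wpM2l ?(le_trans ler01 b1)//; apply: (le_trans h).
  rewrite ler_wpM2l ?(ltW C0)// -[leRHS]powR_inv1 ?(le_trans ler01 b1)//.
  by apply: ler_powR => //; rewrite lerN2; lra.
by rewrite mulrCA divff ?mulr1// gt_eqF// (lt_le_trans ltr01).
Qed.

Lemma Rop_hartley_eq0 u : Rop_in_L2 b u -> {ae leb2, forall xi, bhat xi = 0 -> hartley u xi = 0}.
Proof.
move=> [/LfunP2 Lu hz _]; have [_ _ aR aI] := fourierL2_hartley Lu.
apply: ae_imp3 hz aR aI => xi h hR hI b0.
have /h f0 : fourier (toC b) xi = 0 by rewrite bhat_fourier b0.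
rewrite f0 /= in hR; rewrite f0 /= in hI.
have -> : hartley u xi = evenp (hartley u) xi + oddp (hartley u) xi.
  by rewrite /evenp /oddp; field.
by move/eqP : hI; rewrite eq_sym oppr_eq0 -hR => /eqP ->; rewrite addr0.
Qed.

Lemma Rsymbol_sqr u xi :
  Re (Rsymbol b u xi) ^+ 2 + Im (Rsymbol b u xi) ^+ 2 =
  (bhat xi)^-1 * (Re (fourierL2 (toC u) xi) ^+ 2 + Im (fourierL2 (toC u) xi) ^+ 2).
Proof.
rewrite /Rsymbol -/(bhat xi); case: (fourierL2 _ _) => a c /=.
rewrite !mul0r subr0 addr0 !exprMn -mulrDr; congr (_ * _).
have p2 : (bhat xi `^ (- 2^-1)) ^+ 2 = (bhat xi)^-1.
  rewrite powRN exprVn; congr (_^-1).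
  by rewrite powR12_sqrt ?bhat_ge0// sqr_sqrtr// bhat_ge0.
by rewrite p2.
Qed.

Lemma Rop_energy u : Rop_in_L2 b u ->
  L1 (fun xi => (bhat xi)^-1 * hartley u xi ^+ 2) /\
  fine (norm2 (Rop b u)) ^+ 2 = (2 * pi) ^- 2 *
    \int[leb2]_xi ((bhat xi)^-1 * hartley u xi ^+ 2).
Proof.
move=> [/LfunP2 Lu hz [/LfunP2 LR /LfunP2 LI]]; have [_ _ aR aI] := fourierL2_hartley Lu.
have Lh := L2_hartley Lu; have mh := Lh.1.
have mhn : measurable_fun [set: P2] ((fun xi => hartley u (negp xi)) : P2 -> R) := (L2_negp Lh).1.
have mB : measurable_fun [set: P2] ((fun xi => (bhat xi)^-1) : P2 -> R).
  have -> : (fun xi => (bhat xi)^-1) = fun xi => bhat xi `^ (-1).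
    by apply/funext => xi; rewrite powR_inv1 ?bhat_ge0.
  by apply: (measurableT_comp (measurable_powR (-1))); exact: measurable_bhat.
pose f xi := (bhat xi)^-1 * hartley u xi ^+ 2.
have f0 xi : 0 <= f xi by rewrite mulr_ge0 ?invr_ge0 ?bhat_ge0 ?sqr_ge0.
have mf : measurable_fun [set: P2] (f : P2 -> R).
  by apply: measurable_funM => //; exact: measurable_funX.
have mfn : measurable_fun [set: P2] ((fun xi => f (negp xi)) : P2 -> R).
  exact: (measurableT_comp mf (@measurable_negp R)).
have aeE : {ae leb2, forall xi, Re (Rsymbol b u xi) ^+ 2 + Im (Rsymbol b u xi) ^+ 2 =
    2^-1 * (f xi + f (negp xi))}.
  apply: ae_imp2 aR aI => xi hR hI; rewrite Rsymbol_sqr hR hI /f bhat_even -mulrDr mulrCA.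
  by congr (_ * _); rewrite /evenp /oddp; field.
have mff : measurable_fun [set: P2] ((fun xi => 2^-1 * (f xi + f (negp xi))) : P2 -> R).
  by apply: measurable_funM => //; exact: measurable_funD.
have Iff : L1 (fun xi => 2^-1 * (f xi + f (negp xi))).
  exact: (L1_ae mff aeE (L1D LR.2 LI.2)).
have If : L1 f.
  apply: (L1_dom mf _ (L1Z 2 Iff)) => xi; rewrite ger0_norm// mulrA mulfV// mul1r lerDl.
  exact: f0.
split => //; rewrite (ifourierL2_norm LR LI); congr (_ * _).
transitivity (\int[leb2]_xi (Re (Rsymbol b u xi) ^+ 2 + Im (Rsymbol b u xi) ^+ 2)).
  rewrite (RintD LR.2 LI.2) /ip.
  by congr (_ + _); congr Rintegral; apply/funext => xi; rewrite expr2.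
rewrite (Rint_ae (L1_meas (L1D LR.2 LI.2)) mff aeE).
rewrite (RintZ _ (L1D If (L1_negp If))) (RintD If (L1_negp If)) (Rint_negp If).
by set a := Rintegral _ _ _; field.
Qed.

End Kernel.

#[local] Opaque hf hartley.

(** * Test functions and weak derivatives *)

Section PlaneCalculus.
Context (R : realType).
Notation P2 := (measurableTypeR R * measurableTypeR R)%type.
Notation mu1 := (@lebesgue_measure R).
Implicit Types (u v : R * R -> R) (x y z xi e : R * R) (t : R).

Lemma open_measurable_plane (O : set (R * R)) : open O -> measurable (O : set P2).
Proof.
move=> oO.
pose rr (p : rat * rat * (rat * rat)) : set (R * R) :=
  `](ratr p.1.1 : R), (ratr p.1.2 : R)[%classic `*` `](ratr p.2.1 : R), (ratr p.2.2 : R)[%classic.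
pose D : set (rat * rat * (rat * rat)) := [set p | rr p `<=` O].
have -> : O = \bigcup_(p in D) rr p.
  apply/seteqP; split => [[x y] Oz|z [p Dp]]; last exact: Dp.
  have [[A B] /= [nA nB] AB] := oO _ Oz.
  have [e1 /= e10 hA] := nA; have [e2 /= e20 hB] := nB.
  have [a ha] := @rat_in_itvoo R (x - e1) x ltac:(lra).
  have [b hb] := @rat_in_itvoo R x (x + e1) ltac:(lra).
  have [c hc] := @rat_in_itvoo R (y - e2) y ltac:(lra).
  have [d hd] := @rat_in_itvoo R y (y + e2) ltac:(lra).
  move: ha hb hc hd; rewrite !in_itv /= => /andP[? ?] /andP[? ?] /andP[? ?] /andP[? ?].
  exists ((a, b), (c, d)) => /=; last first.
    by split; rewrite /= in_itv /=; apply/andP; split.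
  move=> [x' y'] [/=]; rewrite !in_itv /= => /andP[? ?] /andP[? ?].
  apply: AB; split => /=; [apply: hA|apply: hB];
    rewrite /ball_ /= ltr_norml; apply/andP; split; lra.
rewrite bigcup_mkcond; apply: countable_bigcupT_measurable => [|p].
  exact: countableP.
by case: ifP => _; [apply: measurableX; exact: measurable_itv|exact: measurable0].
Qed.

Lemma continuous_measurable_plane u : continuous u -> measurable_fun [set: P2] (u : P2 -> R).
Proof.
move=> cu; apply: (measurability _ (RGenOpens.measurableE R)) => _ [_ [a [b ->] <-]].
rewrite setTI; apply: open_measurable_plane.
by apply: (open_comp (f := u)) => [z _|]; [exact: cu|exact: interval_open].
Qed.

Lemma pd1 u t (y : R) : derivable u (t, y) e1 ->
  is_derive t 1 (fun s => u (s, y)) ('D_e1 u (t, y)).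
Proof.
have E : (fun h : R => h^-1 *: (u (h *: (e1 : R * R) + (t, y)) - u (t, y))) =
    (fun h : R => h^-1 *: (u (h *: (1 : R) + t, y) - u (t, y))).
  apply/funext => h; congr (_ *: (u _ - _)).
  by rewrite /e1; congr pair; rewrite /= /GRing.scale /= ?mulr0 ?add0r.
move=> du; apply: DeriveDef.
  by move: du; rewrite /derivable E.
by rewrite /derive E.
Qed.

Lemma pd2 u t (x : R) : derivable u (x, t) e2 ->
  is_derive t 1 (fun s => u (x, s)) ('D_e2 u (x, t)).
Proof.
have E : (fun h : R => h^-1 *: (u (h *: (e2 : R * R) + (x, t)) - u (x, t))) =
    (fun h : R => h^-1 *: (u (x, h *: (1 : R) + t) - u (x, t))).
  apply/funext => h; congr (_ *: (u _ - _)).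
  by rewrite /e2; congr pair; rewrite /= /GRing.scale /= ?mulr0 ?add0r.
move=> du; apply: DeriveDef.
  by move: du; rewrite /derivable E.
by rewrite /derive E.
Qed.

Lemma pd1_rev u t (y d : R) : is_derive t 1 (fun s => u (s, y)) d ->
  derivable u (t, y) e1 /\ 'D_e1 u (t, y) = d.
Proof.
have E : (fun h : R => h^-1 *: (u (h *: (e1 : R * R) + (t, y)) - u (t, y))) =
    (fun h : R => h^-1 *: (u (h *: (1 : R) + t, y) - u (t, y))).
  apply/funext => h; congr (_ *: (u _ - _)).
  by rewrite /e1; congr pair; rewrite /= /GRing.scale /= ?mulr0 ?add0r.
by move=> [du <-]; split; [rewrite /derivable E|rewrite /derive E].
Qed.

Lemma pd2_rev u t (x d : R) : is_derive t 1 (fun s => u (x, s)) d ->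
  derivable u (x, t) e2 /\ 'D_e2 u (x, t) = d.
Proof.
have E : (fun h : R => h^-1 *: (u (h *: (e2 : R * R) + (x, t)) - u (x, t))) =
    (fun h : R => h^-1 *: (u (x, h *: (1 : R) + t) - u (x, t))).
  apply/funext => h; congr (_ *: (u _ - _)).
  by rewrite /e2; congr pair; rewrite /= /GRing.scale /= ?mulr0 ?add0r.
by move=> [du <-]; split; [rewrite /derivable E|rewrite /derive E].
Qed.

Lemma continuous_slice1 u (y : R) : continuous u -> continuous (fun t => u (t, y)).
Proof.
move=> cu t; apply: (cvg_comp (fun s : R => (s, y)) u); last exact: cu.
exact: (cvg_pair (@cvg_id _ (nbhs t)) (@cvg_cst _ y _ _ _)).
Qed.

Lemma continuous_slice2 u (x : R) : continuous u -> continuous (fun t => u (x, t)).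
Proof.
move=> cu t; apply: (cvg_comp (fun s : R => (x, s)) u); last exact: cu.
exact: (cvg_pair (@cvg_cst _ x _ _ _) (@cvg_id _ (nbhs t))).
Qed.

Definition Cc u := continuous u /\ exists N : nat, forall z, ~ box N z -> u z = 0.

Lemma box_compact (n : nat) : compact (box n : set (R * R)).
Proof. by apply: compact_setX; exact: segment_compact. Qed.

Lemma Cc_bounded u : Cc u -> exists M : R, forall z, `|u z| <= M.
Proof.
move=> [cu [N uN]].
have cK : compact (u @` (box N : set (R * R))).
  apply: continuous_compact; last exact: box_compact.
  by apply: continuous_subspaceT.
have [M [_ hM]] := compact_bounded cK.
have hM1 := hM (`|M| + 1) (ltr_pwDr ltr01 (ler_norm M)).
exists (`|M| + 1) => z; have [bz|/uN ->] := pselect (box N z).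
  by apply: hM1; exists z.
by rewrite normr0 addr_ge0.
Qed.

Lemma Cc_measurable u : Cc u -> measurable_fun [set: P2] (u : P2 -> R).
Proof. by move=> [cu _]; exact: continuous_measurable_plane. Qed.

Lemma Cc_L1 u : Cc u -> L1 leb2 u.
Proof.
move=> cu; have [M hM] := Cc_bounded cu; have [_ [N uN]] := cu.
have : L1 leb2 (fun z => \1_(box N) z * u z).
  exact: (L1_bdM (Cc_measurable cu) hM (L1_indic_box R N)).
congr L1; apply/funext => z; rewrite indicE.
have [|/negP zN] := boolP (z \in box N); first by rewrite mul1r.
by rewrite mul0r uN// => bz; apply: zN; exact/mem_set.
Qed.

Lemma Cc_L2 u : Cc u -> L2 leb2 u.
Proof.
move=> cu; have [M hM] := Cc_bounded cu; split; first exact: Cc_measurable.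
have := L1_bdM (Cc_measurable cu) hM (Cc_L1 cu).
by congr L1; apply/funext => z; rewrite expr2.
Qed.

Lemma box_norm (N : nat) z : `|z| <= N%:R -> box N z.
Proof.
rewrite prod_normE ge_max !ler_norml => /andP[/andP[h1 h2] /andP[h3 h4]].
by split; rewrite /= in_itv /=; apply/andP.
Qed.

Lemma test_Cc u : test_function u -> Cc u.
Proof.
move=> [cu ku]; split; first by have [] := cu 0%N.
have [M [_ hM]] := compact_bounded ku.
exists (Num.truncn (`|M| + 1)).+1 => z zN; apply: contrapT => uz; apply: zN.
apply: box_norm; apply: ltW.
apply: (@le_lt_trans _ _ (`|M| + 1)); last exact: truncnS_gt.
apply: (hM (`|M| + 1)); first by rewrite ltr_pwDr// ler_norm.
by apply: subset_closure => /=; exact/eqP.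
Qed.

Lemma derive_out u e N z : (forall z, ~ box N z -> u z = 0) -> ~ box N z -> 'D_e u z = 0.
Proof.
move=> u0 zN; rewrite /derive.
have oN : open (~` (box N : set (R * R))).
  by apply: closed_openC; apply: compact_closed; [exact: norm_hausdorff|exact: box_compact].
have c : h *: e + z @[h --> (0 : R)^'] --> z.
  rewrite -[X in _ --> X](add0r z) -(scale0r e); apply: cvgD; last exact: cvg_cst.
  by apply: cvgZ; [exact: (@nbhs_dnbhs _ (0 : R))|exact: cvg_cst].
apply: cvg_lim => //; apply: cvg_near_cst.
have : \forall h \near (0 : R)^', (~` (box N : set (R * R))) (h *: e + z).
  exact: (c _ (open_nbhs_nbhs (conj oN zN))).
apply: filterS => h hN; change (h^-1 *: (u (h *: e + z) - u z) = 0).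
by rewrite (u0 _ hN) (u0 _ zN) subrr scaler0.
Qed.

Lemma test_derivable u : test_function u ->
  [/\ forall z, derivable u z e1, forall z, derivable u z e2, Cc ('D_e1 u) & Cc ('D_e2 u)].
Proof.
move=> tu; have [_ [N uN]] := test_Cc tu; have [cu _] := tu.
have [_ [d1 d2 [c1 _] [c2 _]]] := cu 1%N.
split => //; split => //; exists N => z; exact: derive_out.
Qed.

Lemma slice_int0 (f F : R -> R) (N : nat) : continuous f ->
  (forall t : R, is_derive t 1 F (f t)) ->
  (forall t, N%:R < `|t| -> f t = 0 /\ F t = 0) ->
  \int[mu1]_t f t = 0.
Proof.
move=> cf dF f0.
have NN : - (N%:R + 1 : R) <= N%:R + 1 by have : (0 : R) <= N%:R := ler0n _ _; lra.
have [_ E] := FTC_itvoc NN cf dF.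
have N0 : (0 : R) <= N%:R := ler0n _ _.
transitivity (\int[mu1]_t (f t * \1_(`]- (N%:R + 1), N%:R + 1]%classic : set R) t)).
  congr Rintegral; apply/funext => t; rewrite indicE.
  have [|/negP tN] := boolP (t \in _); first by rewrite mulr1.
  rewrite mulr0; apply: (f0 t _).1; rewrite ltNge; apply/negP => h; apply: tN; apply/mem_set.
  by move: h; rewrite /= in_itv /= ler_norml => /andP[h1 h2]; apply/andP; split; lra.
rewrite E !(f0 _ _).2 ?subrr// ?normrN ger0_norm; lra.
Qed.

Lemma is_derive_cas t : is_derive t 1 (@cas R) (cas (- t)).
Proof. by apply: is_derive_eq; rewrite /cas cosN sinN addrC. Qed.

Lemma is_derive_cas1 xi (y : R) t :
  is_derive t 1 (fun t => cas (dot2 (t, y) xi)) (xi.1 * cas (- dot2 (t, y) xi)).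
Proof.
apply: isd_comp; first exact: is_derive_cas.
by rewrite /dot2 /=; apply: is_derive_eq; rewrite /GRing.scale /=; ring.
Qed.

Lemma is_derive_cas2 xi (x : R) t :
  is_derive t 1 (fun t => cas (dot2 (x, t) xi)) (xi.2 * cas (- dot2 (x, t) xi)).
Proof.
apply: isd_comp; first exact: is_derive_cas.
by rewrite /dot2 /=; apply: is_derive_eq; rewrite /GRing.scale /=; ring.
Qed.

Transparent hf.
(* Integration by parts; the derivative of [cas] at [t] is [cas (- t)], hence the reflection. *)
Lemma hf_D1 u xi : test_function u -> hf ('D_e1 u) xi = - xi.1 * hf u (negp xi).
Proof.
move=> tu; have [d1 _ c1 _] := test_derivable tu; have cu := test_Cc tu.
have I1 := L1_cas xi (Cc_L1 c1); have I2 := L1Z xi.1 (L1_cas (negp xi) (Cc_L1 cu)).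
have [_ [N uN]] := cu; have [_ [N' uN']] := c1.
have : \int[leb2]_z ('D_e1 u z * cas (dot2 z xi) + xi.1 * (u z * cas (dot2 z (negp xi)))) = 0.
  rewrite -(L1_fubini21 (m1 := mu1) (m2 := mu1) (L1D I1 I2)).2.
  rewrite [X in Rintegral _ _ X](_ : _ = fun=> 0); first by rewrite /Rintegral integral0.
  apply/funext => y; apply: (@slice_int0 _ (fun t => u (t, y) * cas (dot2 (t, y) xi)) (maxn N N')).
  - move=> t; apply: cvgD.
      apply: cvgM; first exact: (continuous_slice1 c1.1).
      exact: (isd_continuous (is_derive_cas1 xi _)).
    apply: cvgM; first exact: cvg_cst.
    apply: cvgM; first exact: (continuous_slice1 cu.1).
    exact: (isd_continuous (is_derive_cas1 (negp xi) _)).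
  - move=> t; have h1 := pd1 (d1 (t, y)).
    apply: isd_eq (isdM h1 (is_derive_cas1 xi y t)) _.
    rewrite addrC; congr (_ + _); first by rewrite mulrC.
    by rewrite mulrCA; congr (_ * (_ * cas _)); rewrite /dot2 /=; ring.
  - move=> t tN; rewrite uN ?uN' ?mul0r ?mulr0 ?addr0//.
      by move=> -[/=]; rewrite in_itv /= -ler_norml => h _; move: tN;
        rewrite ltNge (le_trans h)// ler_nat leq_maxr.
    by move=> -[/=]; rewrite in_itv /= -ler_norml => h _; move: tN;
      rewrite ltNge (le_trans h)// ler_nat leq_maxl.
rewrite (RintD I1 I2) (RintZ _ (L1_cas (negp xi) (Cc_L1 cu))) -/(hf _ _) -/(hf _ _).
by move/eqP; rewrite addr_eq0 mulNr => /eqP.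
Qed.

Lemma hf_D2 u xi : test_function u -> hf ('D_e2 u) xi = - xi.2 * hf u (negp xi).
Proof.
move=> tu; have [_ d1 _ c1] := test_derivable tu; have cu := test_Cc tu.
have I1 := L1_cas xi (Cc_L1 c1); have I2 := L1Z xi.2 (L1_cas (negp xi) (Cc_L1 cu)).
have [_ [N uN]] := cu; have [_ [N' uN']] := c1.
have : \int[leb2]_z ('D_e2 u z * cas (dot2 z xi) + xi.2 * (u z * cas (dot2 z (negp xi)))) = 0.
  rewrite -(L1_fubini12 (m1 := mu1) (m2 := mu1) (L1D I1 I2)).2.
  rewrite [X in Rintegral _ _ X](_ : _ = fun=> 0); first by rewrite /Rintegral integral0.
  apply/funext => x; apply: (@slice_int0 _ (fun t => u (x, t) * cas (dot2 (x, t) xi)) (maxn N N')).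
  - move=> t; apply: cvgD.
      apply: cvgM; first exact: (continuous_slice2 c1.1).
      exact: (isd_continuous (is_derive_cas2 xi _)).
    apply: cvgM; first exact: cvg_cst.
    apply: cvgM; first exact: (continuous_slice2 cu.1).
    exact: (isd_continuous (is_derive_cas2 (negp xi) _)).
  - move=> t; have h1 := pd2 (d1 (x, t)).
    apply: isd_eq (isdM h1 (is_derive_cas2 xi x t)) _.
    rewrite addrC; congr (_ + _); first by rewrite mulrC.
    by rewrite mulrCA; congr (_ * (_ * cas _)); rewrite /dot2 /=; ring.
  - move=> t tN; rewrite uN ?uN' ?mul0r ?mulr0 ?addr0//.
      by move=> -[_ /=]; rewrite in_itv /= -ler_norml => h; move: tN;
        rewrite ltNge (le_trans h)// ler_nat leq_maxr.
    by move=> -[_ /=]; rewrite in_itv /= -ler_norml => h; move: tN;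
      rewrite ltNge (le_trans h)// ler_nat leq_maxl.
rewrite (RintD I1 I2) (RintZ _ (L1_cas (negp xi) (Cc_L1 cu))) -/(hf _ _) -/(hf _ _).
by move/eqP; rewrite addr_eq0 mulNr => /eqP.
Qed.
#[local] Opaque hf.

End PlaneCalculus.

#[local] Opaque hf hartley.

Section Bumps.
Context (R : realType).
Notation P2 := (measurableTypeR R * measurableTypeR R)%type.
Notation mu1 := (@lebesgue_measure R).
Implicit Types (u v : R * R -> R) (f g : R -> R) (t a b : R) (k m n : nat).

Fixpoint smooth k f : Prop :=
  if k is k'.+1 then
    exists2 f', (forall t, is_derive t 1 f (f' t)) & smooth k' f'
  else continuous f.

Lemma smooth_continuous k f : smooth k f -> continuous f.
Proof. by case: k => //= k [f' df _]; exact: isd_continuous df. Qed.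

Lemma smoothW k f : smooth k.+1 f -> smooth k f.
Proof.
elim: k f => [|k IH] f; first exact: smooth_continuous.
by move=> [f' df sf']; exists f' => //; exact: IH.
Qed.

Lemma smoothD k f g : smooth k f -> smooth k g -> smooth k (fun t => f t + g t).
Proof.
elim: k f g => [f g cf cg t|k IH f g [f' df sf] [g' dg sg]]; first exact: cvgD (cf t) (cg t).
by exists (fun t => f' t + g' t) => [t|]; [exact: isdD|exact: IH].
Qed.

Lemma smoothM k f g : smooth k f -> smooth k g -> smooth k (fun t => f t * g t).
Proof.
elim: k f g => [f g cf cg t|k IH f g sf sg]; first exact: cvgM (cf t) (cg t).
have [[f' df sf'] [g' dg sg']] := (sf, sg).
exists (fun t => f t * g' t + g t * f' t) => [t|]; first exact: isdM.
by apply: smoothD; apply: IH => //; exact: smoothW.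
Qed.

Lemma smooth_cst k (c : R) : smooth k (fun=> c).
Proof.
elim: k c => [c t|k IH c]; first exact: cvg_cst.
by exists (fun=> 0) => [t|]; [exact: isd_cst|exact: IH].
Qed.

Lemma smooth_affine k f (p q : R) : smooth k f -> smooth k (fun t => f (p * t + q)).
Proof.
elim: k f => [f cf t|k IH f [f' df sf]].
  apply: (cvg_comp (fun t => p * t + q) f); last exact: cf.
  by apply: cvgD; [apply: cvgM; [exact: cvg_cst|exact: cvg_id]|exact: cvg_cst].
exists (fun t => p * f' (p * t + q)) => [t|].
  apply: (@isd_comp _ f (fun t => p * t + q)) => //.
  by apply: is_derive_eq; rewrite /GRing.scale /=; ring.
by apply: smoothM; [exact: smooth_cst|exact: IH].
Qed.

Definition flat m t : R := if 0 < t then t^-1 ^+ m * expR (- t^-1) else 0.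

Lemma flat_le m t : 0 < t -> t^-1 ^+ m * expR (- t^-1) <= m.+2`!%:R * t ^+ 2.
Proof.
move=> t0; have ti : 0 < t^-1 by rewrite invr_gt0.
have f0 : 0 < m.+2`!%:R :> R by rewrite ltr0n fact_gt0.
have := expR_ge1Dxn m.+1 (ltW ti).
set E := expR t^-1 => h; have E0 : 0 < E by exact: expR_gt0.
have {}h : t^-1 ^+ m.+2 <= m.+2`!%:R * E.
  rewrite -ler_pdivrMl// mulrC; apply: le_trans h; rewrite lerDr; exact: ler01.
rewrite expRN -/E ler_pdivrMr//.
have tn : t != 0 by rewrite gt_eqF.
have -> : t^-1 ^+ m = t ^+ 2 * t^-1 ^+ m.+2.
  by rewrite 2!(exprS t^-1); set P := t^-1 ^+ m; field.
by rewrite (mulrAC _ (t ^+ 2)) [leLHS]mulrC ler_wpM2r// sqr_ge0.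
Qed.

Lemma is_derive_powexp m (x : R) : is_derive x 1 (fun u : R => u ^+ m * expR (- u))
  (m%:R * x ^+ m.-1 * expR (- x) - x ^+ m * expR (- x)).
Proof.
have dX : is_derive x 1 (fun u : R => u ^+ m) (m%:R * x ^+ m.-1).
  elim: m => [|m IH]; first by rewrite mul0r; exact: isd_cst.
  have -> : (fun u : R => u ^+ m.+1) = (fun u : R => u * u ^+ m) by apply/funext => u; rewrite exprS.
  refine (isd_eq (@isdM _ (fun u : R => u) (fun u : R => u ^+ m) x _ _ (isd_id x) IH) _).
  by case: m {IH} => [|m] /=; rewrite -?(natr1 m.+1) ?exprS; ring.
have dE : is_derive x 1 (fun u : R => expR (- u)) (- expR (- x)).
  have dN : is_derive x 1 (fun u : R => - u) (- (1:R)) by exact: isdN (isd_id x).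
  by refine (isd_eq (@isd_comp _ expR (fun u : R => - u) x _ _ (is_derive_expR _) dN) _); ring.
by refine (isd_eq (@isdM _ (fun u : R => u ^+ m) (fun u : R => expR (- u)) x _ _ dX dE) _); ring.
Qed.

Lemma flat_abs_le m h : `|flat m h| <= m.+2`!%:R * h ^+ 2.
Proof.
rewrite /flat; case: ifPn => h0; last by rewrite normr0 mulr_ge0// ?ler0n ?sqr_ge0.
by rewrite ger0_norm ?flat_le// mulr_ge0// ?expR_ge0// exprn_ge0// invr_ge0 ltW.
Qed.

Lemma flat_derive m t : is_derive t 1 (flat m) (- m%:R * flat m.+1 t + flat m.+2 t).
Proof.
have [t0|t0|->] := ltgtP t 0.
- apply: (@near_eq_is_derive _ _ _ (fun=> 0)).
    near=> s; rewrite /flat ltNge ltW//; near: s; exact: lt_nbhsl.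
  by rewrite /flat ltNge (ltW t0) /= mulr0 addr0; exact: isd_cst.
- apply: (@near_eq_is_derive _ _ _ (fun s : R => s^-1 ^+ m * expR (- s^-1))).
    near=> s; have s0 : 0 < s by near: s; exact: lt_nbhsr.
    by rewrite /flat s0.
  rewrite /flat t0; have tn : t != 0 by rewrite gt_eqF.
  have dV : is_derive t 1 (fun s : R => s^-1) (- t ^- 2).
    apply: isd_eq; first exact: (is_deriveV tn (isd_id t)).
    by rewrite /GRing.scale /= mulr1.
  apply: isd_eq; first exact: (@isd_comp _ _ _ _ _ _ (is_derive_powexp m _) dV).
  rewrite -exprVn; move: (t^-1) (expR _) => x E.
  by case: m => [|m] /=; rewrite ?exprS; ring.
- rewrite /flat ltxx mulr0 addr0 -/(flat m).
  have lim : h^-1 *: (flat m (h *: 1 + 0) - flat m 0) @[h --> (0:R)^'] --> (0 : R).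
    rewrite {2}/flat ltxx; apply/norm_cvg0P.
    have cv : m.+2`!%:R * `|h| @[h --> (0:R)^'] --> (0 : R).
      have cn : `|h| @[h --> (0:R)^'] --> `|0 : R|.
        by apply: cvg_norm => A; exact: nbhs_dnbhs.
      rewrite -[X in _ --> X](mulr0 m.+2`!%:R) -[in X in _ --> X](normr0 R).
      by apply: cvgM; first exact: cvg_cst.
    apply: squeeze_cvgr (@cvg_cst _ _ _ _ _) cv.
    near=> h; rewrite normr_ge0 /=.
    have h0 : h != 0 by near: h; exact: nbhs_dnbhs_neq.
    rewrite subr0 addr0 /GRing.scale /= mulr1 normrM normfV.
    rewrite ler_pdivrMl ?normr_gt0// mulrCA -expr2 real_normK ?num_real//.
    exact: flat_abs_le.
  split; last exact: cvg_lim lim.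
  by apply/cvg_ex; exists 0.
Unshelve. all: by end_near.
Qed.

Lemma smooth_flat k m : smooth k (flat m).
Proof.
elim: k m => [|k IH] m.
  exact: (@isd_continuous _ _ (fun t => - m%:R * flat m.+1 t + flat m.+2 t) (flat_derive m)).
exists (fun t => - m%:R * flat m.+1 t + flat m.+2 t); first exact: flat_derive.
by apply: smoothD => //; apply: smoothM => //; exact: smooth_cst.
Qed.

Lemma flat_le1 t : 0 <= flat 0 t <= 1.
Proof.
rewrite /flat expr0 mul1r; case: ifPn => t0; last by rewrite lexx ler01.
by rewrite expR_ge0 -[leRHS]expR0 ler_expR oppr_le0 invr_ge0 ltW.
Qed.

Lemma flat_cvg1 (y : nat -> R) (d : R) : 0 < d -> (forall n, n.+1%:R * d <= y n) ->
  flat 0 (y n) @[n --> \oo] --> (1 : R).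
Proof.
move=> d0 yd.
have c : 1 - d^-1 * n.+1%:R^-1 @[n --> \oo] --> (1 : R).
  rewrite -[X in _ --> X]subr0 -[X in _ - X](mulr0 d^-1).
  apply: cvgB; first exact: cvg_cst.
  by apply: cvg_mull; exact: cvg_harmonic.
apply: squeeze_cvgr c (@cvg_cst _ _ _ _ _).
near=> n; have /andP[_ ->] := flat_le1 (y n); rewrite andbT.
have nd : 0 < n.+1%:R * d by rewrite mulr_gt0// ltr0n.
have y0 : 0 < y n by exact: lt_le_trans (yd n).
rewrite /flat y0 expr0 mul1r; apply: le_trans (expR_ge1Dx _).
by rewrite lerD2l lerN2 -invfM mulrC lef_pV2// posrE.
Unshelve. all: by end_near. Qed.

(* The slack [1 / n] on the right makes the limit the half-open interval. *)
Definition bump a b n t : R := flat 0 (n.+1%:R * (t - a)) * flat 0 (n.+1%:R * (n.+1%:R * (b - t) + 1)).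

Lemma smooth_bump a b n k : smooth k (bump a b n).
Proof.
apply: smoothM.
  have -> : (fun t => flat 0 (n.+1%:R * (t - a))) = (fun t => flat 0 (n.+1%:R * t + - (n.+1%:R * a))).
    by apply/funext => t; congr flat; ring.
  by apply: smooth_affine; exact: smooth_flat.
have -> : (fun t => flat 0 (n.+1%:R * (n.+1%:R * (b - t) + 1))) =
  (fun t => flat 0 (- (n.+1%:R ^+ 2) * t + (n.+1%:R ^+ 2 * b + n.+1%:R))).
  by apply/funext => t; congr flat; ring.
by apply: smooth_affine; exact: smooth_flat.
Qed.

Lemma flat_npos m t : t <= 0 -> flat m t = 0.
Proof. by move=> t0; rewrite /flat ltNge t0. Qed.

Lemma bump_le1 a b n t : 0 <= bump a b n t <= 1.
Proof.
have /andP[a0 a1] := flat_le1 (n.+1%:R * (t - a)).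
have /andP[b0 b1] := flat_le1 (n.+1%:R * (n.+1%:R * (b - t) + 1)).
by rewrite /bump mulr_ge0//= mulr_ile1.
Qed.

Lemma bump_out a b n t : (t <= a) || (b + 1 <= t) -> bump a b n t = 0.
Proof.
have n0 : (1 : R) <= n.+1%:R by rewrite ler1n.
move=> /orP[h|h]; rewrite /bump.
  by rewrite (@flat_npos 0 (_ * (t - a))) ?mul0r// mulr_ge0_le0// ?subr_le0//; lra.
rewrite (@flat_npos 0 (_ * (_ * _ + _))) ?mulr0// mulr_ge0_le0//.
by nra.
Qed.

Lemma bump_cvg a b t : bump a b n t @[n --> \oo] --> (\1_(`]a, b]%classic : set R) t : R).
Proof.
rewrite indicE; case: (boolP (t \in _)) => [|]; rewrite ?inE ?notin_setE /= in_itv /=.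
  move=> /andP[ta tb]; rewrite -[X in _ --> X](mulr1 (1 : R)); apply: cvgM.
    by apply: (@flat_cvg1 _ (t - a)) => //; rewrite subr_gt0.
  apply: (@flat_cvg1 _ 1) => // n; rewrite ler_wpM2l// lerDr mulr_ge0// subr_ge0.
  exact: tb.
have [ta|ta] := leP t a.
  move=> _; under eq_fun do rewrite bump_out ?ta//; exact: cvg_cst.
have [tb|tb _] := leP t b; first by [].
apply: cvg_near_cst; near=> n.
rewrite /bump [X in _ * X]flat_npos ?mulr0// mulr_ge0_le0//.
have : (t - b)^-1 <= n.+1%:R.
  apply: (@le_trans _ _ n%:R); last by rewrite ler_nat.
  by near: n; exact: nbhs_infty_ger.
rewrite -div1r ler_pdivrMr ?subr_gt0// => h; lra.
Unshelve. all: by end_near. Qed.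

Lemma Ck_tensor k f g : smooth k f -> smooth k g -> Ck k (fun z => f z.1 * g z.2).
Proof.
elim: k f g => [f g cf cg|k IH f g sf sg].
  split => // z; apply: cvgM; [apply: (cvg_comp fst f)|apply: (cvg_comp snd g)].
  - exact: cvg_fst.
  - exact: cf.
  - exact: cvg_snd.
  - exact: cg.
have [[f' df sf'] [g' dg sg']] := (sf, sg).
have [cf cg] := (smooth_continuous sf, smooth_continuous sg).
have D1 z : derivable (fun z : R * R => f z.1 * g z.2) z e1 /\
    'D_e1 (fun z : R * R => f z.1 * g z.2) z = f' z.1 * g z.2.
  case: z => x y; apply: pd1_rev => /=.
  by refine (isd_eq (@isdM _ f (fun=> g y) x _ _ (df x) (isd_cst _ _)) _); ring.
have D2 z : derivable (fun z : R * R => f z.1 * g z.2) z e2 /\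
    'D_e2 (fun z : R * R => f z.1 * g z.2) z = f z.1 * g' z.2.
  case: z => x y; apply: pd2_rev => /=.
  exact: (@isdZ _ g y (f x) _ (dg y)).
split.
  move=> z; apply: cvgM; [apply: (cvg_comp fst f)|apply: (cvg_comp snd g)].
  - exact: cvg_fst.
  - exact: cf.
  - exact: cvg_snd.
  - exact: cg.
split; [by move=> z; have [] := D1 z|by move=> z; have [] := D2 z| |].
  have -> : (fun z => 'D_e1 (fun z : R * R => f z.1 * g z.2) z) = (fun z => f' z.1 * g z.2).
    by apply/funext => z; have [] := D1 z.
  by apply: IH => //; exact: smoothW.
have -> : (fun z => 'D_e2 (fun z : R * R => f z.1 * g z.2) z) = (fun z => f z.1 * g' z.2).
  by apply/funext => z; have [] := D2 z.
by apply: IH => //; exact: smoothW.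
Qed.

Definition bump2 a b c d n z : R := bump a b n z.1 * bump c d n z.2.

Lemma bump2_le1 a b c d n z : `|bump2 a b c d n z| <= 1.
Proof.
have /andP[? ?] := bump_le1 a b n z.1; have /andP[? ?] := bump_le1 c d n z.2.
rewrite /bump2 ger0_norm; last exact: mulr_ge0.
exact: mulr_ile1.
Qed.

Lemma bump2_box a b c d : exists N, forall n z, ~ box N z -> bump2 a b c d n z = 0.
Proof.
have [N hN] : exists N : nat, [/\ `|a| < N%:R, `|b| + 1 < N%:R, `|c| < N%:R & `|d| + 1 < N%:R].
  have : \forall n \near \oo, ((`|a| < (n%:R : R) /\ `|b| + 1 < (n%:R : R)) /\
     (`|c| < (n%:R : R) /\ `|d| + 1 < (n%:R : R))).
    by apply: filterI; apply: filterI; exact: nbhs_infty_gtr.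
  by case=> N _ /(_ N (leqnn N)) /= [[? ?] [? ?]]; exists N.
exists N => n z zN; apply: contrapT => h; apply: zN.
have h1 : ~ ((z.1 <= a) || (b + 1 <= z.1)).
  by move=> /(bump_out n) e; apply: h; rewrite /bump2 e mul0r.
have h2 : ~ ((z.2 <= c) || (d + 1 <= z.2)).
  by move=> /(bump_out n) e; apply: h; rewrite /bump2 e mulr0.
move: h1 h2 => /negP; rewrite negb_or -!ltNge => /andP[? ?] /negP; rewrite negb_or -!ltNge => /andP[? ?].
case: hN => ha hb hc hd.
have := ler_norm (- a); have := ler_norm b; have := ler_norm (- c); have := ler_norm d.
rewrite !normrN => ? ? ? ?.
by split; rewrite /= in_itv /=; apply/andP; split; lra.
Qed.

Lemma test_bump2 a b c d n : test_function (bump2 a b c d n).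
Proof.
split=> [k|]; first by apply: Ck_tensor; exact: smooth_bump.
have [N hN] := bump2_box a b c d.
apply: (@subclosed_compact _ _ (box N)); [exact: closed_closure|exact: box_compact|].
have cN : closed (box N : set (R * R)).
  by apply: compact_closed; [exact: norm_hausdorff|exact: box_compact].
rewrite (closure_id (box N : set (R * R))).1//; apply: closure_subset => z /= /eqP h.
by apply: contrapT => zN; apply: h; exact: hN.
Qed.

Lemma test_fundamental v : measurable_fun [set: P2] (v : P2 -> R) ->
  (forall n, L1 leb2 (trunc n v)) ->
  (forall theta, test_function theta -> \int[leb2]_z (v z * theta z) = 0) ->
  {ae leb2, forall z, v z = 0}.
Proof.
move=> mv Iv v0; apply: Rint_rect_eq0_loc => // a b c d.
have [N hN] := bump2_box a b c d.
have cv : \int[leb2]_z (v z * bump2 a b c d n z) @[n --> \oo] --> \int[leb2]_z (v z * irect a b c d z).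
  apply: (@Rint_dct _ P2 R leb2 _ _ (fun z => `|trunc N v z|)).
  - move=> n; apply: measurable_funM => //; apply: Cc_measurable.
    by apply: test_Cc; exact: test_bump2.
  - by apply: measurable_funM => //; exact: measurable_irect.
  - apply: ae_all => z; apply: cvgM; first exact: cvg_cst.
    by rewrite irectE; apply: cvgM; exact: bump_cvg.
  - by apply: L1_abs.
  - move=> n z; rewrite /trunc indicE.
    case: (boolP (z \in box N)) => [_|]; rewrite ?mulr1.
      by rewrite normrM ler_piMr// bump2_le1.
    by rewrite notin_setE => /(hN n) ->; rewrite mulr0 normr0.
have e0 : (fun n => \int[leb2]_z (v z * bump2 a b c d n z)) = fun=> 0.
  by apply/funext => n; apply: v0; exact: test_bump2.
rewrite e0 in cv.
by rewrite -(cvg_lim _ cv)//; apply: lim_cst.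
Qed.

End Bumps.

Section WeakDerivatives.
Context (R : realType).
Notation P2 := (measurableTypeR R * measurableTypeR R)%type.
Notation L2 := (@L2 _ P2 R leb2).
Notation L1 := (@L1 _ P2 R leb2).
Notation ip := (@ip _ P2 R leb2).
Implicit Types (u v g f theta : R * R -> R) (e z xi : R * R).

Lemma locint_trunc v : locally_integrable2 v ->
  measurable_fun [set: P2] (v : P2 -> R) /\ forall n, L1 (trunc n v).
Proof.
move=> [mv Iv]; split => // n; rewrite /L1_on.
have := (@integrable_mkcond _ P2 R leb2 _ _ (measurable_box n)).1 (Iv n).
rewrite [X in integrable _ _ X](_ : _ = EFin \o trunc n v)//.
apply/funext => z; rewrite /patch /trunc /= indicE.
by case: (_ \in _); rewrite ?mulr1 ?mulr0.
Qed.

Lemma L1_locM v theta : measurable_fun [set: P2] (v : P2 -> R) -> (forall n, L1 (trunc n v)) ->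
  Cc theta -> L1 (fun z => v z * theta z).
Proof.
move=> mv Iv ct; have [M hM] := Cc_bounded ct; have [_ [N hN]] := ct.
have -> : (fun z => v z * theta z) = (fun z => trunc N v z * theta z).
  apply/funext => z; rewrite /trunc indicE.
  case: (boolP (z \in box N)) => [_|]; first by rewrite mulr1.
  by rewrite notin_setE => /hN ->; rewrite !mulr0.
have := @L1_bdM _ P2 R leb2 _ _ M (Cc_measurable ct) hM (Iv N).
by [].
Qed.

Lemma truncB n u v : trunc n (fun z => u z - v z) = (fun z => trunc n u z - trunc n v z).
Proof. by apply/funext => z; rewrite /trunc mulrBl. Qed.

Lemma test_fundamental2 u v :
  measurable_fun [set: P2] (u : P2 -> R) -> measurable_fun [set: P2] (v : P2 -> R) ->
  (forall n, L1 (trunc n u)) -> (forall n, L1 (trunc n v)) ->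
  (forall theta, test_function theta ->
     \int[leb2]_z (u z * theta z) = \int[leb2]_z (v z * theta z)) ->
  {ae leb2, forall z, u z = v z}.
Proof.
move=> mu mv Iu Iv uv.
have : {ae leb2, forall z, u z - v z = 0}.
  apply: test_fundamental.
  - exact: measurable_funB.
  - by move=> n; rewrite truncB; exact: L1B.
  - move=> theta tt; have ct := test_Cc tt.
    have -> : (fun z => (u z - v z) * theta z) = (fun z => u z * theta z - v z * theta z).
      by apply/funext => z; rewrite mulrBl.
    by rewrite RintB ?uv ?subrr//; exact: L1_locM.
by apply: ae_imp => z /eqP; rewrite subr_eq0 => /eqP.
Qed.

Lemma weakD_spec e u : weakly_derivable e u -> is_weak_deriv e u (weakD e u).
Proof. by move=> h; exact: (xgetPex (fun=> 0) h). Qed.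

Lemma weak_deriv_unique e u v v' : is_weak_deriv e u v -> is_weak_deriv e u v' ->
  {ae leb2, forall z, v z = v' z}.
Proof.
move=> [_ /locint_trunc[mv Iv] h] [_ /locint_trunc[mv' Iv'] h'].
apply: test_fundamental2 => // theta tt.
by apply: oppr_inj; rewrite -h// -h'.
Qed.

Definition axis e : Prop := e = e1 \/ e = e2.

Lemma hf_D e u xi : axis e -> test_function u ->
  hf ('D_e u) xi = - dot2 e xi * hf u (negp xi).
Proof.
case=> -> tu.
  by rewrite (hf_D1 xi tu) /dot2 mul1r mul0r addr0.
by rewrite (hf_D2 xi tu) /dot2 mul1r mul0r add0r.
Qed.

Lemma test_Cc_D e u : axis e -> test_function u -> Cc ('D_e u).
Proof. by case=> -> /test_derivable[]. Qed.

Lemma axis_bracket2 e xi : axis e -> dot2 e xi ^+ 2 <= bracket2 xi.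
Proof.
have := sqr_ge0 xi.1; have := sqr_ge0 xi.2; rewrite /bracket2 /dot2 => h1 h2.
by case=> ->; rewrite /= ?mul1r ?mul0r ?addr0 ?add0r; nra.
Qed.

Lemma bracket2_negp xi : bracket2 (negp xi) = bracket2 xi.
Proof. by rewrite /bracket2 /dot2 /= !mulrNN. Qed.

Lemma dot2_negp e xi : dot2 e (negp xi) = - dot2 e xi.
Proof. by rewrite /dot2 /=; ring. Qed.

(* [hartley] turns the derivative along [e] into [dmul e]. *)
Definition dmul e f xi : R := - dot2 e xi * f (negp xi).

Lemma L2_dmul e f : axis e -> L2 f -> L1 (fun xi => bracket2 xi * f xi ^+ 2) ->
  L2 (dmul e f).
Proof.
move=> ae_ Lf If; have [mf _] := L2_negp Lf.
have md : measurable_fun [set: P2] (dmul e f : P2 -> R).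
  by apply: measurable_funM => //; apply: measurable_funN; exact: measurable_dot2.
split; first exact: md.
apply: (@L1_dom _ P2 R leb2 _ (fun xi => bracket2 xi * f (negp xi) ^+ 2)).
- exact: measurable_funX.
- move=> xi; rewrite ger0_norm ?sqr_ge0// /dmul mulNr sqrrN exprMn.
  by rewrite ler_wpM2r ?sqr_ge0// axis_bracket2.
- by have := L1_negp If; under eq_fun do rewrite bracket2_negp.
Qed.

Lemma pi2_neq0 : (2 * pi) ^+ 2 != 0 :> R.
Proof. by rewrite expf_neq0// mulf_neq0// gt_eqF// pi_gt0. Qed.

Lemma ip_hartley u v : L2 u -> L2 v -> ip u v = (2 * pi) ^- 2 * ip (hartley u) (hartley v).
Proof.
move=> Lu Lv; rewrite parseval//; move: pi2_neq0; set p := (2 * pi) ^+ 2 => p0.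
by rewrite mulrA mulVf// mul1r.
Qed.

Lemma hartley_surj h : L2 h ->
  {ae leb2, forall z, hartley (fun x => (2 * pi) ^- 2 * hartley h x) z = h z}.
Proof.
move=> Lh; apply: ae_imp2 (hartleyZ ((2 * pi) ^- 2) (L2_hartley Lh)) (hartley_inv Lh) => z a b.
rewrite [LHS]a b; move: pi2_neq0; set p := (2 * pi) ^+ 2 => p0.
by rewrite mulrA mulVf// mul1r.
Qed.

Lemma hartley_Cc f : Cc f -> {ae leb2, forall z, hartley f z = hf f z}.
Proof. by move=> cf; have [_ [N hN]] := cf; exact: hartley_compact (Cc_L2 cf) hN. Qed.

Lemma measurable_hartley f : L2 f -> measurable_fun [set: P2] (hartley f : P2 -> R).
Proof. by move=> /L2_hartley[]. Qed.

Lemma hartley_weak_deriv e u v : axis e -> L2 u ->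
  L1 (fun xi => bracket2 xi * hartley u xi ^+ 2) -> is_weak_deriv e u v ->
  L2 v /\ {ae leb2, forall xi, hartley v xi = dmul e (hartley u) xi}.
Proof.
move=> ae_ Lu Iu [_ /locint_trunc[mv Iv] huv].
have LHu := L2_hartley Lu; have Lh := L2_dmul ae_ LHu Iu.
set h := dmul e (hartley u) in Lh *.
have LHh := L2_hartley Lh.
pose g x := (2 * pi) ^- 2 * hartley h x.
have Lg : L2 g by exact: L2Z.
have vg : {ae leb2, forall z, v z = g z}.
  apply: test_fundamental2 => //; first by case: Lg.
    by move=> n; exact: L1_trunc.
  move=> theta tt; have ct := test_Cc tt; have cd := test_Cc_D ae_ tt.
  have Lt := Cc_L2 ct; have Ld := Cc_L2 cd.
  have E1 : \int[leb2]_z (g z * theta z) = (2 * pi) ^- 2 * ip h (hartley theta).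
    exact: etrans (ipZl _ LHh Lt) (congr1 _ (hartley_sym Lh Lt)).
  have LHt := L2_hartley Lt.
  have E2 : \int[leb2]_z (v z * theta z) = - ((2 * pi) ^- 2 * ip (hartley u) (hartley ('D_e theta))).
    by rewrite -(ip_hartley Lu Ld) /ip_on (huv _ tt) opprK.
  rewrite E1 E2 -mulrN; congr (_ * _); apply: oppr_inj; rewrite opprK.
  rewrite -(ipNr LHt Lh).
  rewrite (@ip_ae _ P2 R leb2 _ (hartley u) _ (fun xi => - dot2 e xi * hf theta (negp xi)) LHu (L2_hartley Ld)).
  - rewrite /ip_on -Rint_negp.
      have mh : measurable_fun [set: P2] (hf theta : P2 -> R) by exact: measurable_hf (Cc_L1 ct).
      apply: Rint_ae.
      + apply: measurable_funM; first by case: (L2_negp LHu).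
        apply: measurable_funM.
          have -> : (fun x => - dot2 e (negp x)) = dot2 e.
            by apply/funext => x; rewrite dot2_negp opprK.
          exact: measurable_dot2.
        have -> : (fun x => hf theta (negp (negp x))) = hf theta by apply/funext => x; rewrite negpK.
        exact: mh.
      + by apply: measurable_funM; [case: Lh|apply: measurable_funN; case: LHt].
      + apply: ae_imp (hartley_Cc ct) => xi a.
        by rewrite a dot2_negp negpK /h /dmul; ring.
    apply: (L1_ae _ _ (L2_L1M LHu (L2_hartley Ld))).
      apply: measurable_funM; first by case: LHu.
      apply: measurable_funM; first by apply: measurable_funN; exact: measurable_dot2.
      apply: (@measurableT_comp _ _ _ _ _ _ (hf theta : P2 -> R)); last exact: measurable_negp.
      exact: measurable_hf (Cc_L1 ct).
    by apply: ae_imp (hartley_Cc cd) => xi a; rewrite a hf_D.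
  - by case: LHu.
  - apply: measurable_funM; first by apply: measurable_funN; exact: measurable_dot2.
    apply: (@measurableT_comp _ _ _ _ _ _ (hf theta : P2 -> R)); last exact: measurable_negp.
    exact: measurable_hf (Cc_L1 ct).
  - exact: ae_all.
  - by apply: ae_imp (hartley_Cc cd) => xi a; rewrite a hf_D.
have gv : {ae leb2, forall z, g z = v z} by apply: ae_imp vg => z ->.
split; first exact: L2_ae gv Lg.
rewrite (hartley_eq_ae mv Lg.1 vg); exact: hartley_surj.
Qed.

End WeakDerivatives.

#[local] Opaque hf hartley.

(** * Convolution with the kernel *)

Section NonIntegrable.
Context d (T : measurableType d) (R : realType) (mu : {measure set T -> \bar R}).

(* [Rintegral] takes [fine] of an infinite or undefined integral, which is [0]. *)
Lemma Rint_notL1 (f : T -> R) : measurable_fun setT f -> ~ L1 mu f -> \int[mu]_x f x = 0.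
Proof.
move=> mf nf; rewrite /Rintegral integralE.
have mE : measurable_fun setT (EFin \o f) by exact/measurable_EFinP.
have p0 : (0 <= \int[mu]_x (EFin \o f)^\+ x)%E by exact: integral_ge0.
have n0 : (0 <= \int[mu]_x (EFin \o f)^\- x)%E by exact: integral_ge0.
have : (\int[mu]_x `|(EFin \o f) x| = \int[mu]_x (EFin \o f)^\+ x + \int[mu]_x (EFin \o f)^\- x)%E.
  rewrite -ge0_integralD//; last 2 first.
  - exact: measurable_funepos.
  - exact: measurable_funeneg.
  by apply: eq_integral => x _; have := congr1 (fun h => h x) (fune_abse (EFin \o f)).
move: p0 n0; change (fun x => ((EFin \o f)^\+ x)%E) with ((EFin \o f)^\+)%E.
case: (\int[mu]_x _)%E => [p||] //; case: (\int[mu]_x _)%E => [n||] //= _ _ e.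
by exfalso; apply: nf; apply: L1_lty => //; rewrite e ltry.
Qed.

Lemma RintZ_meas (c : R) f : measurable_fun setT f -> \int[mu]_x (c * f x) = c * \int[mu]_x f x.
Proof.
move=> mf; have [->|c0] := eqVneq c 0.
  by under eq_fun do rewrite mul0r; rewrite mul0r /Rintegral integral0.
have [If|nf] := pselect (L1 mu f); first exact: RintZ.
rewrite (Rint_notL1 mf nf) mulr0; apply: Rint_notL1; first exact: measurable_funM.
move=> /(L1Z c^-1); under eq_fun do rewrite mulrA mulVf// mul1r.
exact: nf.
Qed.

End NonIntegrable.

Section Convolution.
Context (R : realType).
Notation P2 := (measurableTypeR R * measurableTypeR R)%type.
Notation L2 := (@L2 _ P2 R leb2).
Notation L1 := (@L1 _ P2 R leb2).
Notation ip := (@ip _ P2 R leb2).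
Implicit Types (u v g f theta : R * R -> R) (e z xi : R * R).

Lemma L1_refl f z : L1 f -> L1 (fun y => f (z - y)).
Proof.
move=> If; have := L1_negp (L1_addp z If); congr (L1_on leb2 _).
by apply/funext => y; congr f; congr pair; rewrite addrC.
Qed.

Lemma Rint_refl f z : L1 f -> \int[leb2]_y f (z - y) = \int[leb2]_y f y.
Proof.
move=> If; rewrite -(Rint_addp z If) -(Rint_negp (L1_addp z If)); congr Rintegral.
by apply/funext => y; congr f; congr pair; rewrite addrC.
Qed.

Lemma L1_shift f y : L1 f -> L1 (fun z => f (z - y)).
Proof. exact: (@L1_addp _ (negp y)). Qed.

Lemma Rint_shift f y : L1 f -> \int[leb2]_z f (z - y) = \int[leb2]_z f z.
Proof. exact: (@Rint_addp _ (negp y)). Qed.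

Lemma hartley_L1 f : L1 f -> L2 f -> {ae leb2, forall xi, hartley f xi = hf f xi}.
Proof.
move=> If Lf; have Lh := (hf_L2 If Lf).1; have LH := L2_hartley Lf.
apply: test_fundamental2; [by case: LH|by case: Lh| | |].
- by move=> n; exact: L1_trunc.
- by move=> n; exact: L1_trunc.
move=> theta tt; have ct := test_Cc tt; have Lt := Cc_L2 ct.
rewrite (hf_swap If (Cc_L1 ct)); apply: (etrans (hartley_sym Lf Lt)).
apply: (ip_ae Lf (L2_hartley Lt)); [by case: Lf|exact: measurable_hf (Cc_L1 ct)|exact: ae_all|].
exact: hartley_Cc.
Qed.

Lemma hartley_char v g : L2 v -> L2 g ->
  (forall theta, test_function theta ->
    \int[leb2]_z (v z * theta z) = (2 * pi) ^- 2 * ip g (hartley theta)) ->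
  {ae leb2, forall xi, hartley v xi = g xi}.
Proof.
move=> Lv Lg h; have LHg := L2_hartley Lg; have Lw := L2Z ((2 * pi) ^- 2) LHg.
have vg : {ae leb2, forall z, v z = (2 * pi) ^- 2 * hartley g z}.
  apply: test_fundamental2.
  - exact: Lv.1.
  - exact: Lw.1.
  - by move=> n; exact: (L1_trunc n Lv).
  - by move=> n; exact: (L1_trunc n Lw).
  move=> theta tt; have Lt := Cc_L2 (test_Cc tt).
  rewrite (h _ tt); apply: esym; apply: (etrans (ipZl _ LHg Lt)); congr (_ * _).
  exact: (hartley_sym Lg Lt).
by rewrite (hartley_eq_ae Lv.1 Lw.1 vg); exact: hartley_surj.
Qed.

Lemma measurable_sub2 : measurable_fun [set: P2 * P2] ((fun p => p.1 - p.2) : P2 * P2 -> P2).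
Proof.
apply/measurable_fun_pairP; split.
  apply: measurable_funB; (apply: measurableT_comp; first exact: measurable_fst);
    [exact: measurable_fst|exact: measurable_snd].
apply: measurable_funB; (apply: measurableT_comp; first exact: measurable_snd);
  [exact: measurable_fst|exact: measurable_snd].
Qed.

Variables (b : R * R -> R) (C r : R).
Hypotheses (Ib : L1 b) (hb : kernel_decay b C r).

(* The adjoint of the convolution with [b], acting on test functions. *)
Definition cadj theta y : R := \int[leb2]_z (b (z - y) * theta z).

Lemma measurable_kernel : measurable_fun [set: P2 * P2] ((fun p => b (p.1 - p.2)) : P2 * P2 -> R).
Proof. by apply: measurableT_comp; [exact: L1_meas Ib|exact: measurable_sub2]. Qed.

Lemma L1_kernel theta : Cc theta -> L1 theta ->
  L1_on (sleb2 R \x sleb2 R)%E (fun p => b (p.1 - p.2) * theta p.1).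
Proof.
move=> ct It.
apply: (@L1_prod12 _ _ P2 P2 R (sleb2 R) (sleb2 R) _ (fun z => `|theta z| * \int[leb2]_y `|b y|)).
- apply: measurable_funM; first exact: measurable_kernel.
  by apply: measurableT_comp; [exact: L1_meas It|exact: measurable_fst].
- move=> z /=; under eq_fun do rewrite mulrC.
  by apply: L1Z; exact: L1_refl.
- move=> z /=; under eq_fun do rewrite normrM mulrC.
  have Ia := L1_abs Ib.
  by rewrite (RintZ _ (L1_refl z Ia)) (Rint_refl z Ia).
- by under eq_fun do rewrite mulrC; apply: L1Z; exact: L1_abs.
Qed.

Lemma L1_cadj theta : Cc theta -> L1 (cadj theta).
Proof. by move=> ct; have [] := L1_fubini21 (L1_kernel ct (Cc_L1 ct)). Qed.

Lemma L2_cadj theta : Cc theta -> L2 (cadj theta).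
Proof.
move=> ct; have Ic := L1_cadj ct; have mc := L1_meas Ic; split => //.
have [M hM] := Cc_bounded ct.
have h y : `|cadj theta y| <= M * \int[leb2]_z `|b z|.
  have Is := L1_shift y Ib; have Ia := L1_abs Ib.
  have I1 := L1_bdM (Cc_measurable ct) hM Is.
  apply: (le_trans (Rint_abs I1)).
  rewrite -(Rint_shift y Ia) -(RintZ _ (L1_shift y Ia)).
  apply: Rint_le; [exact: L1_abs|exact: L1Z (L1_shift y Ia)|].
  by move=> z; rewrite normrM mulrC ler_wpM2r.
by under eq_fun do rewrite expr2; exact: (L1_bdM mc h Ic).
Qed.

Lemma hf_cadj theta xi : Cc theta -> hf (cadj theta) xi = bhat b xi * hf theta xi.
Proof.
move=> ct; have It := Cc_L1 ct.
have Ik := L1_kernel ct It.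
have I : L1_on (sleb2 R \x sleb2 R)%E (fun p => b (p.1 - p.2) * theta p.1 * cas (dot2 p.2 xi)).
  apply: (@L1_bdM _ _ _ _ _ _ 2) Ik; last by move=> p; exact: cas_le2.
  apply: (@measurableT_comp _ _ _ _ _ _ (fun y : P2 => cas (dot2 y xi) : R)); last exact: measurable_snd.
  exact: measurable_cas_dot2'.
have sw := Rint_swap I.
Transparent hf.
have E1 : (fun y => \int[sleb2 R]_x (b (x - y) * theta x * cas (dot2 y xi))) =
    (fun y => cadj theta y * cas (dot2 y xi)).
  apply/funext => y; rewrite mulrC /cadj -RintZ; last first.
    have [M hM] := Cc_bounded ct.
    exact: L1_bdM (Cc_measurable ct) hM (L1_shift y Ib).
  by congr Rintegral; apply/funext => z; rewrite mulrC.
have E2 : (fun x => \int[sleb2 R]_y (b (x - y) * theta x * cas (dot2 y xi))) =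
    (fun x => bhat b xi * (theta x * cas (dot2 x xi))).
  apply/funext => z.
  have Is := L1_cos_dot2 xi Ib; have Ic := L1_sin_dot2 xi Ib.
  pose h y := cas (dot2 z xi) * (b y * cos (dot2 y xi)) - cas (- dot2 z xi) * (b y * sin (dot2 y xi)).
  have Ih : L1 h by apply: L1B; exact: L1Z.
  have -> : (fun y => b (z - y) * theta z * cas (dot2 y xi)) = (fun y => theta z * h (z - y)).
    apply/funext => y; rewrite /h.
    have -> : dot2 y xi = dot2 z xi - dot2 (z - y) xi by rewrite /dot2 /=; ring.
    rewrite /cas !(cosD, sinD, cosN, sinN); ring.
  rewrite (RintZ _ (L1_refl z Ih)) (Rint_refl z Ih) /h RintB; [|exact: L1Z|exact: L1Z].
  rewrite (RintZ _ Is) (RintZ _ Ic) (bhat_sin0 Ib hb) -(bhat_cos b xi).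
  by move: (bhat b xi) (cas _) (cas _) (theta z) => p q q' t; ring.
move: sw; rewrite /= E1 E2 (RintZ _ (L1_cas xi It)) => /esym.
by rewrite /hf.
Qed.
#[local] Opaque hf.

Lemma convol_test g theta : L2 g -> Cc theta ->
  \int[leb2]_z (convol b g z * theta z) =
  (2 * pi) ^- 2 * \int[leb2]_xi (bhat b xi * hartley g xi * hf theta xi).
Proof.
move=> Lg ct; have It := Cc_L1 ct; have Lt := Cc_L2 ct; have [mg _] := Lg.
have [I _] : L1_on (sleb2 R \x sleb2 R)%E (fun p => theta p.1 * `|b (p.1 - p.2)| * g p.2) /\
   2 * `|\int[(sleb2 R \x sleb2 R)%E]_p (theta p.1 * `|b (p.1 - p.2)| * g p.2)| <=
   (\int[leb2]_z `|b z|) * (ip theta theta + ip g g).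
  have Ia := L1_abs Ib.
  apply: (@schur_test _ _ _ _ _ (sleb2 R) (sleb2 R) (fun p => `|b (p.1 - p.2)|)) => //.
  - by apply: measurableT_comp => //; exact: measurable_kernel.
  - by move=> z /=; split; [exact: (L1_refl z Ia)|rewrite (Rint_refl z Ia)].
  - by move=> y /=; split; [exact: (L1_shift y Ia)|rewrite (Rint_shift y Ia)].
have {}I : L1_on (sleb2 R \x sleb2 R)%E (fun p => theta p.1 * (b (p.1 - p.2) * g p.2)).
  apply: L1_dom (L1_abs I).
    apply: measurable_funM; first by apply: measurableT_comp; [exact: L1_meas It|exact: measurable_fst].
    apply: measurable_funM; first exact: measurable_kernel.
    by apply: measurableT_comp; [exact: mg|exact: measurable_snd].
  by move=> p; rewrite !normrM normr_id mulrA.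
have sw := Rint_swap I.
have E1 : (fun x => \int[sleb2 R]_y (theta x * (b (x - y) * g y))) =
    (fun z => convol b g z * theta z).
  apply/funext => z; rewrite mulrC RintZ_meas//.
  by apply: measurable_funM => //; exact: L1_meas (L1_refl z Ib).
have E2 : (fun y => \int[sleb2 R]_x (theta x * (b (x - y) * g y))) =
    (fun y => g y * cadj theta y).
  apply/funext => y; rewrite /cadj -RintZ; last first.
    have [M hM] := Cc_bounded ct.
    exact: L1_bdM (Cc_measurable ct) hM (L1_shift y Ib).
  by congr Rintegral; apply/funext => z; rewrite mulrCA mulrA mulrC mulrA.
move: sw; rewrite /= E1 E2 => ->.
have Lc := L2_cadj ct.
rewrite -/(ip g (cadj theta)) (ip_hartley Lg Lc); congr (_ * _).
apply: Rint_ae.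
- by apply: measurable_funM; [exact: measurable_hartley|exact: measurable_hartley].
- apply: measurable_funM; last exact: measurable_hf.
  by apply: measurable_funM; [exact: measurable_bhat Ib hb|exact: measurable_hartley].
- apply: ae_imp (hartley_L1 (L1_cadj ct) Lc) => xi a.
  by rewrite a hf_cadj// mulrCA mulrA.
Qed.

Lemma bhat_dmul_le e f xi : axis e -> 0 < C -> 2 <= r ->
  `|bhat b xi * dmul e f xi| <= C * `|f (negp xi)|.
Proof.
move=> ae_ C0 r2; have h := bhat_bracket2 hb xi C0 r2; have b0 := bhat_ge0 hb xi.
have h1 := axis_bracket2 xi ae_; have h2 := bracket2_ge1 xi.
rewrite /dmul !normrM normrN (ger0_norm b0) mulrA ler_wpM2r//.
apply: le_trans h; rewrite mulrC ler_wpM2r//.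
have : `|dot2 e xi| ^+ 2 <= bracket2 xi by rewrite real_normK ?num_real.
move: (normr_ge0 (dot2 e xi)); set a := `|_| => a0 h3; nra.
Qed.

Lemma hartley_convol_eq v g1 g2 : 0 < C -> 2 <= r -> L2 v -> L2 g1 -> L2 g2 ->
  (forall theta, test_function theta -> \int[leb2]_z (v z * theta z) =
    (- \int[leb2]_z (convol b g1 z * 'D_e1 theta z)) +
    (- \int[leb2]_z (convol b g2 z * 'D_e2 theta z))) ->
  {ae leb2, forall xi, hartley v xi =
    bhat b xi * (dmul e1 (hartley g1) xi + dmul e2 (hartley g2) xi)}.
Proof.
move=> C0 r2 Lv Lg1 Lg2 hv.
have LG e g : axis e -> L2 g -> L2 (fun xi => bhat b xi * dmul e (hartley g) xi).
  move=> ae_ Lg; have LH := L2_negp (L2_hartley Lg).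
  apply: (@L2_dom _ P2 R leb2 _ (fun xi => C * hartley g (negp xi))); last exact: L2Z.
    apply: measurable_funM; first exact: measurable_bhat Ib hb.
    apply: measurable_funM; last by case: LH.
    by apply: measurable_funN; exact: measurable_dot2.
  by move=> xi; rewrite [leRHS]normrM (ger0_norm (ltW C0)); exact: bhat_dmul_le.
have key e g theta : axis e -> L2 g -> test_function theta ->
    (- \int[leb2]_z (convol b g z * 'D_e theta z)) =
    (2 * pi) ^- 2 * ip (fun xi => bhat b xi * dmul e (hartley g) xi) (hartley theta).
  move=> ae_ Lg tt; have ct := test_Cc tt; have cd := test_Cc_D ae_ tt.
  have Lt := Cc_L2 ct; have LHt := L2_hartley Lt; have LGg := LG _ _ ae_ Lg.
  have mhf : measurable_fun [set: P2] (hf theta : P2 -> R) by exact: measurable_hf (Cc_L1 ct).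
  have -> : ip (fun xi => bhat b xi * dmul e (hartley g) xi) (hartley theta) =
      ip (fun xi => bhat b xi * dmul e (hartley g) xi) (hf theta).
    by apply: (ip_ae LGg LHt) => //; [case: LGg|exact: ae_all|exact: hartley_Cc].
  rewrite (convol_test Lg cd) -mulrN; congr (_ * _).
  have Lhf : L2 (hf theta) by exact: (hf_L2 (Cc_L1 ct) Lt).1.
  have I := L2_L1M LGg Lhf.
  rewrite /ip_on -(Rint_negp I) -RintN; last first.
    have := L1N (L1_negp I); congr (L1_on leb2 _); apply/funext => xi.
    by rewrite bhat_even /dmul dot2_negp negpK (hf_D _ ae_ tt); ring.
  congr Rintegral; apply/funext => xi.
  by rewrite bhat_even /dmul dot2_negp negpK (hf_D _ ae_ tt); ring.
have LG1 := LG _ _ (or_introl erefl) Lg1; have LG2 := LG _ _ (or_intror erefl) Lg2.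
set G1 := (fun xi => _) in LG1; set G2 := (fun xi => _) in LG2.
suff : {ae leb2, forall xi, hartley v xi = G1 xi + G2 xi}.
  by apply: ae_imp => xi ->; rewrite mulrDr.
apply: (hartley_char Lv (L2D LG1 LG2)) => theta tt.
have LHt := L2_hartley (Cc_L2 (test_Cc tt)).
apply: (etrans (hv _ tt)).
apply: (etrans (congr2 +%R (key e1 g1 theta (or_introl erefl) Lg1 tt)
  (key e2 g2 theta (or_intror erefl) Lg2 tt))).
rewrite -mulrDr; apply: (congr1 (fun x => (2 * pi) ^- 2 * x)).
exact: (esym (ipDl LG1 LG2 LHt)).
Qed.

End Convolution.

(** * Estimates on the nonlinearity *)

Section Nonlinearity.
Context (R : realType).
Implicit Types (u F : R * R -> R) (f g : R -> R) (p q z : R * R) (M a b c t : R).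

Lemma CkW k u : Ck k.+1 u -> Ck k u.
Proof.
elim: k u => [|k IH] u; first by case.
move=> [cu [d1 d2 h1 h2]]; split; first exact: cu.
by split; [exact: d1|exact: d2|exact: IH h1|exact: IH h2].
Qed.

Lemma Ck_le j k u : (j <= k)%N -> Ck k u -> Ck j u.
Proof.
move=> /subnK <-; elim: (k - j)%N => [|i IH]; first by rewrite add0n.
by rewrite addSn => /CkW.
Qed.

Lemma mvt_bound f g M a b : (forall t, is_derive t 1 f (g t)) -> `|a| <= M -> `|b| <= M ->
  exists c, [/\ `|c| <= M, `|c - a| <= `|b - a| & f b - f a = g c * (b - a)].
Proof.
move=> df; have cf := isd_continuous df.
have key (x y : R) : x <= y -> `|x| <= M -> `|y| <= M ->
    exists c, [/\ `|c| <= M, x <= c <= y & f y - f x = g c * (y - x)].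
  move=> xy xM yM.
  have [] := @MVT_segment R f g x y xy (fun (t : R) _ => df t) _; first exact: continuous_subspaceT.
  move=> c; rewrite in_itv /= => /andP[xc cy] E; exists c; split => //; last by rewrite xc.
  by move: xM yM; rewrite !ler_norml => /andP[? ?] /andP[? ?]; apply/andP; split; lra.
move=> aM bM; have [ab|/ltW ba] := leP a b.
  have [c [cM /andP[ac cb] E]] := key _ _ ab aM bM; exists c; split => //.
  by rewrite !ger0_norm ?subr_ge0// lerD2r.
have [c [cM /andP[bc ca] E]] := key _ _ ba bM aM; exists c; split => //.
  by rewrite !ler0_norm ?subr_le0// lerN2 lerD2r.
by rewrite -(opprB (f a)) E -mulrN opprB.
Qed.

Definition norm1 p : R := `|p.1| + `|p.2|.

Definition inbox M p : Prop := `|p.1| <= M /\ `|p.2| <= M.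

Lemma inbox_bounded u M : continuous u -> exists L : R, 0 <= L /\ forall p, inbox M p -> `|u p| <= L.
Proof.
move=> cu; have [N hN] : exists N : nat, M <= N%:R.
  exists (Num.truncn `|M|).+1; apply: ltW; apply: le_lt_trans (ler_norm M) _.
  exact: truncnS_gt.
have kb : compact (u @` (box N : set (R * R))).
  apply: continuous_compact; last exact: box_compact.
  exact: continuous_subspaceT.
have [L [_ hL]] := compact_bounded kb; exists (`|L| + 1); split; first by rewrite addr_ge0.
move=> p [p1 p2]; apply: (hL (`|L| + 1)); first by rewrite ltr_pwDr// ler_norm.
exists p => //; split; rewrite /= in_itv /= -ler_norml; exact: le_trans hN.
Qed.

Let lip_arith (L1 L2 x y s t : R) : 0 <= L1 -> 0 <= L2 -> 0 <= s -> 0 <= t ->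
  x <= L1 -> y <= L2 -> y * t + x * s <= (L1 + L2) * (s + t).
Proof.
move=> L10 L20 s0 t0 xl yl.
have e1 : x * s <= L1 * s by rewrite ler_wpM2r.
have e2 : y * t <= L2 * t by rewrite ler_wpM2r.
have := mulr_ge0 L10 t0; have := mulr_ge0 L20 s0; lra.
Qed.

Let taylor_arith (L1 L2 x y s t : R) : 0 <= L1 -> 0 <= L2 -> 0 <= s -> 0 <= t ->
  x <= L1 * s -> y <= L2 * (s + t) -> y * t + x * s <= (L1 + L2) * (s + t) ^+ 2.
Proof.
move=> L10 L20 s0 t0 xl yl.
have e1 : x * s <= L1 * s * s by rewrite ler_wpM2r.
have e2 : y * t <= L2 * (s + t) * t by rewrite ler_wpM2r.
apply: (le_trans (lerD e2 e1)); rewrite -subr_ge0.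
have -> : (L1 + L2) * (s + t) ^+ 2 - (L2 * (s + t) * t + L1 * s * s) =
  L1 * (s * t) *+ 2 + L1 * (t * t) + L2 * (s * s) + L2 * (s * t) by ring.
by rewrite !addr_ge0 ?mulrn_wge0 ?mulr_ge0.
Qed.

Lemma Ck1_lipschitz u M : Ck 1 u -> exists L, 0 <= L /\ forall p q, inbox M p -> inbox M q ->
  `|u q - u p| <= L * norm1 (q - p).
Proof.
move=> [cu [d1 d2 [c1 _] [c2 _]]].
have [L1 [L10 hL1]] := inbox_bounded M c1; have [L2 [L20 hL2]] := inbox_bounded M c2.
exists (L1 + L2); split; first exact: addr_ge0.
move=> [p1 p2] [q1 q2] [/= hp1 hp2] [/= hq1 hq2]; rewrite /norm1 /=.
have [c [cM _ E1]] := mvt_bound (fun t => pd1 (d1 (t, p2))) hp1 hq1.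
have [d [dM _ E2]] := mvt_bound (fun t => pd2 (d2 (q1, t))) hp2 hq2.
have -> : u (q1, q2) - u (p1, p2) =
  'D_e2 u (q1, d) * (q2 - p2) + 'D_e1 u (c, p2) * (q1 - p1) by rewrite -E1 -E2; ring.
apply: (le_trans (ler_normD _ _)); rewrite !normrM.
exact: (lip_arith L10 L20 (normr_ge0 _) (normr_ge0 _) (hL1 (c, p2) (conj cM hp2)) (hL2 (q1, d) (conj hq1 dM))).
Qed.

Lemma C2_taylor F M : Ck 2 F -> exists L, 0 <= L /\ forall p q, inbox M p -> inbox M q ->
  `|F q - F p - ('D_e1 F p * (q.1 - p.1) + 'D_e2 F p * (q.2 - p.2))| <= L * norm1 (q - p) ^+ 2.
Proof.
move=> [cF [d1 d2 C1 C2]].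
have [L1 [L10 hL1]] := Ck1_lipschitz M C1; have [L2 [L20 hL2]] := Ck1_lipschitz M C2.
exists (L1 + L2); split; first exact: addr_ge0.
move=> [p1 p2] [q1 q2] [/= hp1 hp2] [/= hq1 hq2].
have [c [cM cd E1]] := mvt_bound (fun t => pd1 (d1 (t, p2))) hp1 hq1.
have [d [dM dd E2]] := mvt_bound (fun t => pd2 (d2 (q1, t))) hp2 hq2.
have -> : F (q1, q2) - F (p1, p2) - ('D_e1 F (p1, p2) * (q1 - p1) + 'D_e2 F (p1, p2) * (q2 - p2)) =
  ('D_e2 F (q1, d) - 'D_e2 F (p1, p2)) * (q2 - p2) + ('D_e1 F (c, p2) - 'D_e1 F (p1, p2)) * (q1 - p1).
  have -> : F (q1, q2) - F (p1, p2) =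
    'D_e2 F (q1, d) * (q2 - p2) + 'D_e1 F (c, p2) * (q1 - p1) by rewrite -E1 -E2; ring.
  by ring.
have := hL1 (p1, p2) (c, p2) (conj hp1 hp2) (conj cM hp2).
have := hL2 (p1, p2) (q1, d) (conj hp1 hp2) (conj hq1 dM).
rewrite /norm1 /= subrr normr0 addr0 => h2 h1.
apply: (le_trans (ler_normD _ _)); rewrite !normrM.
have a1 := normr_ge0 (q1 - p1); have a2 := normr_ge0 (q2 - p2).
have b1 : `|'D_e1 F (c, p2) - 'D_e1 F (p1, p2)| <= L1 * `|q1 - p1|.
  by apply: le_trans h1 _; rewrite ler_wpM2l.
have b2 : `|'D_e2 F (q1, d) - 'D_e2 F (p1, p2)| <= L2 * (`|q1 - p1| + `|q2 - p2|).
  by apply: le_trans h2 _; rewrite ler_wpM2l// lerD2l.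
exact: (taylor_arith L10 L20 a1 a2 b1 b2).
Qed.

Lemma le0_small (x K : R) : (forall t, 0 < t <= 1 -> x <= K * t) -> x <= 0.
Proof.
move=> h; apply/ler_addgt0Pr => e e0; rewrite add0r.
have [K0|K0] := ltP 0 K; last first.
  apply: (le_trans (h 1 _)); first by rewrite ltr01 lexx.
  by rewrite mulr1; apply: le_trans K0 (ltW e0).
pose t := Num.min 1 (e / K).
have t0 : 0 < t by rewrite lt_min ltr01 divr_gt0.
apply: le_trans (h t _) _; first by rewrite t0 ge_min lexx.
apply: (@le_trans _ _ (K * (e / K))); first by rewrite (ler_wpM2l (ltW K0))// ge_min lexx orbT.
by rewrite mulrCA divff ?mulr1// gt_eqF.
Qed.

(* Along an axis the hypothesis reads [t f'(t) <= c f(t)] with [c > 1] and [f(0) = 0];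
   dividing by [t] and letting [t] tend to [0] from both sides gives [f'(0) = 0]. *)
Lemma homogeneous_derive0 f g c L : (forall t, is_derive t 1 f (g t)) -> f 0 = 0 -> 1 < c ->
  (forall t, `|t| <= 1 -> `|g t - g 0| <= L * `|t|) ->
  (forall t, t * g t <= c * f t) -> g 0 = 0.
Proof.
move=> df f0 c1 gL h.
have L0 : 0 <= L.
  have := gL 1; rewrite normr1 lexx mulr1 => /(_ isT); exact: le_trans.
have key t : `|t| <= 1 -> t * g 0 - L * `|t| ^+ 2 <= c * (t * g 0 + L * `|t| ^+ 2).
  move=> t1.
  have [d [d1 dt]] : exists d, [/\ `|d| <= 1, `|d - 0| <= `|t - 0| & f t - f 0 = g d * (t - 0)].
    by apply: mvt_bound => //; rewrite normr0 ler01.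
  rewrite f0 !subr0 in dt * => ft.
  have hd : f t <= t * g 0 + L * `|t| ^+ 2.
    rewrite ft -lerBlDl -(mulrC t) -mulrBr; apply: (le_trans (ler_norm _)).
    rewrite normrM expr2 mulrA mulrC ler_wpM2r//.
    by apply: le_trans (gL _ d1) _; rewrite ler_wpM2l.
  have ht : t * g 0 - L * `|t| ^+ 2 <= t * g t.
    rewrite lerBlDl -lerBlDr -mulrBr; apply: (le_trans (ler_norm _)).
    rewrite normrM expr2 mulrA mulrC ler_wpM2r// distrC; exact: gL.
  apply: (le_trans ht); apply: (le_trans (h t)); rewrite ler_wpM2l//.
  by rewrite ltW// (lt_trans ltr01).
have c0 : 0 < c - 1 by rewrite subr_gt0.
have le : - g 0 <= 0.
  have : - ((c - 1) * g 0) <= 0.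
    apply: (@le0_small _ ((1 + c) * L)) => t /andP[t0 t1].
    have := key t; rewrite (gtr0_norm t0) => /(_ t1) k.
    by rewrite -(ler_pM2r t0); move: (g 0) k => x k; lra.
  by rewrite -mulrN pmulr_rle0.
have ge : g 0 <= 0.
  have : (c - 1) * g 0 <= 0.
    apply: (@le0_small _ ((1 + c) * L)) => t /andP[t0 t1].
    have := key (- t); rewrite normrN (gtr0_norm t0) => /(_ t1) k.
    by rewrite -(ler_pM2r t0); move: (g 0) k => x k; lra.
  by rewrite pmulr_rle0.
by apply/eqP; rewrite eq_le ge -oppr_le0.
Qed.

Lemma homogeneous_grad0 F c : Ck 2 F -> F (0, 0) = 0 -> 1 < c ->
  (forall p, p.1 * 'D_e1 F p + p.2 * 'D_e2 F p <= c * F p) ->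
  'D_e1 F (0, 0) = 0 /\ 'D_e2 F (0, 0) = 0.
Proof.
move=> C F0 c1 h; have [_ [d1 d2 C1 C2]] := C.
have [L1 [L10 hL1]] := Ck1_lipschitz 1 C1; have [L2 [L20 hL2]] := Ck1_lipschitz 1 C2.
split.
  apply: (@homogeneous_derive0 (fun t => F (t, 0)) (fun t => 'D_e1 F (t, 0)) c L1) => //.
  - by move=> t; exact: pd1.
  - move=> t t1; apply: (le_trans (hL1 (0, 0) (t, 0) _ _)).
    + by split; rewrite /= normr0 ler01.
    + by split; rewrite //= normr0 ler01.
    + by rewrite /norm1 /= !subr0 normr0 addr0.
  - by move=> t; have := h (t, 0); rewrite /= mul0r addr0.
apply: (@homogeneous_derive0 (fun t => F (0, t)) (fun t => 'D_e2 F (0, t)) c L2) => //.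
- by move=> t; exact: pd2.
- move=> t t1; apply: (le_trans (hL2 (0, 0) (0, t) _ _)).
  + by split; rewrite /= normr0 ler01.
  + by split; rewrite //= normr0 ler01.
  + by rewrite /norm1 /= !subr0 normr0 add0r.
- by move=> t; have := h (0, t); rewrite /= mul0r add0r.
Qed.

Lemma norm1_sqr_bound p : norm1 p ^+ 2 <= 2 * (p.1 ^+ 2 + p.2 ^+ 2).
Proof.
rewrite /norm1 -(real_normK (num_real p.1)) -(real_normK (num_real p.2)).
by have := sqr_ge0 (`|p.1| - `|p.2|); nra.
Qed.

Lemma C2_bounds F M : Ck 2 F -> F (0, 0) = 0 -> 'D_e1 F (0, 0) = 0 -> 'D_e2 F (0, 0) = 0 ->
  exists L, [/\ 0 <= L,
    forall p, inbox M p -> `|'D_e1 F p| <= L * norm1 p /\ `|'D_e2 F p| <= L * norm1 p,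
    forall p, inbox M p -> `|F p| <= L * norm1 p ^+ 2 &
    forall p q, inbox M p -> inbox M q ->
      `|F q - F p - ('D_e1 F p * (q.1 - p.1) + 'D_e2 F p * (q.2 - p.2))| <= L * norm1 (q - p) ^+ 2].
Proof.
move=> C F0 D10 D20; have [_ [_ _ C1 C2]] := C.
have [L1 [L10 hL1]] := Ck1_lipschitz M C1; have [L2 [L20 hL2]] := Ck1_lipschitz M C2.
have [L3 [L30 hL3]] := C2_taylor M C.
have n0 p : 0 <= norm1 p by rewrite addr_ge0.
have i0 p : inbox M p -> inbox M (0, 0).
  by move=> [h _]; split; rewrite /= normr0; exact: le_trans h.
exists (L1 + L2 + L3); split.
- by rewrite !addr_ge0.
- move=> p hp; have := hL1 _ _ (i0 _ hp) hp; have := hL2 _ _ (i0 _ hp) hp.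
  rewrite D10 D20 !subr0 => h2 h1; split.
    by apply: le_trans h1 _; rewrite ler_wpM2r// -addrA lerDl addr_ge0.
  by apply: le_trans h2 _; rewrite ler_wpM2r// -addrA addrCA lerDl addr_ge0.
- move=> p hp; have := hL3 _ _ (i0 _ hp) hp.
  rewrite F0 D10 D20 !mul0r addr0 !subr0 => h3.
  by apply: le_trans h3 _; rewrite ler_wpM2r ?sqr_ge0// lerDr addr_ge0.
- move=> p q hp hq; apply: le_trans (hL3 _ _ hp hq) _.
  by rewrite ler_wpM2r ?sqr_ge0// lerDr addr_ge0.
Qed.

End Nonlinearity.

(** * Curves on the half-line *)

Definition halfline {R : realType} : set R := [set t | 0 <= t].

Section OneSidedDerivatives.
Context (R : realType).
Implicit Types (f g : R -> R) (s t l a b T : R).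

Lemma cvg_le0 (I : Type) (G : set_system I) (FG : Filter G) (f e : I -> R) (l : R) :
  (\forall i \near G, `|f i - l| <= e i) -> e i @[i --> G] --> (0 : R) ->
  f i @[i --> G] --> l.
Proof.
move=> h e0; apply/cvgrPdist_le => /= d d0.
move/cvgrPdist_le : e0 => /(_ d d0) /= e0.
apply: filterS2 h e0 => i h; rewrite sub0r normrN => e0; rewrite distrC.
exact: le_trans h (le_trans (ler_norm _) e0).
Qed.

Lemma cvg_dnbhs_nbhs (A : set R) f t (l : R) : f t = l ->
  f s @[s --> within A t^'] --> l -> f s @[s --> within A (nbhs t)] --> l.
Proof.
move=> ft h P Pl; have := h P Pl.
change (nbhs t (fun s => s != t -> A s -> P (f s)) -> nbhs t (fun s => A s -> P (f s))).
apply: filterS => s hs As.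
have [->|st] := eqVneq s t; last exact: hs.
by rewrite /= ft; exact: nbhs_singleton.
Qed.

(* Derivative relative to the half-line, hence one-sided at [0]; elsewhere it is the usual one. *)
Definition rdq f l t := (s - t)^-1 * (f s - f t) @[s --> within halfline t^'] --> l.

Lemma sub_cvg0 t : s - t @[s --> within halfline t^'] --> (0 : R).
Proof.
have h : s - t @[s --> t] --> (t - t) by apply: cvgB; [exact: cvg_id|exact: cvg_cst].
rewrite subrr in h => P /h.
change (nbhs t (fun s => P (s - t)) -> nbhs t (fun s => s != t -> halfline s -> P (s - t))).
by apply: filterS => s Ps _ _.
Qed.

Lemma within_neq t : \forall s \near within halfline t^', s != t.
Proof.
change (nbhs t (fun s => s != t -> halfline s -> s != t)).
by apply: filterS filterT => s _.
Qed.

Lemma within_ge0 (G : set_system R) {FG : Filter G} : \forall s \near within halfline G, 0 <= s.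
Proof. by apply: withinT. Qed.

Lemma rdq_cont f l t : rdq f l t -> f s @[s --> within halfline (nbhs t)] --> f t.
Proof.
move=> h; apply: cvg_dnbhs_nbhs => //.
have : (s - t) * ((s - t)^-1 * (f s - f t)) + f t @[s --> within halfline t^'] --> 0 * l + f t.
  by apply: cvgD; [apply: cvgM h; exact: sub_cvg0|exact: cvg_cst].
rewrite mul0r add0r; apply: cvg_trans; apply: near_eq_cvg.
near=> s; have st : s - t != 0.
  by rewrite subr_eq0; near: s; exact: within_neq.
by rewrite mulrA mulfV// mul1r subrK.
Unshelve. all: by end_near. Qed.

Lemma rdq_continuous f f' T : (forall t, 0 <= t -> rdq f (f' t) t) ->
  {within `[0, T], continuous f}.
Proof.
move=> h; apply/subspace_continuousP => t /=; rewrite in_itv /= => /andP[t0 _].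
apply: cvg_trans (rdq_cont (h _ t0)) => P; rewrite /nbhs /= /within /=.
by rewrite !near_simpl; apply: filterS => s hs; rewrite in_itv /= => /andP[s0 _]; exact: hs.
Qed.

Lemma rdq_is_derive f l t : 0 < t -> rdq f l t -> is_derive t 1 f l.
Proof.
move=> t0 h.
have c : h + t @[h --> (0 : R)^'] --> within halfline t^'.
  move=> P; change (nbhs t (fun s => s != t -> halfline s -> P s) -> nbhs (0 : R) (fun h => h != 0 -> P (h + t))) => hP.
  have ct : h + t @[h --> (0 : R)] --> t.
    by rewrite -[X in _ --> X]add0r; apply: cvgD; [exact: cvg_id|exact: cvg_cst].
  have h1 : nbhs (0 : R) (fun h => h + t != t -> halfline (h + t) -> P (h + t)) := ct _ hP.
  have h2 : nbhs (0 : R) (fun h => 0 < h + t) := ct _ (lt_nbhsr t0).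
  apply: filterS2 h1 h2 => x /= {}h1 {}h2 x0; apply: h1; last exact: ltW.
  by rewrite -subr_eq0 addrK.
have lim : h0^-1 *: (f (h0 *: (1 : R) + t) - f t) @[h0 --> (0 : R)^'] --> l.
  have := cvg_comp _ _ c h; apply: cvg_trans; apply: near_eq_cvg; near=> h0.
  by rewrite /= addrK /GRing.scale /= mulr1.
by split; [apply/cvg_ex; exists l|exact: cvg_lim lim].
Unshelve. all: by end_near. Qed.

Lemma unif_near (P : nat -> R -> Prop) T :
  (forall t, 0 <= t <= T -> exists N : nat, \forall s \near within halfline (nbhs t),
     forall n, (N <= n)%N -> P n s) ->
  exists n, forall t, 0 <= t <= T -> P n t.
Proof.
move=> h.
have := (compact_near_coveringP (`[0, T]%classic : set R)).1 (@segment_compact R 0 T).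
move=> /(_ nat \oo (fun n s => 0 <= s -> P n s) _) [].
  move=> t /=; rewrite in_itv /= => tT; have [N hN] := h t tT.
  exists ([set s | 0 <= s -> forall n, (N <= n)%N -> P n s], [set n | (N <= n)%N]) => /=.
    split; last by exists N.
    exact: hN.
  by move=> [s n] /= [h1 h2] s0; exact: h1.
move=> n _ /(_ n (leqnn n)) hn; exists n => t tT.
by apply: hn; rewrite /= ?in_itv//; case/andP : tT.
Qed.

Lemma levine_ode (h h1 h2 : R -> R) (nu T : R) : 0 < nu -> 0 < T ->
  (forall t, 0 <= t -> rdq h (h1 t) t) -> (forall t, 0 <= t -> rdq h1 (h2 t) t) ->
  (forall t, 0 <= t <= T -> 0 < h t) -> 0 < h1 0 -> h 0 / h1 0 <= nu * T ->
  (forall t, 0 < t < T -> (1 + nu) * h1 t ^+ 2 <= h t * h2 t) -> False.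
Proof.
move=> nu0 T0 dh dh1 hp h10 hle hh.
have ch := rdq_continuous (T := T) dh; have ch1 := rdq_continuous (T := T) dh1.
have cdiv (a b : R -> R) : {within `[0, T], continuous a} -> {within `[0, T], continuous b} ->
    (forall t, 0 <= t <= T -> b t != 0) -> {within `[0, T], continuous (fun t => a t / b t)}.
  move=> ca cb b0; apply/subspace_continuousP => t /= ht.
  move/subspace_continuousP : ca => /(_ _ ht) ca; move/subspace_continuousP : cb => /(_ _ ht) cb.
  by apply: cvgM => //; apply: cvgV => //; apply: b0; move: ht; rewrite in_itv.
have ddiv (a b : R -> R) (a' b' t : R) : is_derive t 1 a a' -> is_derive t 1 b b' -> b t != 0 ->
    is_derive t 1 (fun t => a t / b t) ((a' * b t - a t * b') / b t ^+ 2).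
  move=> da db b0.
  have dV : is_derive t 1 (fun t => (b t)^-1) (- b' / b t ^+ 2).
    refine (isd_eq (is_deriveV b0 db) _).
    by rewrite /GRing.scale /= !mulNr mulrC.
  by refine (isd_eq (@isdM _ a (fun t => (b t)^-1) t _ _ da dV) _); field.
have y0 t : 0 <= t <= T -> h1 0 / h 0 <= h1 t / h t.
  move=> /andP[t0 tT].
  have hn s : 0 <= s <= T -> h s != 0 by move=> /hp hs; rewrite gt_eqF.
  have [->//|tn] := eqVneq t 0.
  have {}t0 : 0 < t by rewrite lt_neqAle eq_sym tn.
  have cy : {within `[0, t], continuous (fun t => h1 t / h t)}.
    apply: continuous_subspaceW (cdiv _ _ ch1 ch hn).
    by move=> s /=; rewrite !in_itv /= => /andP[-> st]; exact: le_trans st tT.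
  have dy s : s \in `]0, t[ -> is_derive s 1 (fun t => h1 t / h t) ((h2 s * h s - h1 s * h1 s) / h s ^+ 2).
    rewrite in_itv /= => /andP[s0 st].
    apply: ddiv; [exact: rdq_is_derive (dh1 _ (ltW s0))|exact: rdq_is_derive (dh _ (ltW s0))|].
    by apply: hn; rewrite (ltW s0) (le_trans (ltW st)).
  have [c] := MVT t0 dy cy.
  rewrite in_itv /= => /andP[c0 ct] E; rewrite -subr_ge0 E subr0 mulr_ge0 ?(ltW t0)//.
  rewrite mulr_ge0 ?invr_ge0 ?sqr_ge0// subr_ge0 -expr2 mulrC.
  apply: le_trans (hh c _); last by rewrite c0 (lt_le_trans ct).
  by rewrite ler_peMl ?sqr_ge0// lerDl ltW.
have h1p t : 0 <= t <= T -> 0 < h1 t.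
  move=> ht; have := y0 t ht; have ht0 := hp t ht.
  have h00 : 0 < h 0 by apply: hp; rewrite lexx ltW.
  rewrite ler_pdivlMr//; apply: lt_le_trans; rewrite mulr_gt0// divr_gt0//.
have h1n s : 0 <= s <= T -> h1 s != 0 by move=> /h1p hs; rewrite gt_eqF.
have cg := cdiv _ _ ch ch1 h1n.
have dg s : s \in `]0, T[ -> is_derive s 1 (fun t => h t / h1 t) ((h1 s * h1 s - h s * h2 s) / h1 s ^+ 2).
  rewrite in_itv /= => /andP[s0 sT].
  apply: ddiv; [exact: rdq_is_derive (dh _ (ltW s0))|exact: rdq_is_derive (dh1 _ (ltW s0))|].
  by apply: h1n; rewrite !ltW.
have [c] := MVT T0 dg cg.
rewrite in_itv /= => /andP[c0 cT] E.
have TT : 0 <= T <= T by rewrite lexx ltW.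
have : 0 < h T / h1 T by rewrite divr_gt0 ?hp ?h1p.
apply/negP; rewrite -leNgt.
have -> : h T / h1 T = (h T / h1 T - h 0 / h1 0) + h 0 / h1 0 by rewrite subrK.
rewrite E subr0 -[leRHS](subrr (nu * T)) addrC.
have h1c : 0 < h1 c ^+ 2 by rewrite exprn_gt0// h1p// !ltW.
suff le : (h1 c * h1 c - h c * h2 c) / h1 c ^+ 2 <= - nu.
  apply: lerD; first exact: hle.
  by rewrite -[leRHS]mulNr ler_wpM2r// ltW.
rewrite ler_pdivrMr// lerBlDr; have := hh c; rewrite c0 cT => /(_ isT).
by move: (h1 c) (h c) (h2 c) => p q k; lra.
Qed.

End OneSidedDerivatives.

Section L2Curves.
Context d (X : measurableType d) (R : realType) (mu : {measure set X -> \bar R}).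
Notation L2 := (@L2 _ X R mu).
Notation ip := (@ip _ X R mu).
Implicit Types (u v : X -> R) (U V : R -> X -> R) (s t l a b : R).

Definition nrm u : R := Num.sqrt (ip u u).

Lemma ip_nrm u v : L2 u -> L2 v -> `|ip u v| <= nrm u * nrm v.
Proof.
move=> Lu Lv; rewrite -sqrtrM ?ip_ge0// -sqrtr_sqr; apply: ler_wsqrtr; exact: ip_CS.
Qed.

Definition quo U V t s x : R := (s - t)^-1 * (U s x - U t x) - V t x.

Definition l2_rdq U V t :=
  ip (quo U V t s) (quo U V t s) @[s --> within halfline t^'] --> (0 : R).

Lemma nrm_cvg0 (I : Type) (G : set_system I) (FG : Filter G) (D : I -> X -> R) :
  ip (D i) (D i) @[i --> G] --> (0 : R) -> nrm (D i) @[i --> G] --> (0 : R).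
Proof.
move=> h; rewrite -[X in _ --> X]sqrtr0.
by apply: (cvg_comp (fun i => ip (D i) (D i)) Num.sqrt h); exact: sqrt_continuous.
Qed.

Section Curve.
Variables (U V : R -> X -> R).
Hypotheses (LU : forall t, 0 <= t -> L2 (U t)) (LV : forall t, 0 <= t -> L2 (V t)).

Lemma L2_quo t s : 0 <= t -> 0 <= s -> L2 (quo U V t s).
Proof.
by move=> t0 s0; apply: (L2B _ (LV t0)); apply: L2Z; exact: (L2B (LU s0) (LU t0)).
Qed.

Lemma quoE t s x : s != t -> U s x = U t x + (s - t) * (V t x + quo U V t s x).
Proof.
move=> st; rewrite /quo addrC; have : s - t != 0 by rewrite subr_eq0.
by move: (U s x) (U t x) (V t x) => p q r st0; field.
Qed.

Lemma l2_rdq_cont t : 0 <= t -> l2_rdq U V t ->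
  ip (fun x => U s x - U t x) (fun x => U s x - U t x) @[s --> within halfline (nbhs t)] --> (0 : R).
Proof.
move=> t0 h; apply: cvg_dnbhs_nbhs.
  by rewrite /ip_on; under eq_fun do rewrite subrr mul0r; rewrite /Rintegral integral0.
pose e s := (s - t) ^+ 2 * (2 * ip (V t) (V t) + 2 * ip (quo U V t s) (quo U V t s)).
apply: (@cvg_le0 _ _ _ _ _ e).
  near=> s; have s0 : 0 <= s by near: s; exact: within_ge0.
  have st : s != t by near: s; exact: within_neq.
  have Lq := L2_quo t0 s0; have LVt := LV t0.
  have -> : (fun x => U s x - U t x) = (fun x => (s - t) * (V t x + quo U V t s x)).
    by apply/funext => x; rewrite (quoE x st) addrC addKr.
  have Ls := L2D LVt Lq.
  rewrite (ipZl _ Ls (L2Z _ Ls)) (ipZr _ Ls Ls) subr0 mulrA -expr2 ger0_norm; last first.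
    by rewrite mulr_ge0 ?sqr_ge0 ?ip_ge0.
  by rewrite ler_wpM2l ?sqr_ge0// ip_sqrD_le.
have -> : 0 = 0 * 0 * (2 * ip (V t) (V t) + 2 * 0) :> R by ring.
apply: cvgM.
  by rewrite /e; under eq_fun do rewrite expr2; apply: cvgM; exact: sub_cvg0.
by apply: cvgD; [exact: cvg_cst|apply: cvgM => //; exact: cvg_cst].
Unshelve. all: by end_near. Qed.

End Curve.

Lemma rdq_ip U1 V1 U2 V2 t :
  (forall t, 0 <= t -> L2 (U1 t)) -> (forall t, 0 <= t -> L2 (V1 t)) ->
  (forall t, 0 <= t -> L2 (U2 t)) -> (forall t, 0 <= t -> L2 (V2 t)) ->
  0 <= t -> l2_rdq U1 V1 t -> l2_rdq U2 V2 t ->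
  rdq (fun t => ip (U1 t) (U2 t)) (ip (V1 t) (U2 t) + ip (U1 t) (V2 t)) t.
Proof.
move=> LU1 LV1 LU2 LV2 t0 h1 h2.
pose D1 s := quo U1 V1 t s; pose D2 s := quo U2 V2 t s.
pose e s := nrm (D1 s) * nrm (U2 t) + nrm (U1 t) * nrm (D2 s) +
  `|s - t| * (nrm (V1 t) * nrm (V2 t) + nrm (V1 t) * nrm (D2 s) + nrm (D1 s) * nrm (V2 t) +
    nrm (D1 s) * nrm (D2 s)).
apply: (@cvg_le0 _ _ _ _ _ e).
  near=> s; have s0 : 0 <= s by near: s; exact: within_ge0.
  have st : s != t by near: s; exact: within_neq.
  have st0 : s - t != 0 by rewrite subr_eq0.
  have Lq1 := L2_quo LU1 LV1 t0 s0; have Lq2 := L2_quo LU2 LV2 t0 s0.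
  have [u1 v1 u2 v2] := And4 (LU1 _ t0) (LV1 _ t0) (LU2 _ t0) (LV2 _ t0).
  have w1 := L2D v1 Lq1; have w2 := L2D v2 Lq2.
  have E1 : U1 s = (fun x => U1 t x + (s - t) * (V1 t x + D1 s x)).
    by apply/funext => x; exact: quoE.
  have E2 : U2 s = (fun x => U2 t x + (s - t) * (V2 t x + D2 s x)).
    by apply/funext => x; exact: quoE.
  have z1 := L2Z (s - t) w1; have z2 := L2Z (s - t) w2.
  have -> : (s - t)^-1 * (ip (U1 s) (U2 s) - ip (U1 t) (U2 t)) - (ip (V1 t) (U2 t) + ip (U1 t) (V2 t)) =
    ip (D1 s) (U2 t) + ip (U1 t) (D2 s) + (s - t) * (ip (V1 t) (V2 t) + ip (V1 t) (D2 s) +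
      ip (D1 s) (V2 t) + ip (D1 s) (D2 s)).
    rewrite E1 E2 (ipDl u1 z1 (L2D u2 z2)) (ipDr u2 z2 u1) (ipDr u2 z2 z1).
    rewrite (ipZr _ w2 u1) (ipZr _ w2 z1) (ipZl _ w1 u2) (ipZl _ w1 w2).
    rewrite (ipDl v1 Lq1 u2) (ipDr v2 Lq2 u1) (ipDl v1 Lq1 w2) (ipDr v2 Lq2 v1) (ipDr v2 Lq2 Lq1).
    rewrite -/(D1 s) -/(D2 s).
    have gen (a b c d' e' f g h i x : R) : x != 0 ->
      x^-1 * (a + x * (b + c) + (x * (d' + e') + x * (x * ((f + g) + (h + i)))) - a) - (d' + b) =
      e' + c + x * (f + g + h + i) by move=> x0; field.
    exact: gen.
  apply: (le_trans (ler_normD _ _)); apply: lerD.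
    by apply: (le_trans (ler_normD _ _)); apply: lerD; exact: ip_nrm.
  rewrite normrM ler_wpM2l//.
  apply: (le_trans (ler_normD _ _)); apply: lerD; last exact: ip_nrm.
  apply: (le_trans (ler_normD _ _)); apply: lerD; last exact: ip_nrm.
  by apply: (le_trans (ler_normD _ _)); apply: lerD; exact: ip_nrm.
have -> : 0 = 0 * nrm (U2 t) + nrm (U1 t) * 0 + 0 * (nrm (V1 t) * nrm (V2 t) + nrm (V1 t) * 0 +
   0 * nrm (V2 t) + 0 * 0) :> R by ring.
have n1 : nrm (D1 s) @[s --> within halfline t^'] --> (0 : R) by apply: nrm_cvg0.
have n2 : nrm (D2 s) @[s --> within halfline t^'] --> (0 : R) by apply: nrm_cvg0.
apply: cvgD; first by apply: cvgD; apply: cvgM => //; exact: cvg_cst.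
apply: cvgM; first by apply/norm_cvg0P; exact: sub_cvg0.
apply: cvgD; last by apply: cvgM.
apply: cvgD; last by apply: cvgM => //; exact: cvg_cst.
apply: cvgD; first exact: cvg_cst.
by apply: cvgM => //; exact: cvg_cst.
Unshelve. all: by end_near. Qed.

Lemma l2_rdq_mul U V t (m : X -> R) c : 
  (forall t, 0 <= t -> L2 (U t)) -> (forall t, 0 <= t -> L2 (V t)) -> 0 <= t ->
  measurable_fun setT m -> (forall x, `|m x| <= c) -> l2_rdq U V t ->
  l2_rdq (fun t x => U t x * m x) (fun t x => V t x * m x) t.
Proof.
move=> LU LV t0 mm mc h.
apply: (@cvg_le0 _ _ _ _ _ (fun s => c ^+ 2 * ip (quo U V t s) (quo U V t s))).
  near=> s; have s0 : 0 <= s by near: s; exact: within_ge0.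
  have [mq Iq] := L2_quo LU LV t0 s0.
  have E : quo (fun t x => U t x * m x) (fun t x => V t x * m x) t s = (fun x => quo U V t s x * m x).
    by apply/funext => x; rewrite /quo; ring.
  have [mqm Iqm] := L2_bdM mm mc (conj mq Iq).
  rewrite E subr0 ger0_norm ?ip_ge0// /ip_on.
  have II f : (fun x => f x * f x) = (fun x => f x ^+ 2) :> (X -> R).
    by apply/funext => x; rewrite expr2.
  rewrite !II -(RintZ _ Iq); apply: Rint_le => //; first exact: L1Z.
  move=> x; rewrite exprMn mulrC ler_wpM2r ?sqr_ge0//.
  rewrite -(real_normK (num_real (m x))) ler_pXn2r// nnegrE//.
  exact: le_trans (mc x).
rewrite -[X in _ --> X](mulr0 (c ^+ 2)).
by apply: cvgM => //; exact: cvg_cst.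
Unshelve. all: by end_near. Qed.

Lemma unif_tail U V T (m_ : nat -> X -> R) (m : X -> R) (delta : R) :
  (forall t, 0 <= t -> L2 (U t)) -> (forall t, 0 <= t -> L2 (V t)) ->
  (forall t, 0 <= t -> l2_rdq U V t) ->
  (forall n, measurable_fun setT (m_ n)) -> measurable_fun setT m ->
  (forall n x, 0 <= m_ n x <= 1) -> (forall x, m_ ^~ x @ \oo --> m x) ->
  (forall t, 0 <= t -> \int[mu]_x (U t x ^+ 2 * m x) = 0) -> 0 < delta ->
  exists n, forall t, 0 <= t <= T -> \int[mu]_x (U t x ^+ 2 * m_ n x) <= delta.
Proof.
move=> LU LV dU mm_ mm m01 mcv Um0 d0.
have I n u : L2 u -> L1 mu (fun x => u x ^+ 2 * m_ n x).
  move=> [mu_ Iu]; apply: (@L1_bdM _ _ _ _ _ _ 1) Iu => // x.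
  by have /andP[a b] := m01 n x; rewrite ger0_norm.
apply: unif_near => t /andP[t0 tT].
have cv : \int[mu]_x (U t x ^+ 2 * m_ n x) @[n --> \oo] --> (0 : R).
  rewrite -(Um0 _ t0); apply: (@Rint_dct _ _ _ _ _ _ (fun x => U t x ^+ 2)).
  - by move=> n; exact: L1_meas (I n _ (LU _ t0)).
  - by apply: measurable_funM => //; apply: measurable_funX; case: (LU _ t0).
  - by apply: ae_all => x; apply: cvgM; [exact: cvg_cst|exact: mcv].
  - by case: (LU _ t0).
  - move=> n x; have /andP[a b] := m01 n x.
    by rewrite normrM !ger0_norm ?sqr_ge0// ler_piMr// sqr_ge0.
have d4 : 0 < delta / 4 by rewrite divr_gt0.
move/cvgrPdist_le : cv => /(_ _ d4) /= [N _ hN]; exists N.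
have := l2_rdq_cont LU LV t0 (dU _ t0).
move/cvgrPdist_le => /(_ _ d4) /= h.
near=> s => n Nn; have s0 : 0 <= s by near: s; exact: within_ge0.
have h1 := hN n Nn; rewrite /= sub0r normrN in h1.
have h2 : ip (fun x => U s x - U t x) (fun x => U s x - U t x) <= delta / 4.
  apply: le_trans (ler_norm _) _; rewrite -normrN -[- ip _ _]sub0r.
  by near: s.
have Lst := L2B (LU _ s0) (LU _ t0).
apply: (@le_trans _ _ (\int[mu]_x (2 * (U s x - U t x) ^+ 2 + 2 * (U t x ^+ 2 * m_ n x)))).
  apply: Rint_le; [exact: I (LU _ s0)| |].
    by apply: L1D; [apply: L1Z; case: Lst|apply: L1Z; exact: I (LU _ t0)].
  move=> x; have /andP[a b] := m01 n x.
  move: (U s x) (U t x) (m_ n x) a b => p q k k0 k1.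
  have : p ^+ 2 <= 2 * (p - q) ^+ 2 + 2 * q ^+ 2 by have := sqr_ge0 (p - 2 * q); nra.
  move=> h3; have := ler_wpM2r k0 h3.
  have : 2 * (p - q) ^+ 2 * k <= 2 * (p - q) ^+ 2.
    by rewrite ler_piMr// mulr_ge0// sqr_ge0.
  by rewrite mulrDl; lra.
rewrite RintD; [|by apply: L1Z; case: Lst|by apply: L1Z; exact: I (LU _ t0)].
rewrite RintZ; last by case: Lst.
rewrite RintZ; last exact: I (LU _ t0).
have -> : \int[mu]_x (U s x - U t x) ^+ 2 = ip (fun x => U s x - U t x) (fun x => U s x - U t x).
  by congr Rintegral; apply/funext => x; rewrite expr2.
have := le_trans (ler_norm _) h1.
move: h2; set p := ip _ _; set q := Rintegral _ _ _; lra.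
Unshelve. all: by end_near. Qed.

Lemma unif_bounded U V T :
  (forall t, 0 <= t -> L2 (U t)) -> (forall t, 0 <= t -> L2 (V t)) ->
  (forall t, 0 <= t -> l2_rdq U V t) ->
  exists n : nat, forall t, 0 <= t <= T -> ip (U t) (U t) <= n%:R.
Proof.
move=> LU LV dU.
apply: (@unif_near _ (fun n t => ip (U t) (U t) <= n%:R)) => t /andP[t0 tT].
exists (Num.truncn (2 * ip (U t) (U t) + 2)).+1.
have := l2_rdq_cont LU LV t0 (dU _ t0).
move/cvgrPdist_le => /(_ _ ltr01) /= h.
near=> s => n Nn; have s0 : 0 <= s by near: s; exact: within_ge0.
have h2 : ip (fun x => U s x - U t x) (fun x => U s x - U t x) <= 1.
  apply: le_trans (ler_norm _) _; rewrite -normrN -[- ip _ _]sub0r.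
  by near: s.
have Lst := L2B (LU _ s0) (LU _ t0).
have := ip_sqrD_le (LU _ t0) Lst.
have -> : (fun x => U t x + (U s x - U t x)) = U s by apply/funext => x; rewrite addrC subrK.
move=> h3; apply: (le_trans h3); apply: (@le_trans _ _ (2 * ip (U t) (U t) + 2)).
  by rewrite lerD2l -[leRHS]mulr1 ler_wpM2l.
by apply: ltW; apply: (lt_le_trans (truncnS_gt _)); rewrite ler_nat.
Unshelve. all: by end_near. Qed.

End L2Curves.

Section AlmostEverywhereBounds.
Context d (X : measurableType d) (R : realType) (mu : {measure set X -> \bar R}).
Implicit Types (f g : X -> R).

Lemma L1_dom_ae f g : measurable_fun setT f -> {ae mu, forall x, `|f x| <= g x} ->
  L1 mu g -> L1 mu f.
Proof.
move=> mf fg Ig; apply: L1_lty => //.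
have mg := L1_meas Ig; have Ia := L1_abs Ig.
apply: (@le_lt_trans _ _ (\int[mu]_x (`|g x|)%:E)%E); last by rewrite L1_EFin// ltry.
apply: ae_ge0_le_integral => //.
- by apply/measurable_EFinP; exact: measurableT_comp.
- by apply/measurable_EFinP; exact: measurableT_comp.
- by apply: filterS fg => x h _; rewrite lee_fin; apply: le_trans h (ler_norm _).
Qed.

Lemma Rint_le_ae f g : L1 mu f -> L1 mu g -> {ae mu, forall x, f x <= g x} ->
  \int[mu]_x f x <= \int[mu]_x g x.
Proof.
move=> If Ig fg; rewrite -subr_ge0 -RintB//.
have IB := L1B Ig If.
rewrite (@Rint_ae _ _ _ _ _ (fun x => `|g x - f x|)).
- exact: Rint_ge0.
- exact: L1_meas IB.
- exact: L1_meas (L1_abs IB).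
- by apply: ae_imp fg => x h; rewrite ger0_norm ?subr_ge0.
Qed.

Lemma L2_dom_ae f g : measurable_fun setT f -> {ae mu, forall x, `|f x| <= g x} ->
  L2 mu g -> L2 mu f.
Proof.
move=> mf fg [mg Ig]; split => //; apply: L1_dom_ae Ig; first exact: measurable_funX.
apply: ae_imp fg => x h; rewrite normrX ler_pXn2r// nnegrE//.
exact: le_trans h.
Qed.

End AlmostEverywhereBounds.

(** * The potential energy and Sobolev curves *)

Section Potential.
Context d (X : measurableType d) (R : realType) (mu : {measure set X -> \bar R}).
Notation L2 := (@L2 _ X R mu).
Notation L1 := (@L1 _ X R mu).
Notation ip := (@ip _ X R mu).
Notation P2 := (measurableTypeR R * measurableTypeR R)%type.
Variables (F : R * R -> R).
Hypotheses (CF : Ck 2 F) (F0 : F (0, 0) = 0).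
Hypotheses (D10 : 'D_e1 F (0, 0) = 0) (D20 : 'D_e2 F (0, 0) = 0).
Implicit Types (g h : X -> R * R) (M L : R).

Definition L2v g := L2 (fun x => (g x).1) /\ L2 (fun x => (g x).2).

Definition bdv M g := {ae mu, forall x, inbox M (g x)}.

Lemma measurable_comp_plane (u : R * R -> R) g : continuous u -> L2v g ->
  measurable_fun setT (fun x => u (g x)).
Proof.
move=> cu [[m1 _] [m2 _]].
apply: (@measurableT_comp _ _ _ X P2 (measurableTypeR R) (u : P2 -> R)).
  exact: continuous_measurable_plane.
by apply/measurable_fun_pairP; split.
Qed.

Lemma L2_norm1 g : L2v g -> L2 (fun x => norm1 (g x)).
Proof.
move=> [h1 h2]; apply: L2D.
  by apply: (L2_dom _ _ h1) => [|x]; rewrite ?normr_id//; apply: measurableT_comp => //; case: h1.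
by apply: (L2_dom _ _ h2) => [|x]; rewrite ?normr_id//; apply: measurableT_comp => //; case: h2.
Qed.

Let cD1 : continuous ('D_e1 F). Proof. by case: CF => _ [_ _ [c1 _] _]. Qed.
Let cD2 : continuous ('D_e2 F). Proof. by case: CF => _ [_ _ _ [c2 _]]. Qed.

Lemma L2_gradF M g : L2v g -> bdv M g ->
  L2 (fun x => 'D_e1 F (g x)) /\ L2 (fun x => 'D_e2 F (g x)).
Proof.
move=> Lg bg; have [L [L0 h _ _]] := C2_bounds M CF F0 D10 D20.
split; apply: (L2_dom_ae _ _ (L2Z L (L2_norm1 Lg))).
- exact: (measurable_comp_plane cD1 Lg).
- by apply: ae_imp bg => x /h[].
- exact: (measurable_comp_plane cD2 Lg).
- by apply: ae_imp bg => x /h[].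
Qed.

Lemma L1_potential M g : L2v g -> bdv M g -> L1 (fun x => F (g x)).
Proof.
move=> Lg bg; have [L [L0 _ h _]] := C2_bounds M CF F0 D10 D20.
apply: (L1_dom_ae _ _ (L1Z L (L2_norm1 Lg).2)).
  by apply: measurable_comp_plane => //; case: CF.
by apply: ae_imp bg => x /h.
Qed.

Lemma rdq_potential (G H : R -> X -> R * R) (t M : R) :
  (forall t, 0 <= t -> L2v (G t)) -> (forall t, 0 <= t -> L2v (H t)) ->
  0 <= t -> (\forall s \near within halfline (nbhs t), bdv M (G s)) ->
  l2_rdq mu (fun t x => (G t x).1) (fun t x => (H t x).1) t ->
  l2_rdq mu (fun t x => (G t x).2) (fun t x => (H t x).2) t ->
  rdq (fun t => \int[mu]_x F (G t x))
    (ip (fun x => 'D_e1 F (G t x)) (fun x => (H t x).1) +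
     ip (fun x => 'D_e2 F (G t x)) (fun x => (H t x).2)) t.
Proof.
move=> LG LH t0 bG d1 d2.
have [L [L0 _ _ hT]] := C2_bounds M CF F0 D10 D20.
have bGt : bdv M (G t).
  by have := @nbhs_singleton _ t _ bG; apply.
have [Lf1 Lf2] := L2_gradF (LG _ t0) bGt.
set f1 := (fun x => 'D_e1 F (G t x)) in Lf1 *; set f2 := (fun x => 'D_e2 F (G t x)) in Lf2 *.
pose D1 s := quo (fun t x => (G t x).1) (fun t x => (H t x).1) t s.
pose D2 s := quo (fun t x => (G t x).2) (fun t x => (H t x).2) t s.
have [[LH1 LH2] [LG1 LG2]] := (LH _ t0, LG _ t0).
pose k1 := ip (fun x => (H t x).1) (fun x => (H t x).1).
pose k2 := ip (fun x => (H t x).2) (fun x => (H t x).2).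
pose e s := nrm mu f1 * nrm mu (D1 s) + nrm mu f2 * nrm mu (D2 s) +
  `|s - t| * (4 * L * (k1 + ip (D1 s) (D1 s) + (k2 + ip (D2 s) (D2 s)))).
have LGi1 s : 0 <= s -> L2 (fun x => (G s x).1) by move=> /LG[].
have LGi2 s : 0 <= s -> L2 (fun x => (G s x).2) by move=> /LG[].
have LHi1 s : 0 <= s -> L2 (fun x => (H s x).1) by move=> /LH[].
have LHi2 s : 0 <= s -> L2 (fun x => (H s x).2) by move=> /LH[].
apply: (@cvg_le0 _ _ _ _ _ e).
  have bG' : \forall s \near within halfline t^', bdv M (G s).
    change (nbhs t (fun s => s != t -> halfline s -> bdv M (G s))).
    have bG0 : nbhs t (fun s => halfline s -> bdv M (G s)) := bG.
    by apply: filterS bG0 => s h _.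
  near=> s; have s0 : 0 <= s by near: s; exact: within_ge0.
  have st : s != t by near: s; exact: within_neq.
  have st0 : s - t != 0 by rewrite subr_eq0.
  have bs : bdv M (G s) by near: s.
  have Lq1 : L2 (D1 s) := L2_quo LGi1 LHi1 t0 s0.
  have Lq2 : L2 (D2 s) := L2_quo LGi2 LHi2 t0 s0.
  have E1 x : (G s x).1 - (G t x).1 = (s - t) * ((H t x).1 + D1 s x).
    by rewrite (quoE (fun t x => (G t x).1) (fun t x => (H t x).1) x st) addrC addKr.
  have E2 x : (G s x).2 - (G t x).2 = (s - t) * ((H t x).2 + D2 s x).
    by rewrite (quoE (fun t x => (G t x).2) (fun t x => (H t x).2) x st) addrC addKr.
  have IFs := L1_potential (LG _ s0) bs; have IFt := L1_potential (LG _ t0) bGt.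
  pose rem x := (s - t)^-1 * (F (G s x) - F (G t x)) -
    (f1 x * ((H t x).1 + D1 s x) + f2 x * ((H t x).2 + D2 s x)).
  have Ls1 := L2D LH1 Lq1; have Ls2 := L2D LH2 Lq2.
  have I1 := L2_L1M Lf1 Ls1; have I2 := L2_L1M Lf2 Ls2.
  have I0 := L1Z (s - t)^-1 (L1B IFs IFt).
  have Irem : L1 rem by exact: (L1B I0 (L1D I1 I2)).
  have -> : (s - t)^-1 * (\int[mu]_x F (G s x) - \int[mu]_x F (G t x)) -
      (ip f1 (fun x => (H t x).1) + ip f2 (fun x => (H t x).2)) =
      ip f1 (D1 s) + ip f2 (D2 s) + \int[mu]_x rem x.
    rewrite (RintB I0 (L1D I1 I2)) (RintZ _ (L1B IFs IFt)) (RintB IFs IFt) (RintD I1 I2).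
    have gen (x a b c k i1 i2 : R) : i1 = a + b -> i2 = c + k ->
      x - (a + c) = b + k + (x - (i1 + i2)) by move=> -> ->; ring.
    exact: (gen _ _ _ _ _ _ _ (ipDr LH1 Lq1 Lf1) (ipDr LH2 Lq2 Lf2)).
  apply: (le_trans (ler_normD _ _)); apply: lerD.
    by apply: (le_trans (ler_normD _ _)); apply: lerD; exact: ip_nrm.
  apply: (le_trans (Rint_abs Irem)).
  pose maj x := `|s - t| * (2 * L) * (((H t x).1 + D1 s x) ^+ 2 + ((H t x).2 + D2 s x) ^+ 2).
  have Imaj : L1 maj by apply: L1Z; apply: L1D; [case: Ls1|case: Ls2].
  apply: (@le_trans _ _ (\int[mu]_x maj x)).
    apply: Rint_le_ae => //; first exact: L1_abs.
    apply: ae_imp2 bGt bs => x bx bsx.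
    have := hT _ _ bx bsx; rewrite -/(f1 x) -/(f2 x) E1 E2 => h.
    have -> : rem x = (s - t)^-1 * (F (G s x) - F (G t x) -
        (f1 x * ((s - t) * ((H t x).1 + D1 s x)) + f2 x * ((s - t) * ((H t x).2 + D2 s x)))).
      by rewrite /rem; move: (F _) (F _) (f1 x) (f2 x) (_ + D1 s x) (_ + D2 s x) => a b c k p q; field.
    rewrite normrM normfV ler_pdivrMl ?normr_gt0//; apply: (le_trans h).
    have := norm1_sqr_bound (G s x - G t x); rewrite [(G s x - G t x).1]E1 [(G s x - G t x).2]E2 => h2.
    apply: (le_trans (ler_wpM2l L0 h2)); rewrite /maj !exprMn -(real_normK (num_real (s - t))).
    by rewrite le_eqVlt; apply/orP; left; apply/eqP; ring.
  rewrite /maj RintZ; last by apply: L1D; [case: Ls1|case: Ls2].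
  rewrite -[leLHS]mulrA ler_wpM2l// RintD; [|by case: Ls1|by case: Ls2].
  have II f : \int[mu]_x f x ^+ 2 = ip f f.
    by congr Rintegral; apply/funext => x; rewrite expr2.
  rewrite !II.
  have := ip_sqrD_le LH1 Lq1; have := ip_sqrD_le LH2 Lq2; rewrite -/k1 -/k2 => b2 b1.
  have -> : 4 * L = 2 * L * 2 by ring.
  rewrite -[leRHS]mulrA ler_wpM2l ?mulr_ge0//; apply: le_trans (lerD b1 b2) _.
  by rewrite le_eqVlt; apply/orP; left; apply/eqP; ring.
have gen (a b c k : R) : a * 0 + b * 0 + 0 * (4 * L * (c + 0 + (k + 0))) = 0 by ring.
suff : e s @[s --> within halfline t^'] -->
    nrm mu f1 * 0 + nrm mu f2 * 0 + 0 * (4 * L * (k1 + 0 + (k2 + 0))) by rewrite gen.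
have n1 : nrm mu (D1 s) @[s --> within halfline t^'] --> (0 : R) by apply: nrm_cvg0.
have n2 : nrm mu (D2 s) @[s --> within halfline t^'] --> (0 : R) by apply: nrm_cvg0.
apply: cvgD; first by apply: cvgD; apply: cvgM => //; exact: cvg_cst.
apply: cvgM; first by apply/norm_cvg0P; exact: sub_cvg0.
apply: cvgM; first exact: cvg_cst.
by apply: cvgD; apply: cvgD => //; exact: cvg_cst.
Unshelve. all: by end_near. Qed.

End Potential.

#[local] Opaque hf hartley.

Section SobolevCurves.
Context (R : realType).
Notation P2 := (measurableTypeR R * measurableTypeR R)%type.
Notation L2 := (@L2 _ P2 R leb2).
Notation L1 := (@L1 _ P2 R leb2).
Notation ip := (@ip _ P2 R leb2).
Implicit Types (u v : R * R -> R) (e z xi : R * R) (w p : R -> R * R -> R).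

Lemma locintP v : measurable_fun [set: P2] (v : P2 -> R) -> (forall n, L1 (trunc n v)) ->
  locally_integrable2 v.
Proof.
move=> mv Iv; split => // n.
apply/((@integrable_mkcond _ P2 R leb2 _ (EFin \o v) (measurable_box n)).2).
have := Iv n; rewrite [X in _ -> integrable _ _ X](_ : _ = EFin \o trunc n v)//.
apply/funext => z; rewrite /patch /trunc /= indicE.
by case: (_ \in _); rewrite ?mulr1 ?mulr0.
Qed.

Lemma weak_derivB e u v u' v' : axis e -> is_weak_deriv e u u' -> is_weak_deriv e v v' ->
  is_weak_deriv e (fun z => u z - v z) (fun z => u' z - v' z).
Proof.
move=> ae_ [/locint_trunc[mu Iu] /locint_trunc[mu' Iu'] hu].
move=> [/locint_trunc[mv Iv] /locint_trunc[mv' Iv'] hv].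
have tB n (a b : R * R -> R) : L1 (trunc n a) -> L1 (trunc n b) -> L1 (trunc n (fun z => a z - b z)).
  by rewrite truncB; exact: L1B.
split; [apply: locintP|apply: locintP|].
- exact: measurable_funB.
- by move=> n; exact: tB.
- exact: measurable_funB.
- by move=> n; exact: tB.
move=> theta tt; have ct := test_Cc tt; have cd := test_Cc_D ae_ tt.
under eq_fun do rewrite mulrBl; under [in RHS]eq_fun do rewrite mulrBl.
rewrite (RintB (L1_locM mu Iu cd) (L1_locM mv Iv cd)).
rewrite (RintB (L1_locM mu' Iu' ct) (L1_locM mv' Iv' ct)).
by rewrite hu// hv// opprB opprK addrC.
Qed.

Lemma weak_derivZ e (c : R) u u' : axis e -> is_weak_deriv e u u' ->
  is_weak_deriv e (fun z => c * u z) (fun z => c * u' z).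
Proof.
move=> ae_ [/locint_trunc[mu Iu] /locint_trunc[mu' Iu'] hu].
have tZ n (a : R * R -> R) : L1 (trunc n a) -> L1 (trunc n (fun z => c * a z)).
  by move=> /(L1Z c); congr (L1_on leb2 _); apply/funext => z; rewrite /trunc mulrA.
split; [apply: locintP|apply: locintP|].
- exact: measurable_funM.
- by move=> n; exact: tZ.
- exact: measurable_funM.
- by move=> n; exact: tZ.
move=> theta tt; have ct := test_Cc tt; have cd := test_Cc_D ae_ tt.
under eq_fun do rewrite -mulrA; under [in RHS]eq_fun do rewrite -mulrA.
rewrite (RintZ _ (L1_locM mu Iu cd)) (RintZ _ (L1_locM mu' Iu' ct)).
by rewrite hu// mulrN.
Qed.

Lemma weak_deriv_ae e u v u' : axis e -> measurable_fun [set: P2] (v : P2 -> R) ->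
  {ae leb2, forall z, u z = v z} -> is_weak_deriv e u u' -> is_weak_deriv e v u'.
Proof.
move=> ae_ mv uv [/locint_trunc[mu Iu] lu' hu].
split => //.
  apply: locintP => // n; apply: L1_ae (Iu n); first exact: trunc_measurable.
  by apply: ae_imp uv => z h; rewrite /trunc h.
move=> theta tt; have cd := test_Cc_D ae_ tt; rewrite -hu//; apply: Rint_ae.
- by apply: measurable_funM => //; exact: Cc_measurable.
- by apply: measurable_funM => //; exact: Cc_measurable.
- by apply: ae_imp uv => z ->.
Qed.

Lemma norm_oo_ge0 u : (0 <= norm_oo u)%E.
Proof. exact: Lnorm_ge0. Qed.

Lemma norm_oo_bound u (y : R) : (norm_oo u <= y%:E)%E -> {ae leb2, forall z, `|u z| <= y}.
Proof.
rewrite /norm_oo unlock /=; case: ifPn => [mu0 /ess_supP|].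
  by apply: ae_imp => z; rewrite lee_fin.
rewrite -leNgt => mu0 _; exists setT; split => //.
by apply/eqP; rewrite eq_le mu0 measure_ge0.
Qed.

Lemma Lfunoo_bound u : u \in Lfun (@leb2 R) +oo%E -> exists M : R, {ae leb2, forall z, `|u z| <= M}.
Proof.
rewrite inE => /andP[_]; rewrite inE /= /finite_norm => h; exists (fine (norm_oo u)).
apply: norm_oo_bound; rewrite fineK// ge0_fin_numE//; exact: norm_oo_ge0.
Qed.

Definition Xreg u : Prop := [/\ L2 u, L1 (fun xi => bracket2 xi * hartley u xi ^+ 2),
  forall e, axis e -> is_weak_deriv e u (weakD e u) &
  exists M : R, forall e, axis e -> {ae leb2, forall z, `|weakD e u z| <= M}].

Lemma in_Xs_reg (s : R) u : 1 <= s -> in_Xs s u -> Xreg u.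
Proof.
move=> s1 [[/LfunP2 Lu Hu] w1 w2 /Lfunoo_bound[M1 b1] /Lfunoo_bound[M2 b2]].
split => //; first by case: (Hnorm_q1 Lu s1 Hu).
  by move=> e [->|->]; exact: weakD_spec.
exists (Num.max M1 M2) => e [->|->].
  by apply: ae_imp b1 => z h; rewrite le_max h.
by apply: ae_imp b2 => z h; rewrite le_max h orbT.
Qed.

Lemma ip_weak_deriv_le e u v : axis e -> L2 u ->
  L1 (fun xi => bracket2 xi * hartley u xi ^+ 2) -> is_weak_deriv e u v ->
  L2 v /\ ip v v <= (2 * pi) ^- 2 * q1 u.
Proof.
move=> ae_ Lu Iu huv; have [Lv Hv] := hartley_weak_deriv ae_ Lu Iu huv.
split => //; rewrite (ip_hartley Lv Lv).
have Ld := L2_dmul ae_ (L2_hartley Lu) Iu.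
rewrite (ip_ae (L2_hartley Lv) (L2_hartley Lv) Ld.1 Ld.1 Hv Hv).
rewrite ler_wpM2l ?invr_ge0 ?sqr_ge0// /q1 -Rint_negp//.
rewrite /ip_on; apply: Rint_le; [exact: L2_L1M|exact: (L1_negp Iu)|].
move=> xi; rewrite bracket2_negp -expr2 /dmul mulNr sqrrN exprMn.
by rewrite ler_wpM2r ?sqr_ge0// axis_bracket2.
Qed.

(* [u] is in H^1 exactly when [sg u] is in [L^2]. *)
Definition sg u xi : R := Num.sqrt (bracket2 xi) * hartley u xi.

Lemma sg_sqr u xi : sg u xi ^+ 2 = bracket2 xi * hartley u xi ^+ 2.
Proof. by rewrite /sg exprMn sqr_sqrtr// (le_trans ler01)// bracket2_ge1. Qed.

Lemma measurable_sqrt_bracket2 : measurable_fun [set: P2] ((fun xi => Num.sqrt (bracket2 xi)) : P2 -> R).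
Proof.
apply: (@measurableT_comp _ _ _ _ _ _ (@Num.sqrt R : measurableTypeR R -> R)).
  by apply: continuous_measurable_fun; exact: sqrt_continuous.
exact: measurable_bracket2.
Qed.

Lemma L2_sg u : L2 u -> L1 (fun xi => bracket2 xi * hartley u xi ^+ 2) -> L2 (sg u).
Proof.
move=> Lu Iu; split; last by under eq_fun do rewrite sg_sqr.
by apply: measurable_funM; [exact: measurable_sqrt_bracket2|exact: measurable_hartley].
Qed.

Lemma hartleyB u v : L2 u -> L2 v ->
  {ae leb2, forall z, hartley (fun x => u x - v x) z = hartley u z - hartley v z}.
Proof.
move=> Lu Lv; have h1 := hartleyD Lu (L2Z (- 1) Lv); have h2 := hartleyZ (- 1) Lv.
have -> : (fun x => u x - v x) = (fun x => u x + - 1 * v x) by apply/funext => x; rewrite mulN1r.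
by apply: ae_imp2 h1 h2 => z a b; rewrite a b mulN1r.
Qed.

Lemma Xnorm_quo (s : R) w p t : 1 <= s ->
  (forall t, 0 <= t -> in_Xs s (w t)) -> (forall t, 0 <= t -> in_Xs s (p t)) -> 0 <= t ->
  Xnorm s (fun z => (t' - t)^-1 * (w t' z - w t z) - p t z)
      @[t' --> within halfline t^'] --> 0%E ->
  [/\ l2_rdq leb2 (fun t => sg (w t)) (fun t => sg (p t)) t,
    forall e, axis e -> l2_rdq leb2 (fun t => weakD e (w t)) (fun t => weakD e (p t)) t &
    forall e, axis e -> \forall t' \near within halfline t^', {ae leb2, forall z,
      `|quo (fun t => weakD e (w t)) (fun t => weakD e (p t)) t t' z| <= 1}].
Proof.
move=> s1 Xw Xp t0 hc.
pose Dq t' (z : R * R) := (t' - t)^-1 * (w t' z - w t z) - p t z.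
have /fine_cvgP[fin cv] : Xnorm s (Dq t') @[t' --> within halfline t^'] --> 0%E by exact: hc.
have Rw r : 0 <= r -> Xreg (w r) by move=> /Xw; exact: in_Xs_reg.
have Rp r : 0 <= r -> Xreg (p r) by move=> /Xp; exact: in_Xs_reg.
have LDq r : 0 <= r -> L2 (Dq r).
  move=> r0; have [Lr _ _ _] := Rw _ r0; have [Lt _ _ _] := Rw _ t0; have [Lp _ _ _] := Rp _ t0.
  exact: (L2B (L2Z _ (L2B Lr Lt)) Lp).
have wDq e r : axis e -> 0 <= r ->
    is_weak_deriv e (Dq r) (quo (fun t => weakD e (w t)) (fun t => weakD e (p t)) t r).
  move=> ae_ r0; have [_ _ wr _] := Rw _ r0; have [_ _ wt_ _] := Rw _ t0; have [_ _ wp _] := Rp _ t0.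
  apply: (weak_derivB ae_ _ (wp _ ae_)); apply: (weak_derivZ _ ae_).
  exact: weak_derivB ae_ (wr _ ae_) (wt_ _ ae_).
pose x t' := fine (Xnorm s (Dq t')).
have H0 u : (0 <= Hnorm s u)%E by exact: poweR_ge0.
have parts : \forall r \near within halfline t^', [/\ 0 <= r,
    (Hnorm s (Dq r) <= (x r)%:E)%E, (norm_oo (weakD e1 (Dq r)) <= (x r)%:E)%E &
    (norm_oo (weakD e2 (Dq r)) <= (x r)%:E)%E].
  near=> r; have r0 : 0 <= r by near: r; exact: within_ge0.
  have fr : Xnorm s (Dq r) \is a fin_num by near: r.
  rewrite /x fineK//; split => //; rewrite /Xnorm.
  - by rewrite -addeA leeDl// adde_ge0// norm_oo_ge0.
  - apply: (@le_trans _ _ (Hnorm s (Dq r) + norm_oo (weakD e1 (Dq r)))%E).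
      by rewrite leeDr.
    by rewrite leeDl// norm_oo_ge0.
  - by rewrite leeDr// adde_ge0// norm_oo_ge0.
have q1le : \forall r \near within halfline t^', [/\ 0 <= r,
   L1 (fun xi => bracket2 xi * hartley (Dq r) xi ^+ 2) & q1 (Dq r) <= 2 * x r ^+ 2].
  apply: filterS parts => r [r0 hH _ _].
  have [|I h] := Hnorm_q1 (LDq _ r0) s1; first by apply: le_lt_trans hH _; rewrite ltry.
  have hx : fine (Hnorm s (Dq r)) <= x r.
    by rewrite -lee_fin fineK// ge0_fin_numE// (le_lt_trans hH)// ltry.
  have f0 : 0 <= fine (Hnorm s (Dq r)) by exact: fine_ge0.
  split => //; apply: le_trans h _; rewrite ler_wpM2l// ler_pXn2r// nnegrE.
  exact: le_trans f0 hx.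
have c2 (c : R) : c * (2 * x r ^+ 2) @[r --> within halfline t^'] --> (0 : R).
  have -> : 0 = c * (2 * (0 * 0)) :> R by rewrite mul0r !mulr0.
  apply: cvgM; first exact: cvg_cst.
  apply: cvgM; first exact: cvg_cst.
  by under eq_fun do rewrite expr2; apply: cvgM.
split.
- apply: (@cvg_le0 _ _ _ _ _ (fun r => 1 * (2 * x r ^+ 2))) => //.
  apply: filterS q1le => r [r0 I h]; rewrite subr0 ger0_norm ?ip_ge0// mul1r.
  apply: le_trans h; rewrite le_eqVlt; apply/orP; left; apply/eqP.
  have [Lr Ir _ _] := Rw _ r0; have [Lt It _ _] := Rw _ t0; have [Lp Ip _ _] := Rp _ t0.
  have Ls := L2_sg (LDq _ r0) I.
  have Lq : L2 (quo (fun t => sg (w t)) (fun t => sg (p t)) t r).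
    exact: (L2B (L2Z _ (L2B (L2_sg Lr Ir) (L2_sg Lt It))) (L2_sg Lp Ip)).
  have E : {ae leb2, forall xi, quo (fun t => sg (w t)) (fun t => sg (p t)) t r xi = sg (Dq r) xi}.
    have hB := hartleyB (L2Z (r - t)^-1 (L2B Lr Lt)) Lp.
    have hZ := hartleyZ (r - t)^-1 (L2B Lr Lt); have hB2 := hartleyB Lr Lt.
    apply: ae_imp3 hB hZ hB2 => xi a b c.
    have gen (S i x1 x2 x3 h hz hb : R) : h = hz - x3 -> hz = i * hb -> hb = x1 - x2 ->
      i * (S * x1 - S * x2) - S * x3 = S * h by move=> -> -> ->; ring.
    exact: (gen _ _ _ _ _ _ _ _ a b c).
  rewrite (ip_ae Lq Lq Ls.1 Ls.1 E E) /q1 /ip_on; congr Rintegral; apply/funext => xi.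
  by rewrite -expr2 sg_sqr.
- move=> e ae_; apply: (@cvg_le0 _ _ _ _ _ (fun r => (2 * pi) ^- 2 * (2 * x r ^+ 2))) => //.
  apply: filterS q1le => r [r0 I h]; rewrite subr0 ger0_norm ?ip_ge0//.
  have [_ h2] := ip_weak_deriv_le ae_ (LDq _ r0) I (wDq _ _ ae_ r0).
  by apply: le_trans h2 _; rewrite ler_wpM2l// invr_ge0 sqr_ge0.
- move=> e ae_; near=> r.
  have r0 : 0 <= r by near: r; exact: within_ge0.
  have wd : is_weak_deriv e (Dq r) (weakD e (Dq r)).
    by apply: weakD_spec; eexists; exact: wDq ae_ r0.
  have x1 : x r <= 1.
    have : `|0 - x r| < 1 by near: r; move/cvgrPdist_lt : cv; apply.
    by rewrite sub0r normrN => h; apply: le_trans (ler_norm _) (ltW h).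
  have b : {ae leb2, forall z, `|weakD e (Dq r) z| <= x r}.
    apply: norm_oo_bound; have [_ _ n1 n2] : [/\ 0 <= r,
    (Hnorm s (Dq r) <= (x r)%:E)%E, (norm_oo (weakD e1 (Dq r)) <= (x r)%:E)%E &
    (norm_oo (weakD e2 (Dq r)) <= (x r)%:E)%E] by near: r.
    case: ae_ => ->; [exact: n1|exact: n2].
  apply: ae_imp2 (weak_deriv_unique (wDq _ _ ae_ r0) wd) b => z -> h.
  exact: le_trans h x1.
Unshelve. all: by end_near. Qed.

End SobolevCurves.

(** * The concavity argument *)

Section ConstantCurves.
Context (R : realType).
Implicit Types (f : R -> R) (t : R).

Lemma rdq0_const f f' : (forall t, 0 <= t -> rdq f (f' t) t) -> (forall t, 0 < t -> f' t = 0) ->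
  forall t, 0 <= t -> f t = f 0.
Proof.
move=> df f0 t t0; have [->//|tn] := eqVneq t 0.
have {}t0 : 0 < t by rewrite lt_neqAle eq_sym tn.
have [] := @MVT R f f' 0 t t0 _ (rdq_continuous (T := t) df).
  by move=> s; rewrite in_itv /= => /andP[s0 _]; exact: rdq_is_derive (df _ (ltW s0)).
by move=> c; rewrite in_itv /= => /andP[c0 _]; rewrite f0// mul0r => /eqP; rewrite subr_eq0 => /eqP.
Qed.

Lemma rdq_le_affine f f' (c T : R) : (forall t, 0 <= t -> rdq f (f' t) t) ->
  (forall t, 0 < t <= T -> f' t <= c) -> forall t, 0 <= t <= T -> f t <= f 0 + c * t.
Proof.
move=> df fc t /andP[t0 tT]; have [->|tn] := eqVneq t 0; first by rewrite mulr0 addr0.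
have {}t0 : 0 < t by rewrite lt_neqAle eq_sym tn.
have [] := @MVT R f f' 0 t t0 _ (rdq_continuous (T := t) df).
  by move=> s; rewrite in_itv /= => /andP[s0 _]; exact: rdq_is_derive (df _ (ltW s0)).
move=> x; rewrite in_itv /= => /andP[x0 xt]; rewrite subr0 => E.
by rewrite -lerBlDl E ler_wpM2r ?(ltW t0)// fc// x0 (le_trans (ltW xt)).
Qed.

Lemma rdqD f g l k t : rdq f l t -> rdq g k t -> rdq (fun s => f s + g s) (l + k) t.
Proof.
move=> hf_ hg; rewrite /rdq.
have : (s - t)^-1 * (f s - f t) + (s - t)^-1 * (g s - g t) @[s --> within halfline t^'] --> l + k.
  by apply: cvgD.
apply: cvg_trans; apply: near_eq_cvg.
by near=> s; move: (s - t)^-1 (f s) (g s) (f t) (g t) => i x y z q /=; ring.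
Unshelve. all: by end_near. Qed.

Lemma rdqZ f l (c : R) t : rdq f l t -> rdq (fun s => c * f s) (c * l) t.
Proof.
move=> hf_; rewrite /rdq.
have : c * ((s - t)^-1 * (f s - f t)) @[s --> within halfline t^'] --> c * l.
  by apply: cvgM hf_; exact: cvg_cst.
apply: cvg_trans; apply: near_eq_cvg.
by near=> s; move: (s - t)^-1 (f s) (f t) => i x y /=; ring.
Unshelve. all: by end_near. Qed.

Lemma rdq_eq f l k t : rdq f l t -> l = k -> rdq f k t.
Proof. by move=> h <-. Qed.

Lemma rdq_sqr_shift (t0 t : R) : rdq (fun s => (s + t0) ^+ 2) (2 * (t + t0)) t.
Proof.
rewrite /rdq; have : (s - t) + 2 * (t + t0) @[s --> within halfline t^'] --> 0 + 2 * (t + t0).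
  by apply: cvgD; [exact: sub_cvg0|exact: cvg_cst].
rewrite add0r; apply: cvg_trans; apply: near_eq_cvg.
near=> s; have st : s - t != 0 by rewrite subr_eq0; near: s; exact: within_neq.
have gen (x y z i : R) : x - y != 0 -> i = (x - y)^-1 ->
  (x - y) + 2 * (y + z) = i * ((x + z) ^+ 2 - (y + z) ^+ 2).
  by move=> h ->; field.
exact: gen.
Unshelve. all: by end_near. Qed.

Lemma rdq_shift (t0 t : R) : rdq (fun s => s + t0) 1 t.
Proof.
rewrite /rdq; have : (1 : R) @[s --> within halfline t^'] --> (1 : R) by exact: cvg_cst.
apply: cvg_trans; apply: near_eq_cvg.
near=> s; have st : s - t != 0 by rewrite subr_eq0; near: s; exact: within_neq.
have -> : s + t0 - (t + t0) = s - t by ring.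
by rewrite mulVf.
Unshelve. all: by end_near. Qed.

End ConstantCurves.

Section VanishingCurve.
Context d (X : measurableType d) (R : realType) (mu : {measure set X -> \bar R}).

Lemma vanishing_curve (U V : R -> X -> R) (m : X -> R) (c : R) :
  (forall t, 0 <= t -> L2 mu (U t)) -> (forall t, 0 <= t -> L2 mu (V t)) ->
  (forall t, 0 <= t -> l2_rdq mu U V t) ->
  measurable_fun setT m -> (forall x, `|m x| <= c) ->
  {ae mu, forall x, U 0 x * m x = 0} ->
  (forall t, 0 < t -> {ae mu, forall x, V t x * m x = 0}) ->
  forall t, 0 <= t -> {ae mu, forall x, U t x * m x = 0}.
Proof.
move=> LU LV dU mm mc U0 V0.
have LUm t : 0 <= t -> L2 mu (fun x => U t x * m x) by move=> /LU h; exact: L2_bdM mm mc h.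
have LVm t : 0 <= t -> L2 mu (fun x => V t x * m x) by move=> /LV h; exact: L2_bdM mm mc h.
have dm t (t0 : 0 <= t) := l2_rdq_mul LU LV t0 mm mc (dU _ t0).
have dq t (t0 : 0 <= t) := rdq_ip LUm LVm LUm LVm t0 (dm _ t0) (dm _ t0).
have z0 f g : L2 mu f -> L2 mu g -> {ae mu, forall x, f x = 0} -> ip mu f g = 0.
  move=> Lf Lg f0; rewrite (@ip_ae _ _ _ _ _ (fun=> 0) _ g Lf Lg _ Lg.1 f0 (ae_all _ (fun=> erefl)))//.
  by rewrite /ip; under eq_fun do rewrite mul0r; rewrite /Rintegral integral0.
have q0 := rdq0_const dq.
move=> t t0; apply: (ip_eq0_ae (LUm _ t0)).
rewrite q0//.
  by apply: z0 => //; exact: LUm.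
move=> s s0; rewrite (z0 _ _ (LVm _ (ltW s0)) (LUm _ (ltW s0)) (V0 _ s0)).
by rewrite ipC (z0 _ _ (LVm _ (ltW s0)) (LUm _ (ltW s0)) (V0 _ s0)) addr0.
Qed.

End VanishingCurve.

Section SpectralCutoff.
Context (R : realType).
Notation P2 := (measurableTypeR R * measurableTypeR R)%type.
Notation L2 := (@L2 _ P2 R leb2).
Notation L1 := (@L1 _ P2 R leb2).
Notation ip := (@ip _ P2 R leb2).
Implicit Types (u v g : R * R -> R) (e z xi : R * R) (n : nat).
Variables (b : R * R -> R) (C r : R).
Hypotheses (Ib : L1 b) (hb : kernel_decay b C r) (C0 : 0 < C) (r2 : 2 <= r).

Definition chi n xi : R := (bhat b xi < n.+1%:R^-1)%R%:R.
Definition chi0 xi : R := (bhat b xi == 0)%:R.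

Lemma chi_01 n xi : 0 <= chi n xi <= 1.
Proof. by rewrite /chi; case: (_ < _); rewrite /= ?lexx ?ler01. Qed.

Lemma measurable_chi n : measurable_fun [set: P2] (chi n : P2 -> R).
Proof.
have mb := measurable_bhat Ib hb.
have -> : chi n = \1_[set xi | bhat b xi < n.+1%:R^-1].
  by apply/funext => xi; rewrite /chi indicE; congr (nat_of_bool _)%:R; apply/idP/idP; rewrite inE.
apply: measurable_indic; rewrite -[X in measurable X]setTI.
exact: (@measurable_fun_ltr _ P2 R setT _ (cst n.+1%:R^-1)).
Qed.

Lemma measurable_chi0 : measurable_fun [set: P2] (chi0 : P2 -> R).
Proof.
have mb := measurable_bhat Ib hb.
have -> : chi0 = \1_[set xi | bhat b xi = 0].
  by apply/funext => xi; rewrite /chi0 indicE; congr (nat_of_bool _)%:R; apply/eqP/idP; rewrite inE.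
apply: measurable_indic; rewrite -[X in measurable X]setTI.
exact: (mb measurableT [set 0] (measurable_set1 _)).
Qed.

Lemma chi_cvg xi : chi ^~ xi @ \oo --> chi0 xi.
Proof.
apply: cvg_near_cst; near=> n; rewrite /chi /chi0; congr (nat_of_bool _)%:R.
have b0 := bhat_ge0 hb xi.
have [->|bn] := eqVneq (bhat b xi) 0; first by rewrite invr_gt0 ltr0n.
apply/negbTE; rewrite -leNgt.
have bp : 0 < bhat b xi by rewrite lt_neqAle eq_sym bn.
rewrite invf_ple ?posrE ?ltr0n//; apply: (@le_trans _ _ n%:R); last by rewrite ler_nat.
by near: n; exact: nbhs_infty_ger.
Unshelve. all: by end_near. Qed.

Lemma chi_mono n m xi : (n <= m)%N -> chi m xi <= chi n xi.
Proof.
move=> nm; rewrite /chi; case: (ltP (bhat b xi) m.+1%:R^-1) => h; last exact: ler0n.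
by rewrite (lt_le_trans h)// lef_pV2 ?posrE ?ltr0n// ler_nat.
Qed.

(* [bracket2] is divided out because [spcut] multiplies by [sg], which contains its square root. *)
Definition spec n xi : R := (2 * pi) ^- 2 * ((1 - chi n xi) / (bhat b xi * bracket2 xi)).

Lemma spec_ge0 n xi : 0 <= spec n xi.
Proof.
have /andP[c0 c1] := chi_01 n xi; have b0 := bhat_ge0 hb xi; have k1 := bracket2_ge1 xi.
rewrite /spec mulr_ge0 ?invr_ge0 ?sqr_ge0// mulr_ge0 ?subr_ge0// invr_ge0 mulr_ge0//.
exact: le_trans k1.
Qed.

Lemma spec_le n xi : spec n xi <= (2 * pi) ^- 2 * n.+1%:R.
Proof.
rewrite /spec ler_wpM2l ?invr_ge0 ?sqr_ge0//; have k1 := bracket2_ge1 xi.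
rewrite /chi; case: ltP => /= h; first by rewrite subrr mul0r.
rewrite subr0 mul1r invfM; have n0 : 0 < n.+1%:R^-1 :> R by rewrite invr_gt0 ltr0n.
have bp : 0 < bhat b xi by exact: lt_le_trans h.
apply: (@le_trans _ _ (bhat b xi)^-1).
  by rewrite ler_piMr ?invr_ge0 ?(ltW bp)// invf_le1// (lt_le_trans ltr01).
by rewrite invf_ple// posrE// ltr0n.
Qed.

Lemma measurable_spec n : measurable_fun [set: P2] (spec n : P2 -> R).
Proof.
apply: measurable_funM => //; apply: measurable_funM.
  by apply: measurable_funB => //; exact: measurable_chi.
have -> : (fun xi => (bhat b xi * bracket2 xi)^-1) = fun xi => (bhat b xi * bracket2 xi) `^ (-1).
  apply/funext => xi; rewrite powR_inv1// mulr_ge0 ?(bhat_ge0 hb)//.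
  exact: le_trans (bracket2_ge1 xi).
apply: (measurableT_comp (measurable_powR (-1))).
by apply: measurable_funM; [exact: measurable_bhat Ib hb|exact: measurable_bracket2].
Qed.

Definition kap n xi : R := Num.sqrt (spec n xi).

Lemma kap_bound n xi : `|kap n xi| <= Num.sqrt ((2 * pi) ^- 2 * n.+1%:R).
Proof. by rewrite ger0_norm ?sqrtr_ge0// ler_wsqrtr// spec_le. Qed.

Lemma measurable_kap n : measurable_fun [set: P2] (kap n : P2 -> R).
Proof.
apply: (@measurableT_comp _ _ _ _ _ _ (@Num.sqrt R : measurableTypeR R -> R)).
  by apply: continuous_measurable_fun; exact: sqrt_continuous.
exact: measurable_spec.
Qed.

Definition spcut n u xi : R := sg u xi * kap n xi.

Lemma L2_spcut n u : Xreg u -> L2 (spcut n u).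
Proof. by move=> [Lu Iu _ _]; exact: L2_bdM (measurable_kap n) (kap_bound n) (L2_sg Lu Iu). Qed.

Lemma spcutM n u v xi : spcut n u xi * spcut n v xi =
  (2 * pi) ^- 2 * ((1 - chi n xi) / bhat b xi * (hartley u xi * hartley v xi)).
Proof.
have k1 := bracket2_ge1 xi.
have kp : 0 < bracket2 xi by exact: lt_le_trans k1.
have E1 := sqr_sqrtr (spec_ge0 n xi); have E2 := sqr_sqrtr (ltW kp).
rewrite /spcut /sg /kap.
have gen (s k h h' q P i c bh B : R) : s ^+ 2 = B -> k ^+ 2 = P * (c / (bh * B)) -> B != 0 ->
    s * h * k * (s * h' * k) = P * (c / bh * (h * h')).
  move=> s2 k2 B0; have -> : s * h * k * (s * h' * k) = s ^+ 2 * k ^+ 2 * (h * h') by ring.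
  rewrite s2 k2 invfM; have -> : B * (P * (c * (bh^-1 * B^-1))) * (h * h') =
    (B * B^-1) * (P * (c * bh^-1 * (h * h'))) by ring.
  by rewrite divff// mul1r.
by apply: (gen _ _ _ _ 0 _ 0 _ _ _ E2 E1); rewrite gt_eqF.
Qed.

Lemma spcut_energy_le n u : Xreg u -> L1 (fun xi => (bhat b xi)^-1 * hartley u xi ^+ 2) ->
  ip (spcut n u) (spcut n u) <= (2 * pi) ^- 2 * \int[leb2]_xi ((bhat b xi)^-1 * hartley u xi ^+ 2).
Proof.
move=> Xu Iu; rewrite -RintZ//; have Lc := L2_spcut n Xu.
apply: Rint_le; [exact: L2_L1M|exact: L1Z|] => xi.
rewrite spcutM ler_wpM2l ?invr_ge0 ?sqr_ge0// -expr2 ler_wpM2r ?sqr_ge0//.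
have /andP[c0 c1] := chi_01 n xi; have b0 := bhat_ge0 hb xi.
by rewrite ler_piMl ?invr_ge0// lerBlDr lerDl.
Qed.

Lemma ip_grad e u g : axis e -> Xreg u -> L2 g ->
  L1 (fun xi => hartley u xi * dmul e (hartley g) xi) /\
  (2 * pi) ^- 2 * \int[leb2]_xi (hartley u xi * dmul e (hartley g) xi) = - ip g (weakD e u).
Proof.
move=> ae_ [Lu Iu wu _] Lg; have LHg := L2_hartley Lg.
have [Lv Hv] := hartley_weak_deriv ae_ Lu Iu (wu _ ae_).
have Ld := L2_dmul ae_ (L2_hartley Lu) Iu.
have I := L2_L1M LHg Ld.
have E : (fun xi => hartley u xi * dmul e (hartley g) xi) =
    (fun xi => - (hartley g (negp xi) * dmul e (hartley u) (negp xi))).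
  by apply/funext => xi; rewrite /dmul dot2_negp negpK; ring.
have In := L1_negp I; rewrite E; split; first exact: L1N.
rewrite RintN// (Rint_negp I) mulrN; congr (- _).
rewrite (ip_hartley Lg Lv); congr (_ * _).
exact: (ip_ae LHg Ld LHg.1 (L2_hartley Lv).1 (ae_all _ (fun=> erefl)) (ae_imp (fun _ => esym) Hv)).
Qed.

Lemma tail_bound e n u g : axis e -> Xreg u -> L2 g ->
  (\int[leb2]_xi (chi n xi * (hartley u xi * dmul e (hartley g) xi))) ^+ 2 <=
  (2 * pi) ^+ 2 * ip g g * \int[leb2]_xi (sg u xi ^+ 2 * chi n xi).
Proof.
move=> ae_ [Lu Iu wu _] Lg; have LHg := L2_hartley Lg; have LN := L2_negp LHg.
have mc : measurable_fun [set: P2] (chi n : P2 -> R) by exact: measurable_chi.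
have LHu := L2_hartley Lu.
have cb xi : `|chi n xi| <= 1 by have /andP[a c] := chi_01 n xi; rewrite ger0_norm.
have Lsc := L2_bdM mc cb (L2_sg Lu Iu).
pose v xi := - dot2 e xi * hartley u xi * chi n xi.
have Lv : L2 v.
  apply: (L2_dom _ _ Lsc).
    apply: measurable_funM => //; apply: measurable_funM; last by case: LHu.
    by apply: measurable_funN; exact: measurable_dot2.
  move=> xi; rewrite /v /sg !normrM normrN ler_wpM2r// ler_wpM2r//.
  by rewrite -sqrtr_sqr ger0_norm ?sqrtr_ge0// ler_wsqrtr// axis_bracket2.
have -> : \int[leb2]_xi (chi n xi * (hartley u xi * dmul e (hartley g) xi)) =
    ip (fun xi => hartley g (negp xi)) v.
  by congr Rintegral; apply/funext => xi; rewrite /v /dmul; ring.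
apply: (le_trans (ip_CS LN Lv)).
have -> : ip (fun xi => hartley g (negp xi)) (fun xi => hartley g (negp xi)) = (2 * pi) ^+ 2 * ip g g.
  exact: etrans (ip_negp LHg LHg) (parseval Lg Lg).
apply: ler_wpM2l; first exact: mulr_ge0 (sqr_ge0 _) (ip_ge0 _ _).
have I : L1 (fun xi => sg u xi ^+ 2 * chi n xi).
  by apply: (L1_bdM mc cb); case: (L2_sg Lu Iu).
apply: Rint_le => //; first exact: L2_L1M.
move=> xi; rewrite sg_sqr /v.
have /andP[c0 c1] := chi_01 n xi; have cc : chi n xi ^+ 2 = chi n xi.
  by rewrite /chi; case: (_ < _); rewrite /= ?expr1n ?expr0n.
have -> : - dot2 e xi * hartley u xi * chi n xi * (- dot2 e xi * hartley u xi * chi n xi) =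
  dot2 e xi ^+ 2 * hartley u xi ^+ 2 * chi n xi.
  by rewrite -[in RHS]cc; move: (dot2 e xi) (hartley u xi) (chi n xi) => x y z; ring.
by rewrite ler_wpM2r// ler_wpM2r ?sqr_ge0// axis_bracket2.
Qed.

End SpectralCutoff.

Section Concavity.
Context (R : realType).
Notation P2 := (measurableTypeR R * measurableTypeR R)%type.
Notation L2 := (@L2 _ P2 R leb2).
Notation L1 := (@L1 _ P2 R leb2).
Notation ip := (@ip _ P2 R leb2).
Implicit Types (u v g : R * R -> R) (e z xi : R * R) (n : nat) (t : R).
Variables (b : R * R -> R) (C r : R).
Hypotheses (Ib : L1 b) (hb : kernel_decay b C r) (C0 : 0 < C) (r2 : 2 <= r).
Variables (F : R * R -> R) (nu : R).
Hypotheses (CF : Ck 2 F) (F0 : F (0, 0) = 0) (nu0 : 0 < nu).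
Hypothesis hnu : forall U : R * R,
  U.1 * 'D_e1 F U + U.2 * 'D_e2 F U <= 2 * (1 + 2 * nu) * F U.
Variables w p a : R -> R * R -> R.
Hypotheses (Rw : forall t, 0 <= t -> Xreg (w t)) (Rp : forall t, 0 <= t -> Xreg (p t))
  (Ra : forall t, 0 <= t -> Xreg (a t)).
Hypotheses (dW : forall t, 0 <= t -> l2_rdq leb2 (fun t => sg (w t)) (fun t => sg (p t)) t)
  (dP : forall t, 0 <= t -> l2_rdq leb2 (fun t => sg (p t)) (fun t => sg (a t)) t)
  (dG : forall t e, 0 <= t -> axis e ->
    l2_rdq leb2 (fun t => weakD e (w t)) (fun t => weakD e (p t)) t)
  (bG : forall t e, 0 <= t -> axis e -> \forall s \near within halfline t^',
    {ae leb2, forall z, `|quo (fun t => weakD e (w t)) (fun t => weakD e (p t)) t s z| <= 1}).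
Hypothesis heq : forall t, 0 < t -> forall theta, test_function theta ->
  \int[leb2]_z (a t z * theta z) =
  (- \int[leb2]_z (convol b (fun y => 'D_e1 F (wgrad (w t) y)) z * 'D_e1 theta z)) +
  (- \int[leb2]_z (convol b (fun y => 'D_e2 F (wgrad (w t) y)) z * 'D_e2 theta z)).
Hypotheses (zw : {ae leb2, forall xi, bhat b xi = 0 -> hartley (w 0) xi = 0})
  (zp : {ae leb2, forall xi, bhat b xi = 0 -> hartley (p 0) xi = 0}).

Let a1 : @axis R e1 := or_introl erefl.
Let a2 : @axis R e2 := or_intror erefl.

Lemma nu2_gt1 : 1 < 2 * (1 + 2 * nu).
Proof. by have := nu0; lra. Qed.

Let D0 := homogeneous_grad0 CF F0 nu2_gt1 hnu.

Lemma L2v_wgrad u : Xreg u -> L2v leb2 (wgrad u).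
Proof.
move=> [Lu Iu wu _]; split.
  by have [] := ip_weak_deriv_le a1 Lu Iu (wu _ a1).
by have [] := ip_weak_deriv_le a2 Lu Iu (wu _ a2).
Qed.

Lemma bdv_local t : 0 <= t -> exists N, \forall s \near within halfline (nbhs t),
  forall n, (N <= n)%N -> bdv leb2 n%:R (wgrad (w s)).
Proof.
move=> t0; have [_ _ _ [Mw hw]] := Rw t0; have [_ _ _ [Mp hp]] := Rp t0.
pose M := `|Mw| + (`|Mp| + 1); exists (Num.truncn M).+1.
have hM n : ((Num.truncn M).+1 <= n)%N -> M <= n%:R.
  by move=> h; apply: ltW; apply: (lt_le_trans (truncnS_gt _)); rewrite ler_nat.
have b1 : nbhs t (fun s => s != t -> 0 <= s -> {ae leb2, forall z, `|quo (fun t => weakD e1 (w t)) (fun t => weakD e1 (p t)) t s z| <= 1}) := bG t0 a1.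
have b2 : nbhs t (fun s => s != t -> 0 <= s -> {ae leb2, forall z, `|quo (fun t => weakD e2 (w t)) (fun t => weakD e2 (p t)) t s z| <= 1}) := bG t0 a2.
have b3 : nbhs t (fun s => `|s - t| <= 1).
  have : s - t @[s --> t] --> (0 : R).
    by rewrite -[X in _ --> X](subrr t); apply: cvgB; [exact: cvg_id|exact: cvg_cst].
  move/cvgrPdist_le => /(_ 1 ltr01) /=.
  by apply: filterS => s; rewrite sub0r normrN.
change (nbhs t (fun s => 0 <= s -> forall n, ((Num.truncn M).+1 <= n)%N -> bdv leb2 n%:R (wgrad (w s)))).
apply: filterS3 b1 b2 b3 => s h1 h2 st1 s0 n /hM Mn.
have key e : axis e -> (s != t -> 0 <= s -> {ae leb2, forall z,
      `|quo (fun t => weakD e (w t)) (fun t => weakD e (p t)) t s z| <= 1}) ->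
    {ae leb2, forall z, `|weakD e (w s) z| <= n%:R}.
  move=> ae_; have [->|st] := eqVneq s t => hq.
    apply: ae_imp (hw _ ae_) => z h; apply: le_trans Mn; apply: le_trans h _.
    by apply: le_trans (ler_norm _) _; rewrite lerDl addr_ge0.
  apply: ae_imp3 (hw _ ae_) (hp _ ae_) (hq isT s0) => z x1 x2 x3.
  rewrite (quoE (fun t => weakD e (w t)) (fun t => weakD e (p t)) z st); apply: le_trans Mn.
  apply: (le_trans (ler_normD _ _)); apply: lerD; first exact: le_trans x1 (ler_norm _).
  rewrite normrM; apply: (@le_trans _ _ (1 * (`|Mp| + 1))); last by rewrite mul1r.
  apply: ler_pM => //; apply: (le_trans (ler_normD _ _)); apply: lerD => //.
  exact: le_trans x2 (ler_norm _).
apply: ae_imp2 (key _ a1 h1) (key _ a2 h2) => z y1 y2; split; [exact: y1|exact: y2].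
Qed.

Lemma bdv_at t : 0 <= t -> exists n, bdv leb2 n%:R (wgrad (w t)).
Proof.
move=> t0; have [N h] := bdv_local t0; exists N.
have h' : nbhs t (fun s => 0 <= s -> forall n, (N <= n)%N -> bdv leb2 n%:R (wgrad (w s))) := h.
exact: (nbhs_singleton h' t0 N (leqnn N)).
Qed.

Definition flux1 t z : R := 'D_e1 F (wgrad (w t) z).
Definition flux2 t z : R := 'D_e2 F (wgrad (w t) z).

Lemma L2_flux t : 0 <= t -> L2 (flux1 t) /\ L2 (flux2 t).
Proof.
move=> t0; have [n h] := bdv_at t0.
exact: (L2_gradF CF F0 D0.1 D0.2 (L2v_wgrad (Rw t0)) h).
Qed.

Definition flux u t : R := ip (flux1 t) (weakD e1 u) + ip (flux2 t) (weakD e2 u).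

Definition pot t : R := \int[leb2]_z F (wgrad (w t) z).

Lemma L1_pot t : 0 <= t -> L1 (fun z => F (wgrad (w t) z)).
Proof.
move=> t0; have [n h] := bdv_at t0.
exact: (L1_potential CF F0 D0.1 D0.2 (L2v_wgrad (Rw t0)) h).
Qed.

Lemma rdq_pot t : 0 <= t -> rdq pot (flux (p t) t) t.
Proof.
move=> t0; have [N h] := bdv_local t0.
have h' : \forall s \near within halfline (nbhs t), bdv leb2 N%:R (wgrad (w s)).
  by apply: filterS h => s; apply; exact: leqnn.
have LG s : 0 <= s -> L2v leb2 (wgrad (w s)) by move=> s0; exact: L2v_wgrad (Rw s0).
have LH s : 0 <= s -> L2v leb2 (wgrad (p s)) by move=> s0; exact: L2v_wgrad (Rp s0).
have := @rdq_potential _ P2 R leb2 F CF F0 D0.1 D0.2 (fun t => wgrad (w t)) (fun t => wgrad (p t))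
  t N%:R LG LH t0 h' (dG t0 a1) (dG t0 a2).
by [].
Qed.

Lemma flux_le t : 0 <= t -> flux (w t) t <= 2 * (1 + 2 * nu) * pot t.
Proof.
move=> t0; have [Lg1 Lg2] := L2_flux t0; have [Lw1 Lw2] := L2v_wgrad (Rw t0).
have I1 := L2_L1M Lg1 Lw1; have I2 := L2_L1M Lg2 Lw2; have I := L1_pot t0.
rewrite /flux -(RintD I1 I2) -(RintZ _ I); apply: Rint_le; [exact: L1D I1 I2|exact: L1Z|].
move=> z; rewrite (mulrC (flux1 t z)) (mulrC (flux2 t z)); exact: (hnu (wgrad (w t) z)).
Qed.

Lemma hartley_eq t : 0 < t -> {ae leb2, forall xi, hartley (a t) xi =
  bhat b xi * (dmul e1 (hartley (flux1 t)) xi + dmul e2 (hartley (flux2 t)) xi)}.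
Proof.
move=> t0; have [Lg1 Lg2] := L2_flux (ltW t0); have [La _ _ _] := Ra (ltW t0).
apply: (hartley_convol_eq Ib hb C0 r2 La Lg1 Lg2) => theta tt.
exact: heq t0 _ tt.
Qed.

Let LW t (t0 : 0 <= t) : L2 (sg (w t)).
Proof. by have [Lu Iu _ _] := Rw t0; exact: L2_sg Lu Iu. Qed.
Let LP t (t0 : 0 <= t) : L2 (sg (p t)).
Proof. by have [Lu Iu _ _] := Rp t0; exact: L2_sg Lu Iu. Qed.
Let LA t (t0 : 0 <= t) : L2 (sg (a t)).
Proof. by have [Lu Iu _ _] := Ra t0; exact: L2_sg Lu Iu. Qed.

Lemma sg_chi0 u : {ae leb2, forall xi, bhat b xi = 0 -> hartley u xi = 0} ->
  {ae leb2, forall xi, sg u xi * chi0 b xi = 0}.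
Proof.
apply: ae_imp => xi h; rewrite /chi0; case: eqP => [/h h0|_]; last by rewrite mulr0.
by rewrite /sg h0 mulr0 mul0r.
Qed.

Let chi0_le xi : `|chi0 b xi| <= 1.
Proof. by rewrite /chi0; case: eqP => _; rewrite ?normr1 ?normr0 ?ler01. Qed.

Lemma P_chi0 t : 0 <= t -> {ae leb2, forall xi, sg (p t) xi * chi0 b xi = 0}.
Proof.
move: t; apply: (vanishing_curve LP LA dP (measurable_chi0 Ib hb) chi0_le (sg_chi0 zp)).
move=> t t0; apply: sg_chi0; apply: ae_imp (hartley_eq t0) => xi h b0.
by rewrite h b0 mul0r.
Qed.

Lemma W_chi0 t : 0 <= t -> {ae leb2, forall xi, sg (w t) xi * chi0 b xi = 0}.
Proof.
move: t; apply: (vanishing_curve LW LP dW (measurable_chi0 Ib hb) chi0_le (sg_chi0 zw)).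
by move=> t t0; exact: P_chi0 (ltW t0).
Qed.

Lemma Rint_chi0 u : L2 (sg u) -> {ae leb2, forall xi, sg u xi * chi0 b xi = 0} ->
  \int[leb2]_xi (sg u xi ^+ 2 * chi0 b xi) = 0.
Proof.
move=> Lu h; have mc := measurable_chi0 Ib hb.
rewrite (@Rint_ae _ P2 R leb2 _ (fun=> 0)).
- by rewrite /Rintegral integral0.
- by apply: measurable_funM => //; apply: measurable_funX; case: Lu.
- exact: measurable_cst.
- by apply: ae_imp h => xi; rewrite expr2 -mulrA => ->; rewrite mulr0.
Qed.

Definition tail n u t : R :=
  \int[leb2]_xi (chi b n xi * (hartley u xi * dmul e1 (hartley (flux1 t)) xi)) +
  \int[leb2]_xi (chi b n xi * (hartley u xi * dmul e2 (hartley (flux2 t)) xi)).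

Lemma spcut_eq n u t : 0 < t -> Xreg u ->
  ip (spcut b n u) (spcut b n (a t)) = - flux u t - (2 * pi) ^- 2 * tail n u t.
Proof.
move=> t0 Xu; have [Lg1 Lg2] := L2_flux (ltW t0).
have [I1 E1] := ip_grad a1 Xu Lg1; have [I2 E2] := ip_grad a2 Xu Lg2.
have mc := measurable_chi Ib hb n.
have cb xi : `|chi b n xi| <= 1 by have /andP[h1 h2] := chi_01 b n xi; rewrite ger0_norm.
have J (f : R * R -> R) : L1 f -> L1 (fun xi => chi b n xi * f xi).
  by move=> If; have := L1_bdM mc cb If; under eq_fun do rewrite mulrC.
have J1 := J _ I1; have J2 := J _ I2.
have Lc1 := L2_spcut Ib hb n Xu; have Lc2 := L2_spcut Ib hb n (Ra (ltW t0)).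
set f1 := (fun xi => hartley u xi * _) in I1 E1 J1.
set f2 := (fun xi => hartley u xi * _) in I2 E2 J2.
have IS := L1B (L1D I1 I2) (L1D J1 J2).
have -> : ip (spcut b n u) (spcut b n (a t)) =
    \int[leb2]_xi ((2 * pi) ^- 2 * (f1 xi + f2 xi - (chi b n xi * f1 xi + chi b n xi * f2 xi))).
  apply: Rint_ae; [exact: L1_meas (L2_L1M Lc1 Lc2)|exact: L1_meas (L1Z _ IS)|].
  apply: ae_imp (hartley_eq t0) => xi h.
  rewrite (spcutM hb) h /f1 /f2; congr (_ * _).
  have gen (k B x d1 d2 : R) : (k == 1) || (B != 0) && (k == 0) ->
    (1 - k) / B * (x * (B * (d1 + d2))) = x * d1 + x * d2 - (k * (x * d1) + k * (x * d2)).
    by move=> /orP[/eqP ->|/andP[B0 /eqP ->]]; [ring|field].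
  apply: gen; rewrite /chi; case: (ltP (bhat b xi) n.+1%:R^-1) => hx; first by rewrite eqxx.
  rewrite eqxx andbT; apply/orP; right.
  by rewrite gt_eqF// (lt_le_trans _ hx)// invr_gt0 ltr0n.
rewrite (RintZ _ IS) (RintB (L1D I1 I2) (L1D J1 J2)) (RintD I1 I2) (RintD J1 J2).
have gen (k x1 x2 y1 y2 i1 i2 : R) : k * x1 = - i1 -> k * x2 = - i2 ->
    k * (x1 + x2 - (y1 + y2)) = - (i1 + i2) - k * (y1 + y2).
  by move=> h1 h2; rewrite mulrBr mulrDr h1 h2 opprD.
exact: (gen _ _ _ _ _ _ _ E1 E2).
Qed.

Lemma flux_unif_bounded T : exists K : R, 0 <= K /\ forall t, 0 <= t <= T ->
  ip (flux1 t) (flux1 t) <= K /\ ip (flux2 t) (flux2 t) <= K.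
Proof.
have [M hM] : exists n, forall t, 0 <= t <= T -> bdv leb2 n%:R (wgrad (w t)).
  apply: (@unif_near _ (fun n t => bdv leb2 n%:R (wgrad (w t)))) => t /andP[t0 _].
  exact: bdv_local.
have [L [L0 hL _ _]] := C2_bounds M%:R CF F0 D0.1 D0.2.
have [n1 h1] := unif_bounded T (fun t h => (L2v_wgrad (Rw h)).1)
  (fun t h => (L2v_wgrad (Rp h)).1) (fun t h => dG h a1).
have [n2 h2] := unif_bounded T (fun t h => (L2v_wgrad (Rw h)).2)
  (fun t h => (L2v_wgrad (Rp h)).2) (fun t h => dG h a2).
exists (L ^+ 2 * (2 * (n1%:R + n2%:R))); split.
  by rewrite mulr_ge0 ?sqr_ge0// mulr_ge0// addr_ge0.
move=> t tT; have t0 : 0 <= t by case/andP : tT.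
have [Lg1 Lg2] := L2_flux t0; have [Lw1 Lw2] := L2v_wgrad (Rw t0).
have Iw : L1 (fun z => weakD e1 (w t) z ^+ 2 + weakD e2 (w t) z ^+ 2).
  by apply: L1D; [case: Lw1|case: Lw2].
have II f : \int[leb2]_z f z ^+ 2 = ip f f.
  by congr Rintegral; apply/funext => z; rewrite expr2.
have key g : L2 g -> {ae leb2, forall z, `|g z| <= L * norm1 (wgrad (w t) z)} ->
    ip g g <= L ^+ 2 * (2 * (n1%:R + n2%:R)).
  move=> Lg hg.
  apply: (@le_trans _ _ (\int[leb2]_z (L ^+ 2 * (2 * (weakD e1 (w t) z ^+ 2 + weakD e2 (w t) z ^+ 2))))).
    apply: Rint_le_ae; [exact: L2_L1M|by apply: L1Z; exact: L1Z|].
    apply: ae_imp hg => z h; rewrite -expr2 -(real_normK (num_real (g z))).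
    apply: (@le_trans _ _ ((L * norm1 (wgrad (w t) z)) ^+ 2)).
      rewrite ler_pXn2r// nnegrE//; exact: le_trans h.
    by rewrite exprMn ler_wpM2l ?sqr_ge0//; exact: norm1_sqr_bound.
  rewrite (RintZ _ (L1Z 2 Iw)) (RintZ _ Iw) ler_wpM2l ?sqr_ge0// ler_wpM2l//.
  rewrite RintD; [|by case: Lw1|by case: Lw2].
  apply: lerD; [apply: (le_trans _ (h1 _ tT))|apply: (le_trans _ (h2 _ tT))];
    rewrite le_eqVlt; apply/orP; left; apply/eqP; exact: II.
by split; [apply: (key _ Lg1)|apply: (key _ Lg2)]; apply: ae_imp (hM _ tT) => z /hL[].
Qed.

Lemma tail_small T (eta : R) : 0 < eta -> exists n, forall t, 0 < t <= T ->
  `|(2 * pi) ^- 2 * tail n (p t) t| <= eta /\ `|(2 * pi) ^- 2 * tail n (w t) t| <= eta.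
Proof.
move=> eta0; have [K [K0 hK]] := flux_unif_bounded T.
have P0 : 0 < (2 * pi) ^+ 2 :> R by rewrite exprn_gt0// mulr_gt0// pi_gt0.
set P := (2 * pi) ^+ 2 in P0 *.
pose delta := P * (eta / 2) ^+ 2 / (K + 1).
have K1 : 0 < K + 1 by rewrite ltr_wpDl.
have delta0 : 0 < delta by rewrite divr_gt0// mulr_gt0// exprn_gt0// divr_gt0.
have [n1 h1] := unif_tail T LP LA dP (measurable_chi Ib hb) (measurable_chi0 Ib hb)
  (chi_01 b) (chi_cvg hb) (fun t h => Rint_chi0 (LP h) (P_chi0 h)) delta0.
have [n2 h2] := unif_tail T LW LP dW (measurable_chi Ib hb) (measurable_chi0 Ib hb)
  (chi_01 b) (chi_cvg hb) (fun t h => Rint_chi0 (LW h) (W_chi0 h)) delta0.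
exists (maxn n1 n2) => t /andP[t0 tT].
have tT' : 0 <= t <= T by rewrite (ltW t0).
have [k1 k2] := hK _ tT'; have [Lg1 Lg2] := L2_flux (ltW t0).
have I u n : L2 (sg u) -> L1 (fun xi => sg u xi ^+ 2 * chi b n xi).
  move=> [mu_ Iu]; apply: (@L1_bdM _ P2 R leb2 _ _ 1 (measurable_chi Ib hb n) _ Iu) => xi.
  by have /andP[? ?] := chi_01 b n xi; rewrite ger0_norm.
have mono u n : L2 (sg u) -> (n <= maxn n1 n2)%N ->
    \int[leb2]_xi (sg u xi ^+ 2 * chi b n xi) <= delta ->
    \int[leb2]_xi (sg u xi ^+ 2 * chi b (maxn n1 n2) xi) <= delta.
  move=> Lu nn; apply: le_trans; apply: Rint_le; [exact: I|exact: I|] => xi.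
  by rewrite ler_wpM2l ?sqr_ge0// chi_mono.
have half (x : R) G : 0 <= G <= K -> (forall D, D <= delta -> x ^+ 2 <= P * G * D -> `|P^-1 * x| <= eta / 2).
  move=> /andP[G0 GK] D Dd h.
  have eta2 : 0 <= eta / 2 by rewrite ltW// divr_gt0.
  rewrite -(ler_pXn2r (n := 2))// ?nnegrE// real_normK ?num_real// exprMn exprVn.
  have PP : 0 < P ^+ 2 by exact: exprn_gt0.
  rewrite (ler_pdivrMl _ _ PP); apply: (le_trans h).
  apply: (@le_trans _ _ (P * K * delta)).
    apply: (@le_trans _ _ (P * G * delta)).
      by rewrite ler_wpM2l// mulr_ge0// ltW.
    by rewrite ler_wpM2r ?(ltW delta0)// ler_wpM2l// ltW.
  have -> : P * K * delta = P ^+ 2 * (eta / 2) ^+ 2 * (K / (K + 1)).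
    by rewrite /delta; set E := (eta / 2) ^+ 2; field; rewrite gt_eqF.
  apply: ler_piMr; first exact: mulr_ge0 (sqr_ge0 _) (sqr_ge0 _).
  rewrite (ler_pdivrMr _ _ K1) mul1r lerDl; exact: ler01.
have main u : Xreg u -> \int[leb2]_xi (sg u xi ^+ 2 * chi b (maxn n1 n2) xi) <= delta ->
    `|P^-1 * tail (maxn n1 n2) u t| <= eta.
  move=> Xu hu; rewrite /tail mulrDr; apply: (le_trans (ler_normD _ _)).
  rewrite [leRHS](_ : _ = eta / 2 + eta / 2); last by field.
  have t1 := tail_bound Ib hb (maxn n1 n2) a1 Xu Lg1.
  have t2 := tail_bound Ib hb (maxn n1 n2) a2 Xu Lg2.
  rewrite -/P in t1 t2.
  have q1 : 0 <= ip (flux1 t) (flux1 t) <= K by rewrite k1 andbT; exact: ip_ge0.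
  have q2 : 0 <= ip (flux2 t) (flux2 t) <= K by rewrite k2 andbT; exact: ip_ge0.
  by apply: lerD; [exact: (half _ _ q1 _ hu t1)|exact: (half _ _ q2 _ hu t2)].
split; apply: main.
- exact: Rp (ltW t0).
- exact: mono (LP (ltW t0)) (leq_maxl _ _) (h1 _ tT').
- exact: Rw (ltW t0).
- exact: mono (LW (ltW t0)) (leq_maxr _ _) (h2 _ tT').
Qed.

Lemma spcut_rdq n (U V : R -> R * R -> R) t : 0 <= t ->
  (forall t, 0 <= t -> Xreg (U t)) -> (forall t, 0 <= t -> Xreg (V t)) ->
  l2_rdq leb2 (fun t => sg (U t)) (fun t => sg (V t)) t ->
  l2_rdq leb2 (fun t => spcut b n (U t)) (fun t => spcut b n (V t)) t.
Proof.
move=> t0 RU RV h.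
have LU s : 0 <= s -> L2 (sg (U s)) by move=> /RU[Lu Iu _ _]; exact: L2_sg Lu Iu.
have LV s : 0 <= s -> L2 (sg (V s)) by move=> /RV[Lu Iu _ _]; exact: L2_sg Lu Iu.
exact: (l2_rdq_mul LU LV t0 (measurable_kap Ib hb n) (kap_bound b n) h).
Qed.

Definition qform n u v : R := ip (spcut b n u) (spcut b n v).

Lemma rdq_qform n (U1 V1 U2 V2 : R -> R * R -> R) t : 0 <= t ->
  (forall t, 0 <= t -> Xreg (U1 t)) -> (forall t, 0 <= t -> Xreg (V1 t)) ->
  (forall t, 0 <= t -> Xreg (U2 t)) -> (forall t, 0 <= t -> Xreg (V2 t)) ->
  l2_rdq leb2 (fun t => sg (U1 t)) (fun t => sg (V1 t)) t ->
  l2_rdq leb2 (fun t => sg (U2 t)) (fun t => sg (V2 t)) t ->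
  rdq (fun t => qform n (U1 t) (U2 t)) (qform n (V1 t) (U2 t) + qform n (U1 t) (V2 t)) t.
Proof.
move=> t0 RU1 RV1 RU2 RV2 h1 h2.
have L U : (forall t, 0 <= t -> Xreg (U t)) -> forall t, 0 <= t -> L2 (spcut b n (U t)).
  by move=> RU s s0; exact: (L2_spcut Ib hb n (RU s s0)).
exact: (rdq_ip (L _ RU1) (L _ RV1) (L _ RU2) (L _ RV2) t0
  (spcut_rdq n t0 RU1 RV1 h1) (spcut_rdq n t0 RU2 RV2 h2)).
Qed.

Let Q_CS_shift (A B D be x : R) : D ^+ 2 <= A * B -> 0 <= A -> 0 <= B -> 0 < be ->
  (D + be * x) ^+ 2 <= (A + be * x ^+ 2) * (B + be).
Proof.
move=> h A0 B0 be0.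
have k : 2 * (D * x) <= A + x ^+ 2 * B.
  rewrite leNgt; apply/negP => h2.
  have s0 : 0 <= A + x ^+ 2 * B by rewrite addr_ge0// mulr_ge0// sqr_ge0.
  have : (A + x ^+ 2 * B) ^+ 2 < (2 * (D * x)) ^+ 2.
    by rewrite ltr_pXn2r// nnegrE// ltW// (le_lt_trans s0).
  apply/negP; rewrite -leNgt.
  have := ler_wpM2r (sqr_ge0 x) h; have := sqr_ge0 (A - x ^+ 2 * B); nra.
have := ler_wpM2l (ltW be0) k; lra.
Qed.

Let slope_arith (x y z k : R) : x <= k -> k <= z -> - x <= y -> z <= y + 2 * z.
Proof. lra. Qed.

Let concavity_arith (qa qp ph be eta al : R) : 0 < al -> 0 < be -> eta <= be ->
  - (2 * (1 + 2 * al) * ph) - eta <= qa -> 2^-1 * qp + ph <= - (2 * be) + be ->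
  4 * (1 + al) * (qp + be) <= 2 * (qp + qa) + be * 2.
Proof.
move=> al0 be0 eb Qa E; have N0 : 0 < 2 * (1 + 2 * al) by lra.
have := ler_wpM2l (ltW N0) E; have := mulr_gt0 al0 be0; lra.
Qed.

Let levine_arith (al x y z : R) : 0 < al -> x ^+ 2 <= y * z ->
  (1 + al) * (2 * x) ^+ 2 <= y * (4 * (1 + al) * z).
Proof.
move=> al0 h; have k0 : 0 <= 4 * (1 + al) by rewrite mulr_ge0// addr_ge0// ltW.
apply: le_trans (le_trans (_ : _ <= 4 * (1 + al) * x ^+ 2) (ler_wpM2l k0 h)) _;
  by rewrite le_eqVlt; apply/orP; left; apply/eqP; ring.
Qed.

Lemma no_global_curve :
  L1 (fun xi => (bhat b xi)^-1 * hartley (w 0) xi ^+ 2) ->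
  L1 (fun xi => (bhat b xi)^-1 * hartley (p 0) xi ^+ 2) ->
  2^-1 * ((2 * pi) ^- 2 * \int[leb2]_xi ((bhat b xi)^-1 * hartley (p 0) xi ^+ 2)) + pot 0 < 0 ->
  False.
Proof.
move=> Iw Ip; set Ep := (2 * pi) ^- 2 * _ => E00.
have h00 : (0 : R) <= 0 by [].
pose Ew : R := (2 * pi) ^- 2 * \int[leb2]_xi ((bhat b xi)^-1 * hartley (w 0) xi ^+ 2).
have iP0 : 0 <= (2 * pi) ^- 2 :> R by rewrite invr_ge0 sqr_ge0.
have Ew0 : 0 <= Ew.
  apply: mulr_ge0 => //; apply: Rint_ge0 => xi.
  by apply: mulr_ge0 (sqr_ge0 _); rewrite invr_ge0; exact: bhat_ge0 hb xi.
have Ep0 : 0 <= Ep.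
  apply: mulr_ge0 => //; apply: Rint_ge0 => xi.
  by apply: mulr_ge0 (sqr_ge0 _); rewrite invr_ge0; exact: bhat_ge0 hb xi.
have QEw n : qform n (w 0) (w 0) <= Ew by exact: (spcut_energy_le Ib hb n (Rw h00) Iw).
have QEp n : qform n (p 0) (p 0) <= Ep by exact: (spcut_energy_le Ib hb n (Rp h00) Ip).
move: Ew Ep Ew0 Ep0 QEw QEp E00 => Ew Ep Ew0 Ep0 QEw QEp.
pose E0 := 2^-1 * Ep + pot 0; rewrite -/E0 => E00.
pose be := - E0 / 2; have be0 : 0 < be by rewrite /be divr_gt0// oppr_gt0.
pose K := Ew + Ep; have K0 : 0 <= K by exact: (addr_ge0 Ew0 Ep0).
pose t0 : R := 1 + K / be.
have t01 : 1 <= t0 by rewrite /t0 lerDl divr_ge0// ltW.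
have bt0 : K <= be * t0 by rewrite /t0 mulrDr mulr1 mulrCA divff ?gt_eqF// mulr1 lerDr ltW.
pose T : R := (1 + t0) / nu.
have T0 : 0 < T by rewrite divr_gt0// addr_gt0// (lt_le_trans ltr01).
pose eta := be / (1 + T).
have T1 : 0 < 1 + T by exact: addr_gt0.
have eta0 : 0 < eta by rewrite divr_gt0.
have etab : eta <= be by rewrite /eta ler_pdivrMr// ler_peMr ?(ltW be0)// lerDl ltW.
have etaT : eta * T <= be.
  by rewrite /eta mulrAC ler_pdivrMr// ler_wpM2l ?(ltW be0)// lerDr.
have [n hn] := tail_small T eta0.
have LS u : Xreg u -> L2 (spcut b n u) by move=> Xu; exact: (L2_spcut Ib hb n Xu).
have Qge0 u : 0 <= qform n u u by exact: ip_ge0.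
have QC u v : qform n u v = qform n v u by exact: ipC.
pose en t := 2^-1 * qform n (p t) (p t) + pot t.
have den t : 0 <= t -> rdq en (qform n (p t) (a t) + flux (p t) t) t.
  move=> tt; have d := rdqD (rdqZ (c := 2^-1) (rdq_qform (n := n) tt Rp Ra Rp Ra (dP tt) (dP tt))) (rdq_pot tt).
  refine (@rdq_eq _ en _ _ _ d _).
  by rewrite (QC (a t)); congr (_ + _); field.
have en_le t : 0 <= t <= T -> en t <= E0 + be.
  move=> /andP[tt tT].
  have h : forall s, 0 < s <= T -> qform n (p s) (a s) + flux (p s) s <= eta.
    move=> s sT; have [h _] := hn s sT; have /andP[s0 _] := sT.
    move: h; rewrite /qform (spcut_eq n s0 (Rp (ltW s0))) => h'.
    by rewrite addrAC addNr add0r; apply: le_trans h'; rewrite -normrN; exact: ler_norm.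
  have := rdq_le_affine den h; move=> /(_ t); rewrite tt tT => /(_ isT) h1.
  apply: (le_trans h1); apply: lerD.
    rewrite /en /E0 lerD2r ler_wpM2l ?invr_ge0//.
  by apply: le_trans etaT; rewrite ler_wpM2l// ltW.
pose h t := qform n (w t) (w t) + be * (t + t0) ^+ 2.
pose h1 t := 2 * qform n (w t) (p t) + be * (2 * (t + t0)).
pose h2 t := 2 * (qform n (p t) (p t) + qform n (w t) (a t)) + be * 2.
have dh t : 0 <= t -> rdq h (h1 t) t.
  move=> tt; have d := rdqD (rdq_qform (n := n) tt Rw Rp Rw Rp (dW tt) (dW tt)) (rdqZ (c := be) (@rdq_sqr_shift R t0 t)).
  refine (@rdq_eq _ h _ _ _ d _).
  by rewrite (QC (p t)) /h1; congr (_ + _); ring.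
have dh1 t : 0 <= t -> rdq h1 (h2 t) t.
  move=> tt; have d1 := rdqZ (c := 2) (rdq_qform (n := n) tt Rw Rp Rp Ra (dW tt) (dP tt)).
  have d2 := rdqZ (c := be) (rdqZ (c := 2) (@rdq_shift R t0 t)).
  refine (@rdq_eq _ h1 _ _ _ (rdqD d1 d2) _).
  by rewrite mulr1.
have t0p : 0 < t0 by exact: lt_le_trans t01.
have hpos t : 0 <= t <= T -> 0 < h t.
  move=> /andP[tt _]; rewrite /h ltr_wpDl// mulr_gt0// exprn_gt0// ltr_wpDl//.
have QK : qform n (w 0) (w 0) + qform n (p 0) (p 0) <= K.
  by apply: lerD; [exact: QEw|exact: QEp].
have Qwp : 2 * `|qform n (w 0) (p 0)| <= K.
  apply: le_trans QK; exact: ip_abs_le (LS _ (Rw h00)) (LS _ (Rp h00)).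
have h1lo : be * t0 <= h1 0.
  rewrite /h1 add0r; have : - (2 * `|qform n (w 0) (p 0)|) <= 2 * qform n (w 0) (p 0).
    by rewrite -mulrN ler_wpM2l// lerNl -normrN; exact: ler_norm.
  have -> : be * (2 * t0) = 2 * (be * t0) by rewrite mulrCA.
  exact: (slope_arith Qwp bt0).
have bt0p : 0 < be * t0 by exact: mulr_gt0.
have h10 : 0 < h1 0 by exact: lt_le_trans h1lo.
have h0le : h 0 / h1 0 <= nu * T.
  rewrite ler_pdivrMr// /T mulrCA divff ?gt_eqF// mulr1.
  apply: (@le_trans _ _ ((1 + t0) * (be * t0))); last first.
    by rewrite ler_wpM2l// addr_ge0// ltW.
  rewrite /h add0r mulrDl mul1r; apply: lerD.
    by apply: le_trans bt0; apply: le_trans QK; rewrite lerDl.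
  by rewrite expr2 mulrCA.
apply: (levine_ode nu0 T0 dh dh1 hpos h10 h0le) => t /andP[t1 tT].
have tt := ltW t1; have tT' : 0 <= t <= T by rewrite tt ltW.
have CS : qform n (w t) (p t) ^+ 2 <= qform n (w t) (w t) * qform n (p t) (p t).
  exact: ip_CS (LS _ (Rw tt)) (LS _ (Rp tt)).
have CS2 : (qform n (w t) (p t) + be * (t + t0)) ^+ 2 <= h t * (qform n (p t) (p t) + be).
  exact: Q_CS_shift (t + t0) CS (Qge0 _) (Qge0 _) be0.
have hp : 0 < h t by exact: hpos.
have key : 4 * (1 + nu) * (qform n (p t) (p t) + be) <= h2 t.
  have tT2 : 0 < t <= T by rewrite t1 ltW.
  have [_ tl] := hn t tT2.
  have Qwa : - (2 * (1 + 2 * nu) * pot t) - eta <= qform n (w t) (a t).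
    rewrite /qform (spcut_eq n t1 (Rw tt)); apply: lerD.
      by rewrite lerN2; exact: flux_le.
    by rewrite lerN2; apply: le_trans tl; exact: ler_norm.
  have E := en_le _ tT'; rewrite /en in E.
  have E0be : E0 = - (2 * be) by rewrite /be; field.
  rewrite E0be in E; exact: (concavity_arith nu0 be0 etab Qwa E).
apply: (@le_trans _ _ (h t * (4 * (1 + nu) * (qform n (p t) (p t) + be)))); last first.
  by rewrite ler_wpM2l// ltW.
have -> : h1 t = 2 * (qform n (w t) (p t) + be * (t + t0)) by rewrite /h1; ring.
exact: (levine_arith nu0 CS2).
Qed.

End Concavity.

Section GlobalSolutions.
Context (R : realType).
Notation P2 := (measurableTypeR R * measurableTypeR R)%type.

Lemma time_interval_oo : time_interval (+oo : \bar R)%E = halfline.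
Proof. by apply/funext => t; apply/propext; split => [[]|] //= t0; split => //; rewrite ltry. Qed.

Lemma no_global_solution (s r C : R) (beta F phi psi : R * R -> R) (v : R -> R * R -> R) :
  1 <= s -> 2 <= r -> leb2.-integrable setT (EFin \o beta) -> 0 < C -> kernel_decay beta C r ->
  Ck 2 F -> F (0, 0) = 0 -> in_Xs s phi -> in_Xs s psi ->
  Rop_in_L2 beta phi -> Rop_in_L2 beta psi ->
  (exists2 nu : R, 0 < nu & forall U : R * R,
     U.1 * 'D_e1 F U + U.2 * 'D_e2 F U <= 2 * (1 + 2 * nu) * F U) ->
  energy0 beta F phi psi < 0 -> ~ global_solution beta F s phi psi v.
Proof.
move=> s1 r2 Ib C0 hb CF F0 Xphi Xpsi Rphi Rpsi [nu nu0 hnu] E0 [p [a [hX [dv dp _] v0 p0 heq]]].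
rewrite /Xderiv time_interval_oo in hX dv dp.
have Xv t : 0 <= t -> in_Xs s (v t) by move=> /hX[].
have Xp t : 0 <= t -> in_Xs s (p t) by move=> /hX[].
have Xa t : 0 <= t -> in_Xs s (a t) by move=> /hX[].
have Rv t : 0 <= t -> Xreg (v t) by move=> /Xv; exact: in_Xs_reg.
have Rp t : 0 <= t -> Xreg (p t) by move=> /Xp; exact: in_Xs_reg.
have Ra t : 0 <= t -> Xreg (a t) by move=> /Xa; exact: in_Xs_reg.
have h00 : (0 : R) <= 0 by [].
have qv t (t0 : 0 <= t) := Xnorm_quo s1 Xv Xp t0 (dv t t0).
have qp t (t0 : 0 <= t) := Xnorm_quo s1 Xp Xa t0 (dp t t0).
have [Lv0 _ wv0 _] := Rv _ h00; have [Lp0 _ _ _] := Rp _ h00.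
have [Lphi _ wphi _] := in_Xs_reg s1 Xphi; have [Lpsi _ _ _] := in_Xs_reg s1 Xpsi.
have v0' : {ae leb2, forall z, v 0 z = phi z} by apply: ae_imp v0 => z h; exact: h.
have p0' : {ae leb2, forall z, p 0 z = psi z} by apply: ae_imp p0 => z h; exact: h.
have Hv0 : hartley (v 0) = hartley phi := hartley_eq_ae Lv0.1 Lphi.1 v0'.
have Hp0 : hartley (p 0) = hartley psi := hartley_eq_ae Lp0.1 Lpsi.1 p0'.
have [Iphi _] := Rop_energy Ib hb Rphi; have [Ipsi Epsi] := Rop_energy Ib hb Rpsi.
have pot0 : pot F v 0 = \int[leb2]_z F (wgrad phi z).
  have weq e : axis e -> {ae leb2, forall z, weakD e (v 0) z = weakD e phi z}.
    move=> ae_; apply: (weak_deriv_unique _ (wphi _ ae_)).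
    exact: weak_deriv_ae ae_ Lphi.1 v0' (wv0 _ ae_).
  have [cF _] := CF.
  apply: Rint_ae.
  - exact: (measurable_comp_plane cF (L2v_wgrad (Rv _ h00))).
  - exact: (measurable_comp_plane cF (L2v_wgrad (in_Xs_reg s1 Xphi))).
  - by apply: ae_imp2 (weq _ (or_introl erefl)) (weq _ (or_intror erefl)) => z x1 x2; rewrite /wgrad x1 x2.
apply: (@no_global_curve R beta C r Ib hb C0 r2 F nu CF F0 nu0 hnu v p a Rv Rp Ra).
- by move=> t t0; have [] := qv _ t0.
- by move=> t t0; have [] := qp _ t0.
- by move=> t e t0 ae_; have [_ h _] := qv _ t0; exact: h.
- by move=> t e t0 ae_; have [_ _ h] := qv _ t0; exact: h.
- by move=> t t0 theta tt; exact: (heq t t0 (ltry t) theta tt).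
- by rewrite Hv0; exact: (Rop_hartley_eq0 hb Rphi).
- by rewrite Hp0; exact: (Rop_hartley_eq0 hb Rpsi).
- rewrite Hv0; exact: Iphi.
- rewrite Hp0; exact: Ipsi.
- rewrite Hp0 -Epsi pot0; exact: E0.
Qed.

End GlobalSolutions.

Theorem mainTheorem10 (R : realType) (s r C : R) (beta : R * R -> R)
    (F : R * R -> R) (phi psi : R * R -> R)
    (Tmax : \bar R) (w : R -> R * R -> R)
    (hsr : (2 < s /\ 2 <= r) \/ (1 <= s /\ 3 < r))
    (beta_int : leb2.-integrable setT (EFin \o beta))
    (hC : 0 < C)
    (beta_decay : kernel_decay beta C r)
    (hF : Ck (Num.truncn s).+1 F)
    (hF0 : F (0, 0) = 0)
    (hphi : in_Xs s phi)
    (hpsi : in_Xs s psi)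
    (hw : maximal_solution beta F s phi psi Tmax w)
    (hRphi : Rop_in_L2 beta phi)
    (hRpsi : Rop_in_L2 beta psi)
    (hFphi : leb2.-integrable setT (fun z => (F (wgrad phi z))%:E))
    (hnu : exists2 nu : R, 0 < nu &
       forall U : R * R,
         U.1 * 'D_e1 F U + U.2 * 'D_e2 F U <= 2 * (1 + 2 * nu) * F U)
    (hE0 : energy0 beta F phi psi < 0) :
  (Tmax < +oo)%E /\
  ~ (exists v : R -> R * R -> R, global_solution beta F s phi psi v).
Proof.
have s1 : 1 <= s by case: hsr => -[h _] //; lra.
have r2 : 2 <= r by case: hsr => -[_ h] //; lra.
have C2 : Ck 2 F.
  by apply: Ck_le hF; rewrite ltnS truncn_ge_nat ?(le_trans ler01).
have nog v : ~ global_solution beta F s phi psi v.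
  exact: (no_global_solution s1 r2 beta_int hC beta_decay C2 hF0 hphi hpsi hRphi hRpsi hnu hE0).
split; last by move=> [v /nog].
rewrite ltey; apply/eqP => Too.
by have [_ sol _] := hw; apply: (nog w); rewrite /global_solution -Too.
Qed.
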